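(* Let $c>0$ and $\alpha\ge\frac12$ be real numbers. Then for any $0<a<\frac{8}{e}$ there exists a constant $M_a$ such that $$\lambda_{n,\alpha}(c)\le e^{-4n\log\left(\frac{an}{c}\right)}\qquad\text{for all integers } n\ge cM_a .$$
   Context: $J_\alpha$ denotes the Bessel function of the first kind of order $\alpha$. For $c>0$, $\alpha>-\frac12$, the finite Hankel transform operator $\mathcal H_c^{\alpha}$ is the compact self-adjoint operator on $L^2(0,1)$ given by $\mathcal H_c^{\alpha}(f)(x)=\int_0^1\sqrt{cxt}\,J_\alpha(cxt)f(t)\,dt$. Let $\mathcal Q_c^{\alpha}=c\,\mathcal H_c^{\alpha}\mathcal H_c^{\alpha}$, a compact positive self-adjoint operator, and let $(\lambda_{n,\alpha}(c))_{n\ge0}$ be its eigenvalues arranged in decreasing order. (Equivalently $\lambda_{n,\alpha}(c)=c\,|\mu_{n,\alpha}(c)|^2$, where $(\mu_{n,\alpha}(c))_{n\ge0}$ are the eigenvalues of $\mathcal H_c^\alpha$ in decreasing order of magnitude.) *)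

(* Defs.v *)
From mathcomp Require Import all_boot all_order all_algebra.
From mathcomp Require Import all_classical all_reals all_analysis.

Set Implicit Arguments.
Unset Strict Implicit.
Unset Printing Implicit Defensive.

Import Order.TTheory GRing.Theory Num.Theory.
Import numFieldNormedType.Exports.

Local Open Scope classical_set_scope.
Local Open Scope ring_scope.

Section Bessel.
Context {R : realType}.

(* Euler's integral; meaningful for s > 0. *)
Definition Gamma (s : R) : R :=
  \int[@lebesgue_measure R]_(t in `]0, +oo[) (t `^ (s - 1) * expR (- t)).

(* The defining power series of J_alpha(x), meaningful for alpha > -1 (so that
   all the Gamma values are given by Euler's integral) and x > 0. *)
Definition besselJ (alpha x : R) : R :=
  limn (series (fun m : nat =>
    (-1) ^+ m / (m`!%:R * Gamma (m%:R + alpha + 1)) *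
    (x / 2) `^ (2 * m%:R + alpha))).

End Bessel.

Section L2.
Context {R : realType}.

Definition unit_measure : {measure set (measurableTypeR R) -> \bar R} :=
  mrestr (@lebesgue_measure R) (measurable_itv `]0 : R, 1[).

(* Elements of L^2(0,1) are represented by (Borel) functions on the line that
   are square-integrable for Lebesgue measure restricted to ]0, 1[; equality in
   L^2(0,1) is equality almost everywhere for that measure. *)
Definition L2 : {pred R -> R} := Lfun unit_measure 2%:E.

Definition L2_eigenfunction (T : (R -> R) -> R -> R) (mu : R) (f : R -> R) :=
  f \in L2 /\ T f = (fun x => mu * f x) %[ae unit_measure].

Definition L2_free (k : nat) (F : 'I_k -> R -> R) :=
  forall a : 'I_k -> R,
    (fun x => \sum_(i < k) a i * F i x) = (fun=> 0) %[ae unit_measure] ->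
    forall i, a i = 0.

(* lam lists the eigenvalues of T on L^2(0,1) in decreasing order, each one
   repeated according to its multiplicity: for all real mu, the number of
   indices i with lam i = mu is the dimension of the mu-eigenspace of T (at
   mu = 0 included, so 0 is listed only if it is an eigenvalue). *)
Definition decreasing_eigenvalues (T : (R -> R) -> R -> R) (lam : nat -> R) :=
  nonincreasing_seq lam /\
  forall (mu : R) (k : nat),
    (exists s : seq nat,
      [/\ size s = k, uniq s & forall i, i \in s -> lam i = mu]) <->
    (exists F : 'I_k -> R -> R,
      (forall i, L2_eigenfunction T mu (F i)) /\ L2_free F).

End L2.

Section Hankel.
Context {R : realType}.

Definition hankel (c alpha : R) (f : R -> R) : R -> R := fun x =>
  \int[@lebesgue_measure R]_(t in `]0, 1[)
    (Num.sqrt (c * x * t) * besselJ alpha (c * x * t) * f t).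

Definition hankelQ (c alpha : R) (f : R -> R) : R -> R := fun x =>
  c * hankel c alpha (hankel c alpha f) x.

End Hankel.

(* Main.v *)
From HB Require Import structures.
Require Import Defs.
From mathcomp Require Import all_boot all_order all_algebra.
From mathcomp Require Import all_classical all_reals all_analysis.
From mathcomp Require Import measurable_realfun ring lra zify.

Set Implicit Arguments.
Unset Strict Implicit.
Unset Printing Implicit Defensive.

Import Order.TTheory GRing.Theory Num.Theory.
Import numFieldNormedType.Exports.

Local Open Scope classical_set_scope.
Local Open Scope ring_scope.

(* Expanding the Bessel kernel gives sqrt(cxt) J_al(cxt) = sum_m k_m phi_m(x) phi_m(t)
   with phi_m(x) = x^(2m + al + 1/2), so every eigenfunction of Q = c H^2 with nonzero
   eigenvalue is almost everywhere a series sum_m a_m phi_m with rapidly decreasing a;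
   with u = x^2, a is the sequence of coefficients of an entire function of u, and L^2(0,1)
   becomes L^2(u^al du) on [0, 1].  There H commutes with the self-adjoint operator
   D = -(u(1-u) d^2 + (al+1-(al+2)u) d) + kap u, where kap = c^2/4, whose kap = 0 part has
   the eigenvalues e_n = n(n+al+1) and Jacobi polynomials pi_n as eigenvectors.

   Let E be the span of the eigenspaces of Q for the values lam_0, ..., lam_n, of dimension
   > n.  It is finite-dimensional and D-invariant, so the maximiser psi on E of the Rayleigh
   quotient of D satisfies D psi = chi psi, and chi >= e_n because E meets the orthogonal
   complement of the polynomials of degree < n.  The spectrum of D is simple, hence
   H psi = mu psi, and c mu^2 >= lam_n.  It remains to bound mu = (k_0/2) <psi, 1> / psi(0):
   a Pohozaev identity bounds psi(0) below by the norm of psi, and the three-term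
   recurrence of M_j = <psi, pi_j> forces |M_j| to grow by a factor about (chi - e_j)/kap at
   each step while M_J is at most |pi_J| |psi| by Cauchy-Schwarz, with |pi_J|^2 = O(16^-J), so
   that M_0 = <psi, 1> is tiny.  Taking J close to n and
   prod_(i<n) (e_n - e_i) >= (2n)! >= (2n/e)^(2n) gives the rate (ec/(8n))^(4n) up to
   factors absorbed by a < 8/e. *)

(** * Power integrals and the Gamma function *)

(** On coefficient sequences of entire functions every pairing is an absolutely convergent double
    series, and the symmetry of D is an algebraic identity: u(1 - u) vanishes at both ends, so no
    boundary condition arises and no spectral theory of an unbounded operator is called for. The
    main obstacle is order: the n-th eigenvalue of D would have to be matched with the n-th of Q.
    The span E avoids this, because one vector serves both sides: as top vector of D on E it has chi
    >= e_n, and as a mere element of E it has c |H psi|^2 >= lam_n |psi|^2. The growth of |M_j|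
    needs a gap chi - e_j of at least 3 kap, which is not guaranteed for j near n; hence J = n - r
    with r about c^2 / (2 [e] n), where [e] <= 1/2 is a parameter fixed by a alone. As M_a may
    depend neither on c nor on al, all bounds are uniform in al: the gaps e_n - e_i and the
    recurrence coefficients are compared with their values at al = 0, and Gamma(al + 1) >= (c/2)^al
    exp(-c/2) controls k_0. *)

Section Power_integrals.
Context {R : realType}.
Notation mu := (@lebesgue_measure R).
Local Notation I01 := (`]0%R, 1%R[%classic : set R).

Lemma continuous_powR (s x : R) : 0 < x -> {for x, continuous (fun t => t `^ s)}.
Proof.
move=> x0; apply/differentiable_continuous/derivable1_diffP.
by apply: derivable_powR; rewrite in_itv/= andbT.
Qed.

Lemma within_continuous_powR (s b : R) : 0 < s ->
  {within `[0, b], continuous (fun t : R => t `^ s)}.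
Proof.
move=> s0; case: (ltP 0 b) => [b0|b0].
  apply/(continuous_within_itvP _ b0); split.
  - by move=> x; rewrite in_itv/= => /andP[x0 _]; exact: continuous_powR.
  - by rewrite powR0 ?gt_eqF//; exact: powR_cvg0.
  - by apply: cvg_at_left_filter; exact: continuous_powR.
move: b0; rewrite le_eqVlt => /predU1P[->|b0].
  by rewrite set_itv1; exact: continuous_subspace1.
by rewrite set_itv_ge ?bnd_simp -?ltNge//; exact: continuous_subspace0.
Qed.

Lemma integral_powR01_gt0 (s : R) : 0 < s ->
  (\int[mu]_(t in `]0%R, 1%R[) (t `^ s)%:E = ((s + 1)^-1)%:E)%E.
Proof.
move=> s0; have s10 : 0 < s + 1 by lra.
have cs := @within_continuous_powR s 1 s0.
have mf : measurable_fun I01 (fun t : R => t `^ s).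
  exact: measurable_funTS.
rewrite integral_itv_bndo_bndc; last exact/measurable_EFinP.
rewrite integral_itv_obnd_cbnd; last first.
  by apply/measurable_EFinP; exact: measurable_funTS.
rewrite (@continuous_FTC2 _ _ (fun t => (s + 1)^-1 * t `^ (s + 1)))//.
- by rewrite powR1 powR0 ?gt_eqF// mulr1 mulr0 sube0.
- split.
  + move=> x; rewrite in_itv/= => /andP[x0 _].
    by apply: derivableM => //; apply: derivable_powR; rewrite in_itv/= andbT.
  + rewrite powR0 ?gt_eqF//; apply: cvgM; first exact: cvg_cst.
    exact: powR_cvg0.
  + apply: cvgM; first exact: cvg_cst.
    by apply: cvg_at_left_filter; exact: continuous_powR.
- move=> x; rewrite in_itv/= => /andP[x0 _].
  have xd : derivable (fun t : R => t `^ (s + 1)) x 1.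
    by apply: derivable_powR; rewrite in_itv/= andbT.
  rewrite derive1E deriveM//= derive_cst scaler0 addr0 -derive1E.
  rewrite powR_derive1 ?in_itv/= ?andbT// addrK.
  by rewrite /GRing.scale/= mulrA mulVf ?mul1r// gt_eqF.
Qed.

Lemma integral_powR01 (s : R) : 0 <= s ->
  (\int[mu]_(t in `]0%R, 1%R[) (t `^ s)%:E = ((s + 1)^-1)%:E)%E.
Proof.
rewrite le_eqVlt => /predU1P[<-|]; last exact: integral_powR01_gt0.
under eq_integral do rewrite powRr0.
by rewrite integral_cst//= lebesgue_measure_itv/= lte_fin ltr01 sube0 mule1 add0r invr1.
Qed.

Lemma integrable_powR01 (s : R) : 0 <= s ->
  mu.-integrable `]0, 1[ (fun t => (t `^ s)%:E).
Proof.
move=> s0; apply/integrableP; split.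
  by apply/measurable_EFinP; exact: measurable_funTS.
under eq_integral do rewrite abse_EFin ger0_norm ?powR_ge0//.
by rewrite integral_powR01// ltry.
Qed.

Lemma Rintegral_powR01 (s : R) : 0 <= s ->
  \int[mu]_(t in `]0, 1[) (t `^ s) = (s + 1)^-1.
Proof. by move=> s0; rewrite /Rintegral integral_powR01. Qed.

End Power_integrals.

Section Gamma_function.
Context {R : realType}.
Notation mu := (@lebesgue_measure R).

(** This is y <= exp y at y = t / (2 s), raised to the power s. It spends only half of the decay of
    exp(-t); the other half is left to integrate. *)
Lemma powR_le_expR (s t : R) : 0 < s -> 0 < t ->
  t `^ s <= (2 * s) `^ s * expR (t / 2).
Proof.
move=> s0 t0; have e : t `^ s = (2 * s) `^ s * (t / (2 * s)) `^ s.
  rewrite -powRM; last 2 first.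
  - by rewrite mulr_ge0// ltW.
  - by rewrite divr_ge0 ?mulr_ge0// ltW.
  by congr (_ `^ _); field; lra.
rewrite e ler_wpM2l ?powR_ge0//.
have y0 : 0 < t / (2 * s) by rewrite divr_gt0// mulr_gt0.
rewrite [leRHS](_ : _ = (expR (t / (2 * s))) `^ s); last first.
  by rewrite -expRM; congr expR; field; lra.
apply: ge0_ler_powR; rewrite ?nnegrE ?ltW ?expR_gt0//.
by apply: lt_le_trans (expR_ge1Dx _); lra.
Qed.

Lemma integrable_Gamma (s : R) : 1 < s ->
  mu.-integrable `]0, +oo[ (fun t => (t `^ (s - 1) * expR (- t))%:E).
Proof.
move=> s1; have s10 : 0 < s - 1 by lra.
have mf : measurable_fun setT (fun t : R => t `^ (s - 1) * expR (- t)).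
  apply: measurable_funM; first exact: measurable_powR.
  by apply: measurableT_comp => //; exact: measurableT_comp.
pose C : R := (2 * (s - 1)) `^ (s - 1) * 2.
have C0 : 0 <= C by rewrite mulr_ge0 ?powR_ge0.
have ie : mu.-integrable `]0, +oo[ (fun t => (C * exponential_pdf 2^-1 t)%:E).
  apply: (@integrableS _ _ _ mu setT) => //.
  rewrite (_ : (fun t => _) =
     (fun t => C%:E * (exponential_pdf 2^-1 t)%:E)%E); last first.
    by apply/funext => t; rewrite EFinM.
  by apply: integrableZl => //; apply: integrable_exponential_pdf; lra.
apply: le_integrable ie => //.
  by apply/measurable_EFinP; exact: measurable_funTS.
move=> t/=; rewrite in_itv/= andbT => t0.
rewrite !lee_fin !ger0_norm ?mulr_ge0 ?powR_ge0 ?expR_ge0//; last first.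
  by apply: exponential_pdf_ge0; lra.
rewrite (exponential_pdfE _ (ltW t0))// /C.
have := powR_le_expR s10 t0.
move=> /(ler_wpM2r (expR_ge0 (- t))) /le_trans; apply.
rewrite -!mulrA ler_wpM2l ?powR_ge0// -expRD mulrA mulfV ?mul1r; last by lra.
by rewrite ler_expR; lra.
Qed.

Lemma cvg_powR_expN (s : R) : 0 < s -> t `^ s * expR (- t) @[t --> +oo] --> (0 : R).
Proof.
move=> s0; apply: (@squeeze_cvgr _ _ _ _ (fun=> 0) (fun t => (2 * s) `^ s * expR (- (t / 2)))).
- near=> t; have t0 : 0 < t by [].
  rewrite mulr_ge0 ?powR_ge0 ?expR_ge0//=.
  have := powR_le_expR s0 t0; move=> /(ler_wpM2r (expR_ge0 (- t))) /le_trans; apply.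
  by rewrite -mulrA -expRD ler_wpM2l ?powR_ge0// ler_expR; lra.
- exact: cvg_cst.
- rewrite -[X in _ --> X](mulr0 ((2 * s) `^ s)); apply: cvgM; first exact: cvg_cst.
  apply: (@cvg_comp _ _ _ (fun t : R => t / 2) (fun z => expR (- z)) _ (pinfty_nbhs R)).
    by apply: gt0_cvgMly => //; lra.
  exact: cvgr_expR.
Unshelve. all: by end_near. Qed.

Lemma is_derive_expRN (x : R) :
  is_derive x (1 : R) (fun t : R => expR (- t)) (- expR (- x)).
Proof.
have h : is_derive x (1 : R) (fun t : R => - t) (- 1) by apply: is_deriveN.
have := is_derive1_comp (is_derive_expR (- x)) h.
by rewrite /comp mulrN1.
Qed.

(** The difference of the two integrands is the derivative of -t^s exp(-t), which tends to 0 at 0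
    and at infinity. *)
Lemma GammaS (s : R) : 1 < s -> Gamma (s + 1) = s * Gamma s.
Proof.
move=> s1; have s0 : 0 < s by lra. have s10 : 0 < s - 1 by lra.
pose f t : R := t `^ s * expR (- t) - s * (t `^ (s - 1) * expR (- t)).
pose F t : R := - (t `^ s * expR (- t)).
have cvp (r : R) : 0 < r -> (fun t : R => t `^ r * expR (- t)) t @[t --> 0^'+] --> (0 : R).
  move=> r0; rewrite -[X in _ --> X](_ : 0 * expR (- 0) = _); last by rewrite mul0r.
  apply: cvgM; first exact: powR_cvg0.
  apply: cvg_at_right_filter; apply: continuous_comp; last exact: continuous_expR.
  exact: opp_continuous.
have cpe1 (r x : R) : 0 < x -> {for x, continuous (fun t : R => t `^ r * expR (- t))}.
  move=> x0; apply: continuousM; first exact: continuous_powR.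
  by apply: continuous_comp; [exact: opp_continuous|exact: continuous_expR].
have cf1 (x : R) : 0 < x -> {for x, continuous f}.
  move=> x0; apply: continuousB; first exact: cpe1.
  by apply: continuousM; [exact: cst_continuous|exact: cpe1].
have cf : {within `[0, s], continuous f}.
  apply/(continuous_within_itvP _ s0); split.
  - by move=> x; rewrite in_itv/= => /andP[x0 _]; exact: cf1.
  - rewrite /f powR0 ?gt_eqF// powR0 ?gt_eqF// -[X in _ --> X]/(0 * expR (- 0) - s * (0 * expR (- 0))).
    rewrite mul0r mulr0; apply: cvgB; first exact: cvp.
    by rewrite -[X in _ --> X](mulr0 s); apply: cvgM; [exact: cvg_cst|exact: cvp].
  - by apply: cvg_at_left_filter; exact: cf1.
have dF (x : R) : 0 < x -> is_derive x 1 F (f x).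
  move=> x0.
  have h1 : is_derive x 1 (fun t : R => t `^ s) (s * x `^ (s - 1)).
    apply: DeriveDef; first by apply: derivable_powR; rewrite in_itv/= andbT.
    by rewrite -derive1E powR_derive1// in_itv/= andbT.
  have h2 := is_derive_expRN x.
  apply: (is_derive_eq (is_deriveN (is_deriveM h1 h2))).
  by rewrite /f /GRing.scale/=; ring.
have mu1 : mu.-integrable `]0, +oo[ (fun t => (t `^ s * expR (- t))%:E).
  have := @integrable_Gamma (s + 1); rewrite addrK; apply; lra.
have mu2 := integrable_Gamma s1.
have mu3 : mu.-integrable `]0, +oo[ (fun t => (s * (t `^ (s - 1) * expR (- t)))%:E).
  rewrite (_ : (fun t => _) = (fun t => s%:E * (t `^ (s - 1) * expR (- t))%:E)%E) //.
  exact: integrableZl.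
have -> : Gamma (s + 1) = \int[mu]_(t in `]0, +oo[) (t `^ s * expR (- t)).
  by rewrite /Gamma addrK.
apply/eqP; rewrite -subr_eq0 /Gamma -RintegralZl// -RintegralB//; apply/eqP.
have ifun : mu.-integrable `]0, +oo[ (EFin \o f).
  rewrite (_ : EFin \o f = (fun t => (t `^ s * expR (- t))%:E - (s * (t `^ (s - 1) * expR (- t)))%:E)%E) //.
  exact: integrableB.
(* [f] changes sign at t = s, and the fundamental theorem on a half-line wants a constant sign:
   hence the cut at s. *)
rewrite (_ : `]0, +oo[%classic = `]0, s] `|` `]s, +oo[); last first.
  by rewrite -itv_bndbnd_setU ?bnd_simp ?ltW.
rewrite /Rintegral integral_setU_EFin//=; last 2 first.
- by rewrite -itv_bndbnd_setU ?bnd_simp ?ltW//; case/integrableP: ifun => /measurable_EFinP.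
- by apply/lt_disjoint => x y; rewrite !in_itv/= => /andP[_ xs] /andP[sy _]; exact: le_lt_trans sy.
have mf (D : set R) : measurable D -> D `<=` `]0, +oo[%classic -> measurable_fun D (EFin \o f).
  move=> mD sD; case/integrableP: ifun => + _; exact: measurable_funS.
rewrite integral_itv_obnd_cbnd; last first.
  by apply: mf => // x/=; rewrite !in_itv/= => /andP[-> _].
rewrite [X in (_ + X)%E]integral_itv_obnd_cbnd; last first.
  by apply: mf => // x/=; rewrite !in_itv/= !andbT; exact: lt_trans.
rewrite (@continuous_FTC2 _ f F)//; last 2 first.
- split.
  + by move=> x; rewrite in_itv/= => /andP[x0 _]; case: (dF _ x0).
  + by rewrite /F powR0 ?gt_eqF// mul0r; apply: cvgN; exact: cvp.
  + by apply: cvg_at_left_filter; apply: cvgN; exact: cpe1.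
- move=> x; rewrite in_itv/= => /andP[x0 _]; have := dF _ x0.
  by move=> h; rewrite derive1E derive_val.
rewrite (@ge0_continuous_FTC2y _ f F _ 0)//.
- by rewrite -!EFinB -EFinD/= /F powR0 ?gt_eqF// !mul0r; lra.
- move=> x sx; have x0 : 0 < x by exact: lt_le_trans sx.
  rewrite /f mulrA -mulrBl mulr_ge0 ?expR_ge0// subr_ge0.
  by rewrite -(mulr_powRB1 (ltW x0) s0) ler_wpM2r ?powR_ge0.
- apply: continuous_in_subspaceT => x; rewrite inE/= in_itv/= andbT => sx.
  by apply: cf1; exact: lt_le_trans sx.
- by rewrite -oppr0; apply: cvgN; exact: cvg_powR_expN.
- by move=> x sx; have x0 := lt_trans s0 sx; case: (dF _ x0).
- by apply: cvg_at_right_filter; apply: cvgN; exact: cpe1.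
- move=> x; rewrite in_itv/= andbT => sx; have x0 := lt_trans s0 sx.
  by have h := dF _ x0; rewrite derive1E derive_val.
Qed.

(** Keep only t > y in Euler's integral, where t^(s - 1) >= y^(s - 1). The choice y = c / 2 will
    bound k_0 uniformly in al. *)
Lemma Gamma_ge (s y : R) : 1 < s -> 0 < y -> y `^ (s - 1) * expR (- y) <= Gamma s.
Proof.
move=> s1 y0; have s10 : 0 < s - 1 by lra.
have i1 := integrable_Gamma s1.
have sub : `]y, +oo[%classic `<=` `]0, +oo[%classic.
  by move=> x/=; rewrite !in_itv/= !andbT; exact: lt_trans.
have mG D : measurable D -> measurable_fun D (fun t : R => (t `^ (s - 1) * expR (- t))%:E).
  move=> mD; apply/measurable_EFinP; apply: measurable_funM; first exact: measurable_funTS.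
  by apply: measurableT_comp => //; exact: measurableT_comp.
rewrite /Gamma /Rintegral -[leLHS]/(fine (_%:E)); apply: fine_le => //.
  exact: integrable_fin_num.
apply: (@le_trans _ _ (\int[mu]_(t in `]y, +oo[) (t `^ (s - 1) * expR (- t))%:E)%E); last first.
  apply: ge0_subset_integral => //; first exact: mG.
  by move=> x _; rewrite lee_fin mulr_ge0 ?powR_ge0 ?expR_ge0.
pose f t : R := y `^ (s - 1) * expR (- t).
have cN : continuous (fun t : R => expR (- t)).
  by move=> x; apply: continuous_comp; [exact: opp_continuous|exact: continuous_expR].
have cf : continuous f.
  by move=> x; apply: cvgM; [exact: cvg_cst|exact: cN].
have df (x : R) : is_derive x (1 : R) (fun t => - f t) (f x).
  have h2 := is_derive_expRN x.
  apply: (is_derive_eq (is_deriveN (is_deriveM (is_derive_cst (y `^ (s - 1)) x (1 : R)) h2))).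
  by rewrite /f /GRing.scale/=; ring.
have -> : (y `^ (s - 1) * expR (- y))%:E = (\int[mu]_(t in `]y, +oo[) (f t)%:E)%E.
  rewrite integral_itv_obnd_cbnd; last first.
    by apply/measurable_EFinP; apply: measurable_funTS; exact: continuous_measurable_fun.
  rewrite (@ge0_continuous_FTC2y _ f (fun t => - f t) _ 0)//.
  - by rewrite EFinN oppeK add0e.
  - by move=> x _; rewrite mulr_ge0 ?powR_ge0 ?expR_ge0.
  - exact: continuous_subspaceT.
  - rewrite -oppr0; apply: cvgN; rewrite -(mulr0 (y `^ (s - 1))).
    by apply: cvgM; [exact: cvg_cst|exact: cvgr_expR].
  - by apply: cvg_at_right_filter; apply: cvgN; exact: cf.
  - by move=> x _; have h := df x; rewrite derive1E derive_val.
apply: ge0_le_integral => //.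
- by move=> x _; rewrite lee_fin mulr_ge0 ?powR_ge0 ?expR_ge0.
- by apply/measurable_EFinP; apply: measurable_funTS; exact: continuous_measurable_fun.
- exact: mG.
- move=> x/=; rewrite in_itv/= andbT => yx; rewrite lee_fin ler_wpM2r ?expR_ge0//.
  by apply: ge0_ler_powR; rewrite ?nnegrE ?(ltW s10) ?(ltW y0) ?(ltW yx) ?(ltW (lt_trans y0 yx)).
Qed.

Lemma Gamma_gt0 (s : R) : 1 < s -> 0 < Gamma s.
Proof.
move=> s1; apply: lt_le_trans (Gamma_ge s1 ltr01).
by rewrite mulr_gt0 ?powR_gt0 ?expR_gt0.
Qed.

End Gamma_function.

(** * Coefficient sequences of entire functions *)

Section Absolutely_summable.
Context {R : realType}.
Implicit Types (u v : R^nat).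

Definition abs_summable u := cvgn (series (fun m => `|u m|)).
Definition tsum u : R := limn (series u).

Lemma tsum_cvg u : abs_summable u -> series u @ \oo --> tsum u.
Proof. by move=> su; have := @normed_cvg _ _ u su. Qed.

Lemma abs_summable_le u v : (forall m, `|u m| <= v m) -> cvgn (series v) ->
  abs_summable u.
Proof.
move=> uv sv; apply: series_le_cvg sv => m //.
by rewrite (le_trans _ (uv m)).
Qed.

Lemma abs_summableD u v : abs_summable u -> abs_summable v ->
  abs_summable (fun m => u m + v m).
Proof.
move=> su sv; apply: (@abs_summable_le _ ((fun m => `|u m|) + (fun m => `|v m|))).
  by move=> m; exact: ler_normD.
exact: is_cvg_seriesD.
Qed.

Lemma abs_summableZ k u : abs_summable u -> abs_summable (fun m => k * u m).
Proof.
move=> su; apply: (@abs_summable_le _ (`|k| *: (fun m => `|u m|))).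
  by move=> m; rewrite normrM.
exact: is_cvg_seriesZ.
Qed.

Lemma abs_summableB u v : abs_summable u -> abs_summable v ->
  abs_summable (fun m => u m - v m).
Proof.
move=> su sv; have := abs_summableD su (abs_summableZ (k := - 1) sv).
by congr abs_summable; apply/funext => m; rewrite mulN1r.
Qed.

Lemma tsumD u v : abs_summable u -> abs_summable v ->
  tsum (fun m => u m + v m) = tsum u + tsum v.
Proof.
move=> /tsum_cvg su /tsum_cvg sv; apply/cvg_lim => //.
rewrite (_ : (fun m => u m + v m) = u + v)// seriesD.
exact: cvgD.
Qed.

Lemma tsumZ k u : abs_summable u -> tsum (fun m => k * u m) = k * tsum u.
Proof.
move=> /tsum_cvg su; apply/cvg_lim => //.
rewrite (_ : (fun m => k * u m) = k *: u)// seriesZ.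
exact: cvgZr.
Qed.

Lemma tsumB u v : abs_summable u -> abs_summable v ->
  tsum (fun m => u m - v m) = tsum u - tsum v.
Proof.
move=> su sv; rewrite -[X in _ = _ + X]mulN1r -tsumZ// -tsumD//.
  by congr tsum; apply/funext => m; rewrite mulN1r.
exact: abs_summableZ.
Qed.

Lemma tsum0 : tsum (fun=> 0) = 0.
Proof.
apply/cvg_lim => //; rewrite (_ : series _ = fun=> 0); first exact: cvg_cst.
by apply/funext => n; rewrite /series/= big1.
Qed.

Lemma norm_tsum_le u (C : R) : abs_summable u ->
  (forall n, `|series u n| <= C) -> `|tsum u| <= C.
Proof.
move=> /tsum_cvg su uC; have nsu : (fun n => `|series u n|) @ \oo --> `|tsum u| by exact: cvg_norm.
rewrite -(cvg_lim _ nsu)//; apply: limr_le; first by apply/cvg_ex; exists `|tsum u|.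
exact: nearW.
Qed.

Lemma series_norm_le u n : abs_summable u -> series (fun m => `|u m|) n <= tsum (fun m => `|u m|).
Proof.
move=> su; apply: nondecreasing_cvgn_le => //.
by apply: nondecreasing_series => m _ _.
Qed.

Lemma norm_tsum u : abs_summable u -> `|tsum u| <= tsum (fun m => `|u m|).
Proof.
move=> su; apply: norm_tsum_le => // n.
by apply: le_trans (series_norm_le n su); exact: ler_norm_sum.
Qed.

Lemma tsum_norm_ge0 u : abs_summable u -> 0 <= tsum (fun m => `|u m|).
Proof. by move=> su; apply: le_trans (norm_tsum su); rewrite normr_ge0. Qed.

Lemma abs_summableS u : abs_summable u -> abs_summable (fun m => u m.+1).
Proof.
move=> su; apply: nondecreasing_is_cvgn.
  by apply: nondecreasing_series => m _ _.
exists (tsum (fun m => `|u m|)) => _ [n _ <-].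
apply: le_trans (series_norm_le n.+1 su).
by rewrite /series/= [leRHS]big_nat_recl// lerDr.
Qed.

Lemma tsum_recl u : abs_summable u -> tsum u = u 0%N + tsum (fun m => u m.+1).
Proof.
move=> su; have /tsum_cvg su1 := abs_summableS su.
have /tsum_cvg := su; rewrite -cvg_shiftS => su'.
apply: (cvg_unique _ su') => //.
rewrite (_ : (fun n => series u n.+1) = (fun n => u 0%N + series (fun m => u m.+1) n)).
  by apply: cvgD => //; exact: cvg_cst.
by apply/funext => n; rewrite /series/= big_nat_recl.
Qed.

Lemma tsum_drop u n : abs_summable u -> tsum u - series u n = tsum (fun m => u (m + n)%N).
Proof.
elim: n u => [|n ih] u su.
  by rewrite /series/= big_geq// subr0; congr tsum; apply/funext => m; rewrite addn0.
rewrite tsum_recl// /series/= big_nat_recl// opprD addrACA subrr add0r.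
rewrite -[X in _ - X]/(series (fun m => u m.+1) n) ih; last exact: abs_summableS.
by congr tsum; apply/funext => m; rewrite addnS.
Qed.

Lemma abs_summable_drop u n : abs_summable u -> abs_summable (fun m => u (m + n)%N).
Proof.
elim: n u => [|n ih] u su.
  by rewrite (_ : (fun m => _) = u)//; apply/funext => m; rewrite addn0.
by have := ih _ (abs_summableS su); congr abs_summable; apply/funext => m; rewrite addnS.
Qed.

Lemma abs_summable_norm u : abs_summable u -> abs_summable (fun m => `|u m|).
Proof. by rewrite /abs_summable; under [X in _ -> cvgn (series X)]eq_fun do rewrite normr_id. Qed.

Lemma tail_cvg0 u : abs_summable u ->
  (fun n => tsum (fun m => `|u (m + n)%N|)) @ \oo --> (0 : R).
Proof.
move=> su; have sn := abs_summable_norm su.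
rewrite (_ : (fun n => _) = (fun n => tsum (fun m => `|u m|) - series (fun m => `|u m|) n)).
  rewrite -(subrr (tsum (fun m => `|u m|))).
  by apply: cvgB; [exact: cvg_cst|exact: tsum_cvg].
by apply/funext => n; rewrite (@tsum_drop (fun m => `|u m|)).
Qed.

End Absolutely_summable.

Section Entire_sequences.
Context {R : realType}.
Implicit Types (a b : R^nat).

(* Coefficient sequences of power series with infinite radius of convergence. *)
Definition entire a := forall r : R, 0 < r ->
  exists2 C : R, 0 <= C & forall m, `|a m| * r ^+ m <= C.

(** The geometric growth of the multiplier is absorbed by testing [a] at radius s r instead of r. *)
Lemma entireM_bound a (p : R^nat) (B s : R) : entire a -> 0 < s ->
  (forall m, `|p m| <= B * s ^+ m) -> entire (fun m => p m * a m).
Proof.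
move=> ea s0 pB r r0; have [C C0 aC] := ea (s * r) (mulr_gt0 s0 r0).
have B0 : 0 <= B by have := le_trans (normr_ge0 _) (pB 0%N); rewrite expr0 mulr1.
exists (B * C) => [|m]; first exact: mulr_ge0.
rewrite normrM mulrAC; apply: (@le_trans _ _ (B * s ^+ m * r ^+ m * `|a m|)).
  by rewrite !ler_wpM2r// ?exprn_ge0// ltW.
by rewrite -!mulrA ler_wpM2l// mulrA -exprMn mulrC.
Qed.

Lemma entire_summable a (p : R^nat) (B s : R) : entire a -> 0 < s ->
  (forall m, `|p m| <= B * s ^+ m) -> abs_summable (fun m => a m * p m).
Proof.
(* Radius 2 leaves a geometric majorant of ratio 1/2. *)
move=> ea s0 pB; have [C C0 aC] := entireM_bound ea s0 pB (@ltr0Sn R 1).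
apply: (@abs_summable_le _ _ (geometric C 2^-1)); last first.
  by apply: is_cvg_geometric_series; rewrite ger0_norm; lra.
move=> m; rewrite /geometric/= mulrC.
by rewrite exprVn ler_pdivlMr ?exprn_gt0.
Qed.

Lemma entire_abs_summable a : entire a -> abs_summable a.
Proof.
move=> ea; have := @entire_summable a (fun=> 1) 1 1 ea ltr01.
under eq_fun do rewrite mulr1; apply => m.
by rewrite normr1 expr1n mulr1.
Qed.

Lemma entireD a b : entire a -> entire b -> entire (fun m => a m + b m).
Proof.
move=> ea eb r r0; have [C C0 aC] := ea _ r0; have [D D0 bD] := eb _ r0.
exists (C + D) => [|m]; first exact: addr_ge0.
apply: le_trans (lerD (aC m) (bD m)).
by rewrite -mulrDl ler_wpM2r ?ler_normD// exprn_ge0// ltW.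
Qed.

Lemma entireZ k a : entire a -> entire (fun m => k * a m).
Proof.
move=> ea; apply: (@entireM_bound _ (fun=> k) `|k| 1) => // m.
by rewrite expr1n mulr1.
Qed.

Lemma entire0 : entire (fun=> 0).
Proof. by move=> r r0; exists 0 => // m; rewrite normr0 mul0r. Qed.

Lemma entireB a b : entire a -> entire b -> entire (fun m => a m - b m).
Proof.
move=> ea eb; have := entireD ea (entireZ (-1) eb).
by congr entire; apply/funext => m; rewrite mulN1r.
Qed.

Lemma entire_shift a : entire a -> entire (fun m => a m.+1).
Proof.
move=> ea r r0; have [C C0 aC] := ea _ r0.
exists (C / r) => [|m]; first by rewrite divr_ge0// ltW.
by rewrite ler_pdivlMr// -mulrA -exprSr.
Qed.

(** Multiplication by u, on coefficient sequences. *)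
Definition unshift a m := if m is m'.+1 then a m' else 0.

Lemma entire_unshift a : entire a -> entire (unshift a).
Proof.
move=> ea r r0; have [C C0 aC] := ea _ r0.
exists (C * r) => [|[|m]]; rewrite ?mulr_ge0// ?(ltW r0)//=.
  by rewrite normr0 mul0r mulr_ge0// ltW.
by rewrite exprSr mulrA ler_wpM2r// ltW.
Qed.

Lemma entire_sum (I : Type) (s : seq I) (F : I -> R^nat) :
  (forall i, entire (F i)) -> entire (fun m => \sum_(i <- s) F i m).
Proof.
move=> eF; elim: s => [|i s ih].
  by under eq_fun do rewrite big_nil; exact: entire0.
by under eq_fun do rewrite big_cons; exact: entireD.
Qed.

Lemma entire_fin a (N : nat) : (forall m, (N <= m)%N -> a m = 0) -> entire a.
Proof.
move=> aN r r0; exists (\sum_(m < N) `|a m| * r ^+ m).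
  by apply: sumr_ge0 => m _; rewrite mulr_ge0// exprn_ge0// ltW.
move=> m; case: (ltnP m N) => mN; last first.
  rewrite aN// normr0 mul0r; apply: sumr_ge0 => i _.
  by rewrite mulr_ge0// exprn_ge0// ltW.
rewrite (bigD1 (Ordinal mN))//= lerDl; apply: sumr_ge0 => i _.
by rewrite mulr_ge0// exprn_ge0// ltW.
Qed.

End Entire_sequences.

(** * Moments and the inner product of coefficient sequences *)

Section Moments.
Context {R : realType}.
Variable al : R.
Hypothesis al0 : 0 < al.
Implicit Types (a b f : R^nat).

(** The integral of u^(m + l + al) over [0, 1]: the Gram matrix of the monomials for the weight
    u^al. *)
Definition wt (m l : nat) : R := (m%:R + l%:R + al + 1)^-1.

Lemma wtC m l : wt m l = wt l m.
Proof. by rewrite /wt [m%:R + _]addrC. Qed.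

Lemma wt_den_ge1 m l : 1 <= m%:R + l%:R + al + 1.
Proof. by have h := al0; have := ler0n R m; have := ler0n R l; lra. Qed.

Lemma wt_gt0 m l : 0 < wt m l.
Proof. by rewrite invr_gt0 (lt_le_trans ltr01)// wt_den_ge1. Qed.

Lemma wt_le1 m l : wt m l <= 1.
Proof.
by rewrite invf_le1 ?wt_den_ge1// (lt_le_trans ltr01)// wt_den_ge1.
Qed.

Lemma norm_wt_le1 m l : `|wt m l| <= 1 * 1 ^+ l.
Proof. by rewrite expr1n mulr1 ger0_norm ?wt_le1// ltW// wt_gt0. Qed.

(* With g(u) = sum_l a_l u^l, rho a m is the integral of u^(al+m) g(u) and
   ip a b the inner product of the corresponding functions for u^al du. *)
Definition rho a m : R := tsum (fun l => a l * wt m l).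
Definition ip a b : R := tsum (fun m => a m * rho b m).

Lemma rho_summable a m : entire a -> abs_summable (fun l => a l * wt m l).
Proof. by move=> ea; exact: entire_summable ea ltr01 (norm_wt_le1 m). Qed.

Lemma rho_bound a : entire a -> exists2 B, 0 <= B & forall m, `|rho a m| <= B.
Proof.
move=> ea; have sa := entire_abs_summable ea.
exists (tsum (fun m => `|a m|)); first exact: tsum_norm_ge0.
move=> m; apply: norm_tsum_le => [|n]; first exact: rho_summable.
apply: le_trans (series_norm_le n sa); apply: le_trans (ler_norm_sum _ _ _) _.
apply: ler_sum => l _; rewrite normrM ler_piMr//.
by have := norm_wt_le1 m l; rewrite expr1n mulr1.
Qed.

Lemma rho_bound1 a : entire a -> exists B, forall m, `|rho a m| <= B * 1 ^+ m.
Proof.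
by move=> /rho_bound[B _ aB]; exists B => m; rewrite expr1n mulr1.
Qed.

Lemma ip_summable a b : entire a -> entire b -> abs_summable (fun m => a m * rho b m).
Proof.
by move=> ea /rho_bound1[B bB]; exact: entire_summable ea ltr01 bB.
Qed.

Lemma rhoD a b m : entire a -> entire b -> rho (fun m => a m + b m) m = rho a m + rho b m.
Proof.
move=> ea eb; rewrite /rho -tsumD; [|exact: rho_summable..].
by congr tsum; apply/funext => l; rewrite mulrDl.
Qed.

Lemma rhoZ k a m : entire a -> rho (fun m => k * a m) m = k * rho a m.
Proof.
move=> ea; rewrite /rho -tsumZ; last exact: rho_summable.
by congr tsum; apply/funext => l; rewrite mulrA.
Qed.

Lemma ipDl a b f : entire a -> entire b -> entire f ->
  ip (fun m => a m + b m) f = ip a f + ip b f.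
Proof.
move=> ea eb ef; rewrite /ip -tsumD; [|exact: ip_summable..].
by congr tsum; apply/funext => l; rewrite mulrDl.
Qed.

Lemma ipZl k a f : entire a -> entire f -> ip (fun m => k * a m) f = k * ip a f.
Proof.
move=> ea ef; rewrite /ip -tsumZ; last exact: ip_summable.
by congr tsum; apply/funext => l; rewrite mulrA.
Qed.

(** Square truncations. [ip] sums over l inside and over m outside, which hides its symmetry; that
    of [ipN] is visible and passes to the limit. *)
Definition ipN (N : nat) a b : R :=
  \sum_(0 <= m < N) \sum_(0 <= l < N) a m * b l * wt m l.

Lemma ipNC N a b : ipN N a b = ipN N b a.
Proof.
rewrite /ipN exchange_big/=; apply: eq_bigr => m _; apply: eq_bigr => l _.
by rewrite wtC [a _ * _]mulrC.
Qed.

(** As 0 < [wt] <= 1, the error is at most the sum of the |a m| times a tail of the sum of the |b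
    m|. *)
Lemma ipN_cvg a b : entire a -> entire b -> (fun N => ipN N a b) @ \oo --> ip a b.
Proof.
move=> ea eb; have sb := entire_abs_summable eb; have sa := entire_abs_summable ea.
have := tsum_cvg (ip_summable ea eb).
have h : (fun n => series (fun m => a m * rho b m) n - ipN n a b) @ \oo --> (0 : R).
  apply: (@norm_cvg0 _ R).
  apply: (@squeeze_cvgr _ _ _ _ (fun=> 0)
    (fun n => tsum (fun m => `|a m|) * tsum (fun m => `|b (m + n)%N|))).
  - near=> n; rewrite normr_ge0/= /series/= /ipN -sumrB.
    apply: le_trans (ler_norm_sum _ _ _) _.
    have tb : 0 <= tsum (fun m => `|b (m + n)%N|).
      by apply: tsum_norm_ge0; exact: (@abs_summable_drop _ b).
    apply: (@le_trans _ _ (\sum_(0 <= m < n) `|a m| * tsum (fun m => `|b (m + n)%N|))).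
      apply: ler_sum => m _.
      under eq_bigr do rewrite -mulrA.
      rewrite -mulr_sumr -mulrBr normrM ler_wpM2l// -[X in _ - X]/(series (fun l => b l * wt m l) n).
      rewrite tsum_drop; last exact: rho_summable.
      have sbn := abs_summable_drop (n := n) sb.
      apply: norm_tsum_le => [|k].
        exact: (@abs_summable_drop _ (fun l => b l * wt m l) n (rho_summable eb)).
      apply: le_trans (series_norm_le k sbn); apply: le_trans (ler_norm_sum _ _ _) _.
      apply: ler_sum => l _; rewrite normrM ler_piMr//.
      by have := norm_wt_le1 m (l + n); rewrite expr1n mulr1.
    by rewrite -mulr_suml ler_wpM2r//; exact: series_norm_le.
  - exact: cvg_cst.
  - by rewrite -(mulr0 (tsum (fun m => `|a m|))); apply: cvgM; [exact: cvg_cst|exact: tail_cvg0].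
move=> h1; rewrite -(subr0 (ip a b)) (_ : (fun N => ipN N a b) =
  (fun n => series (fun m => a m * rho b m) n - (series (fun m => a m * rho b m) n - ipN n a b))).
  exact: cvgB.
by apply/funext => n; rewrite subKr.
Unshelve. all: by end_near. Qed.

Lemma ipC a b : entire a -> entire b -> ip a b = ip b a.
Proof.
move=> ea eb; apply: (cvg_unique _ (ipN_cvg ea eb)) => //.
have e : (fun N => ipN N a b) = (fun N => ipN N b a).
  by apply/funext => N; rewrite ipNC.
by rewrite /mkset e; exact: ipN_cvg.
Qed.

Lemma ipDr a b f : entire a -> entire b -> entire f ->
  ip f (fun m => a m + b m) = ip f a + ip f b.
Proof.
move=> ea eb ef; rewrite ipC//; last exact: entireD.
by rewrite ipDl// ipC// [ip b f]ipC.
Qed.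

Lemma ipZr k a f : entire a -> entire f -> ip f (fun m => k * a m) = k * ip f a.
Proof.
move=> ea ef; rewrite ipC//; last exact: entireZ.
by rewrite ipZl// ipC.
Qed.

End Moments.

(** * Integrals of polynomials against t^be over ]0, 1[ *)

Section Weighted_integral.
Context {R : realType}.
Notation mu := (@lebesgue_measure R).
Implicit Types (p q : {poly R}) (be : R).

(** Defined on coefficients, so that linearity stays algebraic; positivity and comparison come from
    [wint_Rintegral]. *)
Definition wint be p : R := \sum_(i < size p) p`_i / (i%:R + be + 1).

Lemma wint_widen be N p : (size p <= N)%N ->
  wint be p = \sum_(i < N) p`_i / (i%:R + be + 1).
Proof.
move=> pN; rewrite /wint (big_ord_widen N (fun i => p`_i / (i%:R + be + 1)))//.
rewrite big_mkcond/=; apply: eq_bigr => i _.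
by case: ltnP => // pi; rewrite nth_default// mul0r.
Qed.

Lemma wint_is_linear be : linear_for *%R (wint be).
Proof.
move=> k p q; pose N := maxn (size p) (size q).
have pN : (size p <= N)%N by rewrite leq_maxl.
have qN : (size q <= N)%N by rewrite leq_maxr.
have sN : (size (k *: p + q)%R <= N)%N.
  rewrite (leq_trans (size_polyD _ _))// geq_max qN andbT.
  exact: leq_trans (size_scale_leq _ _) pN.
rewrite !(wint_widen _ pN, wint_widen _ qN, wint_widen _ sN).
rewrite mulr_sumr -big_split/=; apply: eq_bigr => i _.
by rewrite coefD coefZ mulrDl mulrA.
Qed.

HB.instance Definition _ be :=
  GRing.isLinear.Build R {poly R} R *%R (wint be) (wint_is_linear be).

Lemma wintXn be n : wint be 'X^n = (n%:R + be + 1)^-1.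
Proof.
rewrite (@wint_widen _ n.+1) ?size_polyXn// big_ord_recr/= coefXn eqxx mul1r.
rewrite big1 ?add0r// => i _; rewrite coefXn.
by have := ltn_ord i; rewrite ltn_neqAle => /andP[/negbTE -> _]; rewrite mul0r.
Qed.

Lemma wint_Rintegral be p : 0 <= be ->
  mu.-integrable `]0, 1[ (fun t => (t `^ be * p.[t])%:E) /\
  wint be p = \int[mu]_(t in `]0, 1[) (t `^ be * p.[t]).
Proof.
move=> be0; pose K q := mu.-integrable `]0, 1[ (EFin \o (fun t => t `^ be * q.[t])) /\
  wint be q = \int[mu]_(t in `]0, 1[) (t `^ be * q.[t]).
rewrite -/(K p) -(coefK p) poly_def; apply: (big_ind K); rewrite /K.
- have -> : (fun t : R => t `^ be * (0 : {poly R}).[t]) = fun=> 0.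
    by apply/funext => t; rewrite horner0 mulr0.
  split; first exact: integrable0.
  by rewrite linear0 /Rintegral integral0.
- move=> p1 p2 [i1 e1] [i2 e2].
  have -> : (fun t : R => t `^ be * (p1 + p2).[t]) = (fun t => t `^ be * p1.[t] + t `^ be * p2.[t]).
    by apply/funext => t; rewrite hornerD mulrDr.
  split; last by rewrite linearD RintegralD//= e1 e2.
  pose f1 (t : R) := t `^ be * p1.[t]; pose f2 (t : R) := t `^ be * p2.[t].
  rewrite (_ : EFin \o _ = (fun t => (EFin \o f1) t + (EFin \o f2) t)%E)//.
  exact: integrableD.
- move=> i _; have s0 : 0 <= be + i%:R by rewrite addr_ge0.
  have E : {in `]0, 1[%classic, forall t, p`_i * t `^ (be + i%:R) = t `^ be * (p`_i *: 'X^i).[t]}.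
    move=> t; rewrite inE/= in_itv/= => /andP[t0 _]; rewrite hornerZ hornerXn powRD.
      by rewrite powR_mulrn ?(ltW t0)// mulrCA.
    by rewrite (gt_eqF t0) implybT.
  have ii : mu.-integrable `]0, 1[ (EFin \o (fun t => p`_i * t `^ (be + i%:R))).
    rewrite (_ : EFin \o _ = (fun t => (p`_i)%:E * (t `^ (be + i%:R))%:E)%E)//.
    by apply: integrableZl => //; exact: integrable_powR01.
  split.
    by apply: eq_integrable ii => // t tI /=; rewrite E.
  transitivity (\int[mu]_(t in `]0, 1[) (p`_i * t `^ (be + i%:R))).
    rewrite RintegralZl//; last exact: integrable_powR01.
    by rewrite linearZ/= wintXn Rintegral_powR01// [_ + be]addrC.
  exact: eq_Rintegral.
Qed.

Lemma wint_ge0 be p : 0 <= be -> (forall t, 0 < t < 1 -> 0 <= p.[t]) -> 0 <= wint be p.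
Proof.
move=> be0 p0; rewrite (wint_Rintegral p be0).2; apply: Rintegral_ge0 => t /=.
by rewrite in_itv/= => /p0 pt; rewrite mulr_ge0 ?powR_ge0.
Qed.

Lemma wint_sqr_ge0 be p : 0 <= be -> 0 <= wint be (p * p).
Proof. by move=> be0; apply: wint_ge0 => // t _; rewrite hornerM -expr2 sqr_ge0. Qed.

Lemma le_wint be p q : 0 <= be -> (forall t, 0 < t < 1 -> p.[t] <= q.[t]) ->
  wint be p <= wint be q.
Proof.
move=> be0 pq; rewrite -subr_ge0 -linearB; apply: wint_ge0 => // t /pq.
by rewrite hornerD hornerN subr_ge0.
Qed.

Lemma le_wint_weight be p : 0 <= be -> (forall t, 0 < t < 1 -> 0 <= p.[t]) ->
  wint be p <= wint 0 p.
Proof.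
move=> be0 p0; have [i1 ->] := wint_Rintegral p be0.
have [i2 ->] := wint_Rintegral p (lexx 0).
apply: le_Rintegral => // t /=; rewrite in_itv/= => tI.
rewrite ler_wpM2r ?p0// powRr0 -(powRr0 t).
by apply: ger_powR => //; case/andP: tI => -> /ltW ->.
Qed.

Lemma wint_deriv p : wint 0 p^`() = p.[1] - p.[0].
Proof.
rewrite -(coefK p) poly_def; apply: (big_ind (fun q => wint 0 q^`() = q.[1] - q.[0])).
- by rewrite deriv0 linear0 !horner0 subrr.
- by move=> p1 p2 e1 e2; rewrite derivD linearD/= e1 e2 !hornerD; ring.
move=> i _; rewrite derivZ linearZ/= !hornerZ -mulrBr; congr (_ * _).
rewrite derivXn !hornerXn expr1n; case: (nat_of_ord i) => [|j].
  by rewrite mulr0n linear0 expr0 subrr.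
rewrite raddfMn/= wintXn expr0n subr0 addr0 -(mulr_natr _ j.+1) [_ + 1]natr1 mulVf//.
Qed.

End Weighted_integral.

Section Inner_product.
Context {R : realType}.
Variable al : R.
Hypothesis al0 : 0 < al.
Implicit Types (a b f : R^nat).

(** Makes [ipN N a a] the integral of a square, whence the positivity of [ip] in the limit. *)
Lemma ipN_wint N a b :
  ipN al N a b = wint al (\poly_(i < N) a i * \poly_(i < N) b i).
Proof.
rewrite !poly_def mulr_suml linear_sum /ipN big_mkord; apply: eq_bigr => m _.
rewrite mulr_sumr linear_sum big_mkord; apply: eq_bigr => l _.
have -> : a m *: 'X^m * (b l *: 'X^l) = (a m * b l) *: 'X^(m + l).
  by rewrite -scalerAl -scalerAr scalerA -exprD.
by rewrite linearZ/= wintXn /wt natrD.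
Qed.

Lemma ip_ge0 a : entire a -> 0 <= ip al a a.
Proof.
move=> ea; have ia := ipN_cvg al0 ea ea.
rewrite -(cvg_lim _ ia)//; apply: limr_ge; first by apply/cvg_ex; exists (ip al a a).
by apply: nearW => N; rewrite ipN_wint wint_sqr_ge0// ltW.
Qed.

Lemma ip_CS a b : entire a -> entire b -> ip al a b ^+ 2 <= ip al a a * ip al b b.
Proof.
move=> ea eb; have h := al0.
pose A := ip al a a; pose B := ip al a b; pose C := ip al b b.
have q t : 0 <= A + 2 * t * B + t ^+ 2 * C.
  have et : entire (fun m => t * b m) by exact: entireZ.
  have := ip_ge0 (entireD ea et).
  rewrite ipDl//; last exact: entireD.
  rewrite !ipDr// ipZl// !ipZr// ipZl// (ipC al0 eb ea) -/A -/B -/C.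
  by congr (_ <= _); ring.
have A0 := ip_ge0 ea; have C0 := ip_ge0 eb; rewrite -/A -/C in A0 C0 *.
(* Definiteness is not at hand, so a null [b] is treated apart: the quadratic is then affine in t,
   and t = -(A + 1) / (2 B) sends it to -1. *)
have [C00|] := eqVneq C 0.
  rewrite -/B C00 mulr0; have [->|B0] := eqVneq B 0; first by rewrite expr0n.
  have := q (- (A + 1) / (2 * B)); rewrite C00 mulr0 addr0.
  rewrite [X in A + X](_ : _ = - (A + 1)); first by lra.
  by field.
move=> Cn0; have Cp : 0 < C by rewrite lt_neqAle eq_sym Cn0.
have := q (- B / C); rewrite [X in 0 <= X](_ : _ = (A * C - B ^+ 2) / C); last by field.
by rewrite pmulr_lge0 ?invr_gt0// subr_ge0.
Qed.

Definition mono m : R^nat := fun i => (i == m)%:R.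

Lemma entire_mono m : entire (mono m).
Proof.
apply: (@entire_fin _ _ m.+1) => i mi.
by rewrite /mono gtn_eqF.
Qed.

Lemma tsum_mono m (u : R^nat) : tsum (fun i => mono m i * u i) = u m.
Proof.
apply/cvg_lim => //; apply: cvg_near_cst; exists m.+1 => // n /= mn.
rewrite /series/= (bigD1_seq m) ?mem_index_iota ?iota_uniq//=.
rewrite /mono eqxx mul1r big1 ?addr0// => i im.
by rewrite (negbTE im) mul0r.
Qed.

Lemma ip_mono m a : ip al (mono m) a = rho al a m.
Proof. exact: tsum_mono. Qed.

Lemma ip_mono_le1 m : ip al (mono m) (mono m) <= 1.
Proof. by rewrite ip_mono /rho tsum_mono wt_le1. Qed.

Lemma rho_le_ip m a : entire a -> rho al a m ^+ 2 <= ip al a a.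
Proof.
move=> ea; rewrite -ip_mono; apply: le_trans (ip_CS (entire_mono m) ea) _.
by rewrite ler_piMl ?ip_ge0 ?ip_mono_le1.
Qed.

End Inner_product.

(** * The commuting differential operator *)

Section Differential_operator.
Context {R : realType}.
Variable al kap : R.
Hypothesis al0 : 0 < al.
Implicit Types (a b f : R^nat).

Definition ev (m : nat) : R := m%:R * (m%:R + al + 1).

(* -(u (1 - u) g'' + (al + 1 - (al + 2) u) g') + kap u g, on the coefficients of g. *)
Definition Dop a : R^nat := fun m =>
  ev m * a m - m.+1%:R * (m.+1%:R + al) * a m.+1 + kap * unshift a m.

(** The transpose of the matrix of [Dop]. At m = 0 the junk value [w 0.-1] is multiplied by 0. *)
Definition Dadj (w : R^nat) : R^nat := fun m =>
  ev m * w m - m%:R * (m%:R + al) * w m.-1 + kap * w m.+1.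

Lemma natr_le_exp2 m : m%:R <= 2 ^+ m :> R.
Proof. by rewrite -natrX ler_nat ltnW// ltn_expl. Qed.

Lemma quad_le_exp4 m (x : R) : 0 <= x -> `|m%:R * (m%:R + x)| <= (x + 1) * 4 ^+ m.
Proof.
move=> x0; have h := natr_le_exp2 m; have h1 : 1 <= 2 ^+ m :> R by rewrite exprn_ege1// ler1n.
rewrite ger0_norm ?mulr_ge0 ?addr_ge0//.
rewrite (_ : 4 = 2 * 2) ?exprMn; last by ring.
rewrite mulrA; have m0 := ler0n R m.
apply: (@le_trans _ _ (2 ^+ m * (2 ^+ m + x))); first by rewrite ler_pM ?addr_ge0 ?lerD2r.
rewrite mulrC ler_wpM2r ?exprn_ge0//.
by rewrite mulrDl mul1r addrC lerD2r ler_peMr.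
Qed.

Lemma entire_ev a : entire a -> entire (fun m => ev m * a m).
Proof.
move=> ea; apply: (entireM_bound ea (ltr0Sn R 3) (B := al + 1 + 1)) => m.
by rewrite /ev -addrA quad_le_exp4//; have := al0; lra.
Qed.

Lemma entire_sub a : entire a -> entire (fun m => m%:R * (m%:R + al) * a m).
Proof.
move=> ea; apply: (entireM_bound ea (ltr0Sn R 3) (B := al + 1)) => m.
by rewrite quad_le_exp4// ltW.
Qed.

Lemma entire_Dop a : entire a -> entire (Dop a).
Proof.
move=> ea; apply: entireD; last by apply: entireZ; exact: entire_unshift.
apply: entireB; first exact: entire_ev.
exact: (entire_shift (entire_sub ea)).
Qed.

(** Summation by parts: the terms m (m + al) a_m w_(m-1) are reindexed, and the one of index 0
    vanishes, so no boundary term is left. *)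
Lemma tsum_Dop a (w : R^nat) (B : R) : entire a -> (forall m, `|w m| <= B) ->
  tsum (fun m => Dop a m * w m) = tsum (fun m => a m * Dadj w m).
Proof.
move=> ea wB.
have wB1 m : `|w m| <= B * 1 ^+ m by rewrite expr1n mulr1.
have wp m : `|w m.-1| <= B * 1 ^+ m by rewrite expr1n mulr1.
have ws m : `|w m.+1| <= B * 1 ^+ m by rewrite expr1n mulr1.
have S u v : entire u -> (forall m, `|v m| <= B * 1 ^+ m) -> abs_summable (fun m => u m * v m).
  by move=> eu vB; exact: entire_summable eu ltr01 vB.
pose x m := m%:R * (m%:R + al) * a m * w m.-1.
have ex := entire_sub ea.
have sx : abs_summable x by exact: S ex wp.
have s1 : abs_summable (fun m => ev m * a m * w m) by apply: S => //; exact: entire_ev.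
have s2 : abs_summable (fun m => kap * (unshift a m * w m)).
  by apply: abs_summableZ; apply: S => //; exact: entire_unshift.
have s3 : abs_summable (fun m => kap * (a m * w m.+1)) by apply: abs_summableZ; exact: S.
transitivity (tsum (fun m => ev m * a m * w m - x m.+1 + kap * (unshift a m * w m))).
  by congr tsum; apply/funext => m; rewrite /Dop /x /=; ring.
transitivity (tsum (fun m => ev m * a m * w m - x m + kap * (a m * w m.+1))); last first.
  by congr tsum; apply/funext => m; rewrite /Dadj /x /=; ring.
have sx1 := abs_summableS sx.
rewrite tsumD//; last exact: abs_summableB.
rewrite [in RHS]tsumD//; last exact: abs_summableB.
rewrite tsumB// [in RHS]tsumB//.
rewrite (tsum_recl sx) {2}/x !mul0r add0r; congr (_ - _ + _).
rewrite !tsumZ; [|exact: S|by apply: S => //; exact: entire_unshift].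
rewrite [in LHS]tsum_recl /= ?mul0r ?add0r//.
by apply: S => //; exact: entire_unshift.
Qed.

(** The left side is <u^m, D u^l> and the right side <D u^m, u^l>: the symmetry of D on monomials,
    from which [rho_Dop] and [ip_Dop] follow by summation. *)
Lemma Dadj_wt m l :
  Dadj (wt al m) l = ev m * wt al m l - m%:R * (m%:R + al) * wt al m.-1 l + kap * wt al m.+1 l.
Proof.
have h := al0; have m0 := ler0n R m; have l0 := ler0n R l.
have n1 : m%:R + l%:R + al + 1 != 0 by rewrite gt_eqF//; lra.
rewrite /Dadj; congr (_ + kap * _); last by rewrite /wt -[in LHS]natr1 -[in RHS]natr1; congr (_^-1); ring.
case: m m0 n1 => [|m] m0 n1; case: l l0 n1 => [|l] l0 n1.
- by rewrite /ev !mul0r.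
- rewrite /ev /wt /= !mul0r subr0 -natr1 in l0 n1 *.
  have := ler0n R l => ?.
  by field; apply/andP; split; rewrite gt_eqF//; lra.
- rewrite /ev /wt /= !mul0r subr0 -natr1 in m0 n1 *.
  have := ler0n R m => ?.
  by field; apply/andP; split; rewrite gt_eqF//; lra.
- rewrite /ev /wt /= -!natr1 in m0 l0 n1 *.
  have := ler0n R m; have := ler0n R l => ? ?.
  by field; apply/andP; split; rewrite gt_eqF//; lra.
Qed.

Lemma rho_Dop a m : entire a -> rho al (Dop a) m = Dadj (rho al a) m.
Proof.
move=> ea; rewrite /rho (@tsum_Dop _ _ 1)//; last first.
  by move=> l; have := norm_wt_le1 al0 m l; rewrite expr1n mulr1.
have S j := rho_summable al0 (m := j) ea.
rewrite /Dadj /rho -!tsumZ//.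
rewrite -tsumB; [|exact: abs_summableZ..].
rewrite -tsumD; last 2 first.
- by apply: abs_summableB; exact: abs_summableZ.
- exact: abs_summableZ.
transitivity (tsum (fun l => a l * Dadj (wt al m) l)) => //.
by congr tsum; apply/funext => l; rewrite Dadj_wt; ring.
Qed.

Lemma ip_Dop a b : entire a -> entire b -> ip al (Dop a) b = ip al a (Dop b).
Proof.
move=> ea eb; have [B B0 bB] := rho_bound al0 eb.
rewrite /ip (tsum_Dop ea bB); congr tsum; apply/funext => m.
by rewrite rho_Dop.
Qed.

Section Integral_operator.
Variable kk : R^nat.
Hypothesis ekk : entire kk.
(** The equation z K'' + (al + 1) K' = - kap K for K(z) = sum_m kk_m z^m, which is Bessel's equation
    after a change of variable. *)
Hypothesis kkS : forall m, m.+1%:R * (m.+1%:R + al) * kk m.+1 = - kap * kk m.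

Definition Hop a : R^nat := fun m => kk m * rho al a m.

Lemma entire_Hop a : entire a -> entire (Hop a).
Proof.
move=> ea; have [B aB] := rho_bound1 al0 ea.
have := entireM_bound ekk ltr01 aB.
by congr entire; apply/funext => m; rewrite mulrC.
Qed.

Lemma ip_Hop a b : entire a -> entire b -> ip al (Hop a) b = ip al a (Hop b).
Proof.
move=> ea eb; rewrite [RHS]ipC//; last exact: entire_Hop.
by congr tsum; apply/funext => m; rewrite /Hop mulrAC.
Qed.

Lemma HopZ k a : entire a -> Hop (fun m => k * a m) = (fun m => k * Hop a m).
Proof. by move=> ea; apply/funext => m; rewrite /Hop rhoZ// mulrCA. Qed.

Lemma HopD a b : entire a -> entire b -> Hop (fun m => a m + b m) = (fun m => Hop a m + Hop b m).
Proof. by move=> ea eb; apply/funext => m; rewrite /Hop rhoD// mulrDr. Qed.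

(** On moments D acts as [Dadj]. The diagonal terms agree, and the coefficients of rho_(m+1) and
    rho_(m-1) match by [kkS] at m and at m - 1. *)
Lemma Hop_Dop a : entire a -> Hop (Dop a) = Dop (Hop a).
Proof.
move=> ea; apply/funext => m; rewrite /Hop rho_Dop// /Dadj /Dop.
have e1 := kkS m; case: m e1 => [|m] /= e1.
  apply/eqP; rewrite -subr_eq0; apply/eqP.
  transitivity ((1%:R * (1%:R + al) * kk 1%N - - kap * kk 0%N) * rho al a 1%N); first by ring.
  by rewrite e1 subrr mul0r.
have e2 := kkS m; apply/eqP; rewrite -subr_eq0; apply/eqP.
transitivity ((m.+2%:R * (m.+2%:R + al) * kk m.+2 - - kap * kk m.+1) * rho al a m.+2
  - (m.+1%:R * (m.+1%:R + al) * kk m.+1 - - kap * kk m) * rho al a m); first by ring.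
by rewrite e1 e2 !subrr !mul0r subrr.
Qed.

End Integral_operator.

End Differential_operator.

(** * Jacobi polynomials *)

Section Jacobi.
Context {R : realType}.
Variable al : R.
Hypothesis al0 : 0 < al.
Implicit Types (a b f : R^nat).

Lemma ip_suml N (y : R^nat) (F : nat -> R^nat) f : (forall j, entire (F j)) -> entire f ->
  ip al (fun m => \sum_(j < N) y j * F j m) f = \sum_(j < N) y j * ip al (F j) f.
Proof.
move=> eF ef; elim: N => [|N ih].
  rewrite big_ord0 /ip -[RHS](@tsum0 R); congr tsum; apply/funext => m.
  by rewrite big_ord0 mul0r.
rewrite big_ord_recr/= -ih -ipZl// -ipDl//; last 2 first.
- by apply: entire_sum => j; exact: entireZ.
- exact: entireZ.
by congr ip; apply/funext => m; rewrite big_ord_recr.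
Qed.

(** Since u u^al = u^(al + 1), symmetry and positivity of multiplication by u are inherited from
    [ip] at the exponent al + 1. *)
Lemma ip_unshift f g : entire f -> entire g -> ip al (unshift f) g = ip (al + 1) f g.
Proof.
move=> ef eg; have h := al0; rewrite /ip tsum_recl/=; last first.
  by apply: ip_summable => //; exact: entire_unshift.
rewrite mul0r add0r; congr tsum; apply/funext => m; congr (_ * _).
congr tsum; apply/funext => l; congr (_ * _).
by rewrite /wt -natr1; congr (_^-1); ring.
Qed.

Lemma ip_unshiftC f g : entire f -> entire g -> ip al (unshift f) g = ip al f (unshift g).
Proof.
move=> ef eg; have h := al0; rewrite ip_unshift// [RHS]ipC//; last exact: entire_unshift.
by rewrite ip_unshift// ipC//; lra.
Qed.

Lemma ip_unshift_ge0 f : entire f -> 0 <= ip al (unshift f) f.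
Proof. by move=> ef; have h := al0; rewrite ip_unshift// ip_ge0//; lra. Qed.

(** The recursion solves D_0 pi = e_j pi, where D_0 is D at kap = 0, downwards from the leading
    coefficient 1; its denominator is e_j - e_(j-d'-1). *)
Fixpoint jacc (j d : nat) : R :=
  if d is d'.+1 then
    - jacc j d' * ((j%:R - d'%:R) * (j%:R - d'%:R + al)) /
      (d'.+1%:R * (2 * j%:R - d'%:R + al))
  else 1.

(* Monic orthogonal polynomials on [0, 1] for the weight u^al, given by their
   coefficient sequences; jacc j d is the coefficient of u^(j - d). *)
Definition jac (j : nat) : R^nat := fun i => if (i <= j)%N then jacc j (j - i) else 0.

Lemma jac_diag j : jac j j = 1.
Proof. by rewrite /jac leqnn subnn. Qed.

Lemma jac_gt j i : (j < i)%N -> jac j i = 0.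
Proof. by rewrite /jac ltnNge => /negbTE ->. Qed.

Lemma entire_jac j : entire (jac j).
Proof. by apply: (@entire_fin _ _ j.+1) => i; exact: jac_gt. Qed.

Lemma Dop_jac j i : Dop al 0 (jac j) i = ev al j * jac j i.
Proof.
have h := al0; rewrite /Dop mul0r addr0.
case: (ltngtP i j) => ij; last 2 first.
- by rewrite (jac_gt ij) (jac_gt (leqW ij)) !mulr0 subr0.
- by rewrite ij (@jac_gt j j.+1)// mulr0 subr0.
rewrite /jac ij (ltnW ij).
have -> : (j - i = (j - i.+1).+1)%N by rewrite subnSK.
set d := (j - i.+1)%N => /=.
have -> : j = (i + d + 1)%N by rewrite /d; lia.
rewrite /ev !natrD -!natr1; move: (jacc _ _) => x.
have i0 := ler0n R i; have d0 := ler0n R d.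
by field; apply/andP; split; rewrite gt_eqF//; lra.
Qed.

(** Compares consecutive degrees, so that the three-term recurrence becomes a rational identity in
    the single unknown [jacc j d]. *)
Lemma jacc_SS j d : (d <= j)%N ->
  jacc j.+1 d.+1 = - jacc j d * (j.+1%:R * (j.+1%:R + al) * (2 * j%:R + al - d%:R + 1)) /
    (d.+1%:R * (2 * j%:R + 2 + al) * (2 * j%:R + 1 + al)).
Proof.
have h := al0; have j0 := ler0n R j; elim: d => [|d ih] dj.
  rewrite /= -natr1 subr0; field.
  by apply/andP; split; rewrite gt_eqF//; lra.
rewrite [LHS]/= -[in LHS]/(jacc j.+1 d.+1) ih ?(ltnW dj)//.
rewrite [in RHS]/= -!natr1; have d0 := ler0n R d.
have dj' : d%:R + 1 <= j%:R :> R by rewrite natr1 ler_nat.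
by field; repeat (apply/andP; split); rewrite gt_eqF//; lra.
Qed.

(** The difference [jacc j 1 - jacc j.+1 1] of subleading coefficients. *)
Definition jbet (j : nat) : R :=
  (j%:R + 1) * (j%:R + 1 + al) / (2 * j%:R + 2 + al) - j%:R * (j%:R + al) / (2 * j%:R + al).

(** For j > 0, the ratio of the squared norms of pi_j and pi_(j-1), by [jnormS]. Its vanishing at j
    = 0 cancels the term [jac 0.-1], which is [jac 0]. *)
Definition jgam (j : nat) : R :=
  (j%:R * (j%:R + al)) ^+ 2 / ((2 * j%:R + al) ^+ 2 * ((2 * j%:R + al) ^+ 2 - 1)).

Lemma jac_rec j i :
  unshift (jac j) i = jac j.+1 i + jbet j * jac j i + jgam j * jac j.-1 i.
Proof.
have h := al0; have j0 := ler0n R j.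
have [ij|ij] := ltnP j.+1 i.
  have ij1 : (j < i)%N by exact: ltnW.
  rewrite !jac_gt//; last by rewrite (leq_ltn_trans (leq_pred j)).
  case: i ij ij1 => // i ij ij1.
  by rewrite /= jac_gt// !mulr0 !addr0.
have -> : unshift (jac j) i = jacc j (j.+1 - i).
  case: i ij => [|i] ij /=; last by rewrite /jac -ltnS ij subSS.
  by rewrite subrr mul0r mulr0 mul0r.
have -> : jac j.+1 i = jacc j.+1 (j.+1 - i) by rewrite /jac ij.
rewrite /jac; move: ij; case: ltngtP => // [ij _|->]; last first.
  by rewrite subnn ltnn [(j < _)%N]ltnNge leq_pred /= !mulr0 !addr0.
have -> : (i <= j)%N by rewrite -ltnS.
rewrite subSn//.
have [->|nij] := eqVneq i j.
  rewrite subnn; have -> : jgam j * (if (j <= j.-1)%N then jacc j.-1 (j.-1 - j) else 0) = 0.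
    case: j {j0 ij} => [|j]; first by rewrite /jgam mul0r expr0n mul0r mul0r.
    by rewrite /= ltnn mulr0.
  rewrite /= /jbet -natr1 !subr0; field.
  by apply/andP; split; rewrite gt_eqF//; lra.
have {ij nij} ij : (i < j)%N by rewrite ltn_neqAle nij -ltnS.
case: j j0 ij => // j j0 ij; rewrite -[j.+1.-1]/j; rewrite ltnS in ij.
rewrite ij (subSn ij); have dj : (j - i <= j)%N by exact: leq_subr.
move: (j - i)%N dj => d dj.
have -> : jacc j.+1 d.+2 = - jacc j.+1 d.+1 * ((j.+1%:R - d.+1%:R) * (j.+1%:R - d.+1%:R + al)) /
      (d.+2%:R * (2 * j.+1%:R - d.+1%:R + al)) by [].
rewrite (@jacc_SS j.+1 d.+1)// jacc_SS// /jbet /jgam -!natr1.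
move: (jacc j d) => x; have d0 := ler0n R d; have jj := ler0n R j.
have dj' : d%:R <= j%:R :> R by rewrite ler_nat.
field; repeat (apply/andP; split); rewrite gt_eqF//; nra.
Qed.

Lemma jgam_ge0 j : 0 <= jgam j.
Proof.
have h := al0; case: j => [|j]; first by rewrite /jgam mul0r expr0n mul0r.
have j0 := ler0n R j; rewrite /jgam -natr1 divr_ge0 ?sqr_ge0// mulr_ge0 ?sqr_ge0//; nra.
Qed.

Lemma jgam_gt0 j : 0 < jgam j.+1.
Proof.
have h := al0; have j0 := ler0n R j; rewrite /jgam -natr1 divr_gt0//.
  by rewrite exprn_gt0// mulr_gt0//; lra.
by rewrite mulr_gt0 ?exprn_gt0//; nra.
Qed.

Lemma jgam_le1 j : jgam j <= 1.
Proof.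
have h := al0; case: j => [|j]; first by rewrite /jgam mul0r expr0n mul0r.
have j0 := ler0n R j; rewrite /jgam -natr1.
have s1 : 0 < (2 * (j%:R + 1) + al) ^+ 2 - 1 by nra.
rewrite ler_pdivrMr ?mul1r; last by rewrite mulr_gt0 ?exprn_gt0//; lra.
have -> : (2 * (j%:R + 1) + al) ^+ 2 - 1 = 4 * ((j%:R + 1) * (j%:R + 1 + al)) + al ^+ 2 - 1.
  by ring.
move: j0; move: (j%:R : R) => x x0.
set y := (x + 1) * (x + 1 + al); have y1 : 1 <= y by rewrite /y; nra.
have -> : (2 * (x + 1) + al) ^+ 2 = 4 * y + al ^+ 2 by rewrite /y; ring.
by rewrite [leLHS]expr2; apply: ler_pM; nra.
Qed.

Lemma jbet_le1 j : jbet j <= 1.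
Proof.
have h := al0; have j0 := ler0n R j; rewrite /jbet lerBlDr.
rewrite ler_pdivrMr; last by lra.
set q := _ / _; have e : q * (2 * j%:R + al) = j%:R * (j%:R + al).
  by rewrite /q divfK// gt_eqF//; lra.
have q0 : 0 <= q by rewrite /q divr_ge0 ?mulr_ge0//; lra.
have -> : (1 + q) * (2 * j%:R + 2 + al) = 2 * j%:R + 2 + al + q * (2 * j%:R + al) + 2 * q by ring.
rewrite e; lra.
Qed.

Lemma jac_orth i j : i != j -> ip al (jac i) (jac j) = 0.
Proof.
move=> ij; have h := al0; have ei := entire_jac i; have ej := entire_jac j.
have e : (ev al i - ev al j) * ip al (jac i) (jac j) = 0.
  apply/eqP; rewrite mulrBl subr_eq0 -ipZl// -ipZr//; apply/eqP.
  have E k : (fun m => ev al k * jac k m) = Dop al 0 (jac k).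
    by apply/funext => m; rewrite Dop_jac.
  by rewrite !E ip_Dop.
move/eqP: e; rewrite mulf_eq0 => /orP[|/eqP//].
have -> : ev al i - ev al j = (i%:R - j%:R) * (i%:R + j%:R + al + 1) by rewrite /ev; ring.
rewrite mulf_eq0 subr_eq0 eqr_nat (negbTE ij)/= gt_eqF//.
by have := ler0n R i; have := ler0n R j; lra.
Qed.

Definition jnorm j := ip al (jac j) (jac j).

Lemma unshift_jac j :
  unshift (jac j) = (fun m => jac j.+1 m + (jbet j * jac j m + jgam j * jac j.-1 m)).
Proof. by apply/funext => m; rewrite jac_rec addrA. Qed.

Lemma ip_unshift_jac j f : entire f ->
  ip al (unshift (jac j)) f =
    ip al (jac j.+1) f + (jbet j * ip al (jac j) f + jgam j * ip al (jac j.-1) f).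
Proof.
move=> ef; have h := al0; have e k := entire_jac k.
rewrite unshift_jac ipDl// ?ipDl ?ipZl//; do ?[exact: entireZ|apply: entireD].
Qed.

(** Both sides are <u pi_j, pi_(j+1)>, computed by the recurrence of pi_j and by that of
    pi_(j+1). *)
Lemma jnormS j : jnorm j.+1 = jgam j.+1 * jnorm j.
Proof.
have h := al0; have e k := entire_jac k.
have := ip_unshift_jac j (e j.+1).
rewrite (@jac_orth j j.+1) ?ltn_eqF// (@jac_orth j.-1 j.+1); last first.
  by rewrite ltn_eqF// (leq_ltn_trans (leq_pred j)).
rewrite !mulr0 !addr0 ip_unshiftC// -/(jnorm j.+1) => <-.
rewrite ipC//; last exact: entire_unshift.
rewrite ip_unshift_jac// (@jac_orth j.+2 j) ?gtn_eqF//.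
by rewrite (@jac_orth j.+1 j) ?gtn_eqF// mulr0 !add0r.
Qed.

Lemma jnorm0 : jnorm 0 = (al + 1)^-1.
Proof.
have e : jac 0 = mono 0 by apply/funext => -[|i]; rewrite /jac /mono.
by rewrite /jnorm e ip_mono /rho tsum_mono /wt !add0r.
Qed.

Lemma jnorm_gt0 j : 0 < jnorm j.
Proof.
have h := al0; elim: j => [|j ih]; first by rewrite jnorm0 invr_gt0; lra.
by rewrite jnormS mulr_gt0// jgam_gt0.
Qed.

(** The right side is the value of [jgam j.+1] at al = 0, namely 1/16 times a factor of Wallis'
    product. *)
Lemma jgamS_le j : jgam j.+1 <=
  16^-1 * ((2 * (j%:R + 1)) ^+ 2 / ((2 * (j%:R + 1)) ^+ 2 - 1)).
Proof.
have h := al0; rewrite /jgam -[j.+1%:R]natr1.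
have : 1 <= j%:R + 1 :> R by rewrite lerDr.
move: (j%:R + 1) => k k1; set S := 2 * k + al.
have Sk : 2 * k <= S by rewrite /S; lra.
have S2 : (2 * k) ^+ 2 <= S ^+ 2 by rewrite lerXn2r ?nnegrE//; lra.
have y16 : 16 * (k * (k + al)) ^+ 2 <= S ^+ 2 * S ^+ 2.
  have -> : 16 * (k * (k + al)) ^+ 2 = (S ^+ 2 - al ^+ 2) ^+ 2 by rewrite /S; ring.
  by rewrite -expr2 lerXn2r ?nnegrE ?sqr_ge0//; [rewrite /S; nra|have := sqr_ge0 al; lra].
have k2 : 1 < (2 * k) ^+ 2 by nra.
set K := (2 * k) ^+ 2 in S2 k2 *; move: y16; move: (S ^+ 2) S2 => T KT y16.
rewrite ler_pdivrMr; last by rewrite mulr_gt0//; lra.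
rewrite -mulrA ler_pdivlMl// (le_trans y16)//.
rewrite [leRHS](_ : _ = T * (K * (T - 1) / (K - 1))); last by field; lra.
rewrite ler_wpM2l; [by []|lra|]; rewrite ler_pdivlMr; nra.
Qed.

(* (2 j + 1) / (j + 1) bounds a partial Wallis product, and telescopes. *)
Lemma jnorm_le j : jnorm j <= (al + 1)^-1 * 16^-1 ^+ j * ((2 * j%:R + 1) / (j%:R + 1)).
Proof.
have h := al0; elim: j => [|j ih].
  by rewrite jnorm0 mulr0 !add0r expr0 divr1 !mulr1.
rewrite jnormS.
have j0 := ler0n R j; have jn := ltW (jnorm_gt0 j).
apply: (le_trans (ler_wpM2r jn (jgamS_le j))).
have k0 : 0 <= 16^-1 * ((2 * (j%:R + 1)) ^+ 2 / ((2 * (j%:R + 1)) ^+ 2 - 1)) :> R.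
  by apply: le_trans (jgamS_le j); exact: jgam_ge0.
apply: (le_trans (ler_wpM2l k0 ih)).
rewrite [16^-1 ^+ j.+1]exprS -[j.+1%:R]natr1.
rewrite [leLHS](_ : _ = (al + 1)^-1 * (16^-1 * 16^-1 ^+ j) *
  ((2 * (j%:R + 1)) ^+ 2 / ((2 * (j%:R + 1)) ^+ 2 - 1) * ((2 * j%:R + 1) / (j%:R + 1)))); last by ring.
apply: ler_wpM2l.
  by rewrite mulr_ge0 ?mulr_ge0 ?exprn_ge0 ?invr_ge0//; lra.
move: (j%:R : R) j0 => x x0.
rewrite [leLHS](_ : _ = 4 * (x + 1) / (2 * x + 3)); last first.
  by field; repeat (apply/andP; split); rewrite gt_eqF//; nra.
rewrite ler_pdivrMr; last by lra.
by rewrite mulrAC ler_pdivlMr; nra.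
Qed.

Lemma jnorm_le2 j : jnorm j <= 2 * (al + 1)^-1 * 16^-1 ^+ j.
Proof.
have h := al0; apply: (le_trans (jnorm_le j)).
rewrite [leRHS](_ : _ = (al + 1)^-1 * 16^-1 ^+ j * 2); last by ring.
apply: ler_wpM2l; first by rewrite mulr_ge0 ?exprn_ge0 ?invr_ge0//; lra.
by have j0 := ler0n R j; rewrite ler_pdivrMr; lra.
Qed.

Section Eigenvector.
Variables (kap chi : R) (psi : R^nat).
Hypothesis kap0 : 0 < kap.
Hypothesis epsi : entire psi.
Hypothesis Dpsi : Dop al kap psi = (fun m => chi * psi m).

Let M j := ip al (jac j) psi.

Lemma Dop_kap (k : R) a : Dop al k a = (fun m => Dop al 0 a m + k * unshift a m).
Proof. by apply/funext => m; rewrite /Dop mul0r addr0. Qed.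

(** Pair D psi = chi psi with pi_j and move D = D_0 + kap u onto pi_j. *)
Lemma jac_coeff_rec j :
  (chi - ev al j) * M j = kap * (M j.+1 + (jbet j * M j + jgam j * M j.-1)).
Proof.
have h := al0; have e k := entire_jac k.
have : ip al (Dop al kap (jac j)) psi = chi * M j by rewrite ip_Dop// Dpsi ipZr.
rewrite Dop_kap ipDl//; last 2 first.
- exact: entire_Dop.
- by apply: entireZ; exact: entire_unshift.
rewrite (_ : Dop al 0 (jac j) = fun m => ev al j * jac j m); last first.
  by apply/funext => m; rewrite Dop_jac.
rewrite !ipZl//; last exact: entire_unshift.
by rewrite ip_unshift_jac// -/(M j) -/(M j.+1) -/(M j.-1) => E; rewrite mulrBl -E; ring.
Qed.

(* As long as |M j| is nondecreasing the recurrence makes it grow further. *)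
Lemma jac_coeff_growth J : (forall i, (i < J)%N -> 3 * kap <= chi - ev al i) ->
  forall j, (j < J)%N -> (chi - ev al j - 2 * kap) * `|M j| <= kap * `|M j.+1|.
Proof.
move=> G; have kp := kap0.
have step j : (j < J)%N -> `|M j.-1| <= `|M j| ->
    (chi - ev al j - 2 * kap) * `|M j| <= kap * `|M j.+1|.
  move=> /G Gj Mj.
  have E : kap * M j.+1 = (chi - ev al j - kap * jbet j) * M j - kap * (jgam j * M j.-1).
    by have := jac_coeff_rec j; lra.
  rewrite -[X in X * `|M j.+1|]gtr0_norm// -normrM E.
  apply: le_trans (lerB_dist _ _).
  have b1 : kap * jbet j <= kap by rewrite ger_pMr// jbet_le1.
  have g1 : kap * (jgam j * `|M j.-1|) <= kap * `|M j|.
    rewrite ler_pM2l// (le_trans _ Mj)//.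
    by rewrite ler_piMl// jgam_le1.
  have -> : `|kap * (jgam j * M j.-1)| = kap * (jgam j * `|M j.-1|).
    by rewrite normrM normrM (gtr0_norm kp) (ger0_norm (jgam_ge0 j)).
  rewrite normrM.
  rewrite (@ger0_norm _ (chi - ev al j - kap * jbet j)); last by lra.
  have : (chi - ev al j - kap) * `|M j| <= (chi - ev al j - kap * jbet j) * `|M j|.
    by rewrite ler_wpM2r//; lra.
  by lra.
(* Monotonicity starts for free, since [0.-1 = 0]. It propagates because the margin 3 kap minus the
   loss 2 kap leaves a factor at least kap. *)
suff H j : (j < J)%N -> `|M j.-1| <= `|M j| by move=> j jJ; apply: step => //; exact: H.
elim: j => // j ih jJ; have jJ' : (j < J)%N by exact: ltnW.
have := step _ jJ' (ih jJ'); have := G _ jJ'; have := normr_ge0 (M j) => M0 Gj S.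
rewrite -(ler_pM2l kp) (le_trans _ S)// ler_wpM2r//; lra.
Qed.

Lemma jac_coeff_prod J : (forall i, (i < J)%N -> 3 * kap <= chi - ev al i) ->
  \prod_(i < J) ((chi - ev al i - 2 * kap) / kap) * `|M 0| <= `|M J|.
Proof.
move=> G; have kp := kap0; elim: J G => [|J ih] G; first by rewrite big_ord0 mul1r.
rewrite big_ord_recr/= mulrAC.
have g0 : 0 <= (chi - ev al J - 2 * kap) / kap.
  by have := G J (ltnSn J) => ?; rewrite divr_ge0 ?(ltW kp)//; lra.
have /(ler_wpM2r g0) /le_trans := ih (fun i iJ => G i (ltnW iJ)); apply.
have := jac_coeff_growth G (ltnSn J).
by rewrite mulrA ler_pdivrMr// [`|M J| * _]mulrC [`|M J.+1| * _]mulrC.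
Qed.

Lemma jac_coeff0_le J : (forall i, (i < J)%N -> 3 * kap <= chi - ev al i) ->
  (\prod_(i < J) ((chi - ev al i - 2 * kap) / kap)) ^+ 2 * rho al psi 0 ^+ 2 <=
    2 * (al + 1)^-1 * 16^-1 ^+ J * ip al psi psi.
Proof.
move=> G; have h := al0; have kp := kap0.
have p0 : 0 <= \prod_(i < J) ((chi - ev al i - 2 * kap) / kap).
  by apply: prodr_ge0 => i _; have := G i (ltn_ord i) => ?; rewrite divr_ge0 ?(ltW kp)//; lra.
have e0 : rho al psi 0 = M 0.
  have e : jac 0 = mono 0 by apply/funext => -[|i]; rewrite /jac /mono.
  by rewrite /M e ip_mono.
have := jac_coeff_prod G; rewrite -exprMn e0 => H.
apply: (@le_trans _ _ (M J ^+ 2)).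
  rewrite -(real_normK (num_real (M J))) -[leLHS](real_normK (num_real _)) normrM (ger0_norm p0).
  by rewrite lerXn2r ?nnegrE ?mulr_ge0.
apply: (le_trans (ip_CS al0 (entire_jac J) epsi)).
by rewrite ler_wpM2r ?ip_ge0//; exact: jnorm_le2.
Qed.

End Eigenvector.

End Jacobi.

(** * Lower bound for D off the polynomials of degree < n *)

Section Rayleigh.
Context {R : realType}.
Variable al : R.
Hypothesis al0 : 0 < al.
Implicit Types (a b f : R^nat).

Definition trunc (N : nat) a : R^nat := fun m => if (m < N)%N then a m else 0.

Lemma entire_trunc N a : entire (trunc N a).
Proof. by apply: (@entire_fin _ _ N) => m Nm; rewrite /trunc ltnNge Nm. Qed.

Lemma tsum_fin N (u : R^nat) : (forall m, (N <= m)%N -> u m = 0) -> tsum u = series u N.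
Proof.
move=> u0; apply/cvg_lim => //; apply: cvg_near_cst; exists N => // n /= Nn.
rewrite /series/= (big_cat_nat (n := N))//= [X in _ + X]big_nat [X in _ + X]big1 ?addr0//.
by move=> m /andP[Nm _]; exact: u0.
Qed.

Lemma ip_truncl N a b : ip al (trunc N a) b = series (fun m => a m * rho al b m) N.
Proof.
rewrite /ip (@tsum_fin N); last by move=> m Nm; rewrite /trunc ltnNge Nm/= mul0r.
by rewrite /series/= [LHS]big_nat [RHS]big_nat; apply: eq_bigr => m /andP[_ mN]; rewrite /trunc mN.
Qed.

Lemma ip_trunc N a b : ip al (trunc N a) (trunc N b) = ipN al N a b.
Proof.
rewrite ip_truncl /series/= /ipN; apply: eq_bigr => m _.
rewrite /rho (@tsum_fin N); last by move=> l Nl; rewrite /trunc ltnNge Nl/= mul0r.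
rewrite /series/= mulr_sumr [LHS]big_nat [RHS]big_nat; apply: eq_bigr => l /andP[_ lN].
by rewrite /trunc lN mulrA.
Qed.

Lemma jac_span N a : (forall m, (N <= m)%N -> a m = 0) ->
  exists y : R^nat, a = (fun m => \sum_(j < N) y j * jac al j m).
Proof.
elim: N a => [|N ih] a aN.
  by exists (fun=> 0); apply/funext => m; rewrite big_ord0 aN.
have [m Nm|y ay] := ih (fun m => a m - a N * jac al N m).
  have [->|mN] := eqVneq m N; first by rewrite jac_diag mulr1 subrr.
  have Nm' : (N < m)%N by rewrite ltn_neqAle eq_sym mN.
  by rewrite jac_gt// aN// mulr0 subr0.
exists (fun j => if (j < N)%N then y j else a N); apply/funext => m.
rewrite big_ord_recr/= ltnn.
under eq_bigr do rewrite ltn_ord.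
by have /(congr1 (fun f => f m)) /= <- := ay; rewrite subrK.
Qed.

Lemma ip_jac_span N (y : R^nat) i : (i < N)%N ->
  ip al (fun m => \sum_(j < N) y j * jac al j m) (jac al i) = y i * jnorm al i.
Proof.
move=> iN; have h := al0; rewrite ip_suml//; [|exact: entire_jac..].
rewrite (bigD1 (Ordinal iN))//= big1 ?addr0// => j ji.
by rewrite jac_orth ?mulr0.
Qed.

Lemma ip_jac_span2 N (y z : R^nat) :
  ip al (fun m => \sum_(j < N) y j * jac al j m) (fun m => \sum_(j < N) z j * jac al j m) =
  \sum_(j < N) y j * z j * jnorm al j.
Proof.
have h := al0; have e j := entire_jac al j.
rewrite ip_suml//; last by apply: entire_sum => j; exact: entireZ.
apply: eq_bigr => j _; rewrite ipC//; last by apply: entire_sum => i; exact: entireZ.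
by rewrite ip_jac_span// mulrA.
Qed.

Lemma Dop_sum (k : R) N (y : R^nat) (F : nat -> R^nat) :
  Dop al k (fun m => \sum_(j < N) y j * F j m) =
  (fun m => \sum_(j < N) y j * Dop al k (F j) m).
Proof.
apply/funext => m; rewrite /Dop.
have -> : unshift (fun m => \sum_(j < N) y j * F j m) m = \sum_(j < N) y j * unshift (F j) m.
  by case: m => //=; rewrite big1// => j _; rewrite mulr0.
rewrite !mulr_sumr -sumrB -big_split/=; apply: eq_bigr => j _; ring.
Qed.

Lemma ev_ge0 n : 0 <= ev al n.
Proof. by have h := al0; rewrite /ev mulr_ge0//; have := ler0n R n; lra. Qed.

Lemma le_ev i j : (i <= j)%N -> ev al i <= ev al j.
Proof.
move=> ij; have h := al0; have i0 := ler0n R i.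
have : i%:R <= j%:R :> R by rewrite ler_nat.
by rewrite /ev => ?; apply: ler_pM; lra.
Qed.

(** On polynomials both forms are diagonal in the Jacobi basis; once the components of index < n are
    removed, only eigenvalues at least e_n remain. *)
Lemma rayleigh_fin n N a : (forall m, (n + N <= m)%N -> a m = 0) ->
  ev al n * (ip al a a - \sum_(j < n) ip al a (jac al j) ^+ 2 / jnorm al j) <=
  ip al (Dop al 0 a) a.
Proof.
move=> /jac_span[y ->]; have h := al0; have e j := entire_jac al j.
rewrite Dop_sum.
rewrite (_ : (fun m => \sum_(j < n + N) y j * Dop al 0 (jac al j) m) =
             (fun m => \sum_(j < n + N) (y j * ev al j) * jac al j m)); last first.
  by apply/funext => m; apply: eq_bigr => j _; rewrite Dop_jac// mulrA.
rewrite !(ip_jac_span2 _ y) (ip_jac_span2 _ (fun j => y j * ev al j)).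
have -> : \sum_(j < n) ip al (fun m => \sum_(j < n + N) y j * jac al j m) (jac al j) ^+ 2 / jnorm al j =
    \sum_(j < n) y j * y j * jnorm al j.
  apply: eq_bigr => j _; rewrite ip_jac_span ?(leq_trans (ltn_ord j)) ?leq_addr//.
  by field; rewrite gt_eqF// jnorm_gt0.
rewrite !big_split_ord/= addrAC subrr add0r mulr_sumr.
apply: ler_wpDl.
  apply: sumr_ge0 => j _; rewrite [y j * _ * _]mulrAC -expr2.
  apply: mulr_ge0; first by rewrite mulr_ge0 ?sqr_ge0 ?ev_ge0.
  by apply: ltW; exact: jnorm_gt0.
apply: ler_sum => j _; rewrite -mulrA [leRHS](_ : _ = ev al (n + j) * (y (n + j)%N * (y (n + j)%N * jnorm al (n + j)))); last by ring.
rewrite ler_wpM2r//; last by rewrite le_ev// leq_addr.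
by rewrite mulrA -expr2 mulr_ge0 ?sqr_ge0// ltW// jnorm_gt0.
Qed.

Lemma cvg_entire0 a : entire a -> a @ \oo --> (0 : R).
Proof.
move=> ea; have := entire_abs_summable ea; move=> /normed_cvg.
exact: cvg_series_cvg_0.
Qed.

(* Expand truncations of f in the Jacobi basis: the components of degree < n tend
   to 0, and multiplication by kap u is nonnegative. *)
Lemma rayleigh_lower n (kap : R) f : 0 <= kap -> entire f ->
  (forall m, (m < n)%N -> rho al f m = 0) ->
  ev al n * ip al f f <= ip al (Dop al kap f) f.
Proof.
move=> k0 ef f0; have h := al0; have e j := entire_jac al j.
have eD k := entire_Dop k al0 ef.
apply: (@le_trans _ _ (ip al (Dop al 0 f) f)); last first.
  rewrite (Dop_kap _ kap) ipDl//; last by apply: entireZ; exact: entire_unshift.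
  rewrite lerDl ipZl//; last exact: entire_unshift.
  by rewrite mulr_ge0// ip_unshift_ge0.
have j0 j : (j < n)%N -> ip al f (jac al j) = 0.
  move=> jn; rewrite ipC// /ip -[RHS](@tsum0 R); congr tsum; apply/funext => m.
  have [mj|mj] := ltnP j m; first by rewrite jac_gt// mul0r.
  by rewrite f0 ?mulr0// (leq_ltn_trans mj).
pose c1 N := ev al n * (ipN al N.+1 f f -
  \sum_(j < n) series (fun m => f m * rho al (jac al j) m) N.+1 ^+ 2 / jnorm al j).
(* The second term is a correction: [Dop] of the truncation and the truncation of [Dop] differ only
   at index N, where f_(N+1) is lost. *)
pose c2 N := ipN al N.+1 (Dop al 0 f) f +
  N.+1%:R * (N.+1%:R + al) * f N.+1 * rho al (trunc N.+1 f) N.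
have h1 : c1 @ \oo --> ev al n * (ip al f f - 0).
  apply: cvgM; first exact: cvg_cst.
  apply: cvgB.
    by have := ipN_cvg h ef ef; rewrite -cvg_shiftS.
  pose S k N := series (fun m => f m * rho al (jac al k) m) N.+1 ^+ 2 / jnorm al k.
  suff : forall k, (k <= n)%N -> (fun N => \sum_(j < k) S j N) @ \oo --> (0 : R).
    by move/(_ n (leqnn n)).
  elim=> [_|k ih kn].
    by rewrite (_ : (fun N => _) = fun=> 0); [exact: cvg_cst|apply/funext => N; rewrite big_ord0].
  rewrite (_ : (fun N => _) = fun N => \sum_(j < k) S j N + S k N); last first.
    by apply/funext => N; rewrite big_ord_recr.
  rewrite -[X in _ --> X](addr0 0); apply: cvgD; first exact: ih (ltnW kn).
  rewrite -[X in _ --> X](mul0r (jnorm al k)^-1); apply: cvgM; last exact: cvg_cst.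
  have s0 : (fun N => series (fun m => f m * rho al (jac al k) m) N.+1) @ \oo --> (0 : R).
    by have := tsum_cvg (ip_summable h ef (e k)); rewrite -/(ip al f (jac al k)) j0// -cvg_shiftS.
  by rewrite -[X in _ --> X](mul0r 0); exact: (cvgM s0 s0).
have h2 : c2 @ \oo --> ip al (Dop al 0 f) f + 0.
  apply: cvgD; first by have := ipN_cvg h (eD 0) ef; rewrite -cvg_shiftS.
  have := cvg_entire0 (entire_sub al0 ef); rewrite -cvg_shiftS => g0.
  have sf := entire_abs_summable ef.
  apply: norm_cvg0; apply: (@squeeze_cvgr _ _ _ _ (fun=> 0)
    (fun N => `|N.+1%:R * (N.+1%:R + al) * f N.+1| * tsum (fun m => `|f m|))).
  - near=> N; rewrite normr_ge0/= normrM ler_wpM2l//.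
    apply: norm_tsum_le; first by apply: rho_summable => //; exact: entire_trunc.
    move=> k; apply: le_trans (series_norm_le k sf); apply: le_trans (ler_norm_sum _ _ _) _.
    apply: ler_sum => m _; rewrite normrM; apply: (@le_trans _ _ `|trunc N.+1 f m|).
      by rewrite ler_piMr//; have := norm_wt_le1 h N m; rewrite expr1n mulr1.
    by rewrite /trunc; case: ifP => // _; rewrite normr0.
  - exact: cvg_cst.
  - rewrite -[X in _ --> X](mul0r (tsum (fun m => `|f m|))).
    apply: cvgM; last exact: cvg_cst.
    by rewrite -(normr0 R); exact: cvg_norm.
rewrite -[X in _ * X <= _]subr0 -[leRHS]addr0; apply: (ler_cvg_to h1 h2).
exists n => // N /= nN; have tr := entire_trunc.
have -> : c1 N = ev al n * (ip al (trunc N.+1 f) (trunc N.+1 f) -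
    \sum_(j < n) ip al (trunc N.+1 f) (jac al j) ^+ 2 / jnorm al j).
  by rewrite /c1 ip_trunc; congr (_ * (_ - _)); apply: eq_bigr => j _; rewrite ip_truncl.
have -> : c2 N = ip al (Dop al 0 (trunc N.+1 f)) (trunc N.+1 f).
  have -> : Dop al 0 (trunc N.+1 f) = (fun m => trunc N.+1 (Dop al 0 f) m +
      (N.+1%:R * (N.+1%:R + al) * f N.+1) * mono N m).
    apply/funext => m; rewrite /Dop /trunc /mono !mul0r !addr0 !ltnS.
    case: (ltngtP m N) => mN.
    - by rewrite mulr0 addr0.
    - by rewrite !mulr0 subr0 addr0.
    - by rewrite mN !mulr0 mulr1; ring.
  rewrite ipDl//; [|apply: entireZ; exact: entire_mono].
  rewrite ip_trunc ipZl//; last exact: entire_mono.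
  by rewrite ip_mono.
apply: (@rayleigh_fin n (N.+1 - n)) => m; rewrite subnKC; last exact: leqW.
by move=> Nm; rewrite /trunc ltnNge Nm.
Unshelve. all: by end_near. Qed.

End Rayleigh.

(** * Pohozaev identity and simplicity of the spectrum *)

Section Pohozaev.
Context {R : realType}.
Variables (al kap chi : R).

(* D psi = chi psi reads odeL psi = 0. *)
Definition odeL (g : {poly R}) : {poly R} :=
  'X * g^`()^`() - 'X * ('X * g^`()^`()) + (al + 1) *: g^`() - (al + 2) *: ('X * g^`())
  + chi *: g - kap *: ('X * g).

(** The multiplier is 2 (1 - u) g'. Its factor 1 - u removes the boundary term at u = 1, leaves chi
    g(0)^2 at u = 0, and merges the terms in g'^2 into one of known sign. *)
Lemma pohozaev_deriv (g : {poly R}) :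
  ((1 - 'X) * (chi%:P - kap *: 'X) * (g * g) + 'X * (1 - 'X) ^+ 2 * (g^`() * g^`()))^`() =
  2%:P * ((1 - 'X) * g^`() * odeL g)
  - ((chi - kap)%:P + (2 * kap) *: (1 - 'X)) * (g * g)
  - (2 * al + 1) *: ((1 - 'X) ^+ 2 * (g^`() * g^`())).
Proof.
rewrite /odeL !(derivD, derivN, derivM, derivC, derivX, derivZ, derivXn, deriv_exp, expr2, derivB).
rewrite -!mul_polyC !(polyCD, polyCM, polyCN).
ring.
Qed.

(** Cutting a solution breaks its coefficient recurrence only at the degrees N and N + 1. *)
Lemma odeL_trunc (psi : R^nat) N : Dop al kap psi = (fun m => chi * psi m) ->
  odeL (\poly_(i < N.+1) psi i) =
  - ((N.+1%:R * (N.+1%:R + al) * psi N.+1) *: 'X^N + (kap * psi N) *: 'X^(N.+1)).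
Proof.
move=> Dpsi; apply/polyP => m; have := congr1 (fun f => f m) Dpsi; rewrite /Dop /ev/= => Dm.
have cd (p : {poly R}) i : p^`()`_i = p`_i.+1 * i.+1%:R by rewrite coef_deriv mulr_natr.
rewrite /odeL !(coefD, coefN, coefZ, coefXM, cd, coef_poly, coefXn).
case: m Dm => [|m] /= Dm; first by case: N => [|N] /=; lra.
have -> : (if m == 0%N then 0 else
    (if (m.-1.+2 < N.+1)%N then psi m.-1.+2 else 0) * m.-1.+2%:R * m.-1.+1%:R) =
    (if (m.+1 < N.+1)%N then psi m.+1 else 0) * m.+1%:R * m%:R.
  by case: m {Dm} => [|m] /=; rewrite ?mulr0.
rewrite !ltnS !eqSS.
move: Dm; rewrite -!natr1; set M := m%:R => Dm.
case: (ltngtP m.+1 N) => mN.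
- by rewrite (ltnW (ltnW mN)) (ltn_eqF (ltnW mN))/=; lra.
- move: mN; rewrite ltnS leq_eqVlt => /predU1P[->|mN].
    by rewrite leqnn eqxx/=; lra.
  by rewrite [(m <= N)%N]leqNgt mN (gtn_eqF mN)/=; lra.
- by rewrite -mN leqnSn (ltn_eqF (ltnSn m)) -natr1 -/M/=; lra.
Qed.

(** Integrate [pohozaev_deriv] over [0, 1] for truncations of psi. The defect of [odeL_trunc] costs
    at most a multiple of C (|A N| + |B N|), with C bounding |g'| for all N, and tends to 0; the
    other dropped terms have a favourable sign, and du dominates u^al du. *)
Lemma pohozaev (psi : R^nat) : 0 < al -> 0 <= kap <= chi -> entire psi ->
  Dop al kap psi = (fun m => chi * psi m) ->
  (chi - kap) * ip al psi psi <= chi * psi 0%N ^+ 2.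
Proof.
move=> al0 /andP[k0 kchi] epsi Dpsi.
pose A N := N.+1%:R * (N.+1%:R + al) * psi N.+1.
pose B N := kap * psi N.
pose C := tsum (fun m => `|m.+1%:R * psi m.+1|).
have sC : abs_summable (fun m => m.+1%:R * psi m.+1).
  apply: (@abs_summableS _ (fun m => m%:R * psi m)); apply: entire_abs_summable.
  apply: (entireM_bound epsi (ltr0Sn R 1) (B := 1)) => m.
  by rewrite mul1r ger0_norm// natr_le_exp2.
have C0 : 0 <= C by exact: tsum_norm_ge0.
have H N : (chi - kap) * ipN al N.+1 psi psi <=
    chi * psi 0%N ^+ 2 + 2 * (C * (`|A N| + `|B N|)).
  pose g := \poly_(i < N.+1) psi i.
  have gt t : 0 < t < 1 -> `|g^`().[t]| <= C.
    move=> /andP[t0 t1]; rewrite horner_coef.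
    apply: le_trans (ler_norm_sum _ _ _) _.
    apply: (@le_trans _ _ (series (fun m => `|m.+1%:R * psi m.+1|) (size g^`()))); last exact: series_norm_le.
    rewrite /series/= big_mkord; apply: ler_sum => i _.
    rewrite normrM; apply: (@le_trans _ _ `|g^`()`_i|).
      by rewrite ler_piMr// ger0_norm ?exprn_ge0 ?(ltW t0)// exprn_ile1 ?(ltW t0) ?(ltW t1).
    rewrite coef_deriv coef_poly; case: ifP => _; last by rewrite mul0rn normr0.
    by rewrite mulr_natl.
  have g0 : g.[0] = psi 0%N by rewrite horner_coef0 coef_poly.
  have lin3 (p q r : {poly R}) x y : wint 0 (x%:P * p - q - y *: r) = x * wint 0 p - wint 0 q - y * wint 0 r.
    by rewrite mul_polyC linearB linearB/= linearZ linearZ.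
  pose HE := (hornerM, hornerD, hornerN, hornerC, hornerX, hornerZ, horner_exp).
  have := wint_deriv ((1 - 'X) * (chi%:P - kap *: 'X) * (g * g) + 'X * (1 - 'X) ^+ 2 * (g^`() * g^`())).
  rewrite pohozaev_deriv lin3.
  have -> : ((1 - 'X) * (chi%:P - kap *: 'X) * (g * g) + 'X * (1 - 'X) ^+ 2 * (g^`() * g^`())).[1] = 0.
    by rewrite !HE; ring.
  have -> : ((1 - 'X) * (chi%:P - kap *: 'X) * (g * g) + 'X * (1 - 'X) ^+ 2 * (g^`() * g^`())).[0] = chi * psi 0%N ^+ 2.
    by rewrite !HE g0; ring.
  move=> E.
  have X3 : 0 <= wint 0 ((1 - 'X) ^+ 2 * (g^`() * g^`())).
    by apply: wint_ge0 => // t _; rewrite !HE -expr2 mulr_ge0 ?sqr_ge0.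
  have X1 : wint 0 ((1 - 'X) * g^`() * odeL g) <= C * (`|A N| + `|B N|).
    have -> : C * (`|A N| + `|B N|) = wint 0 (C * (`|A N| + `|B N|))%:P.
      by rewrite -[_%:P]mulr1 mul_polyC linearZ/= -[1]/('X^0) wintXn !add0r invr1 mulr1.
    apply: le_wint => // t tI; rewrite hornerC; apply: le_trans (ler_norm _) _.
    rewrite (odeL_trunc _ Dpsi) !HE normrM [X in X * _ <= _]normrM.
    case/andP: (tI) => t0 t1.
    have u1 : `|1 - t| <= 1 by rewrite ger0_norm; lra.
    apply: ler_pM; rewrite ?mulr_ge0//.
      rewrite -[C]mul1r; apply: ler_pM => //; exact: gt.
    rewrite normrN; apply: le_trans (ler_normD _ _) _.
    have tn k : `|t ^+ k| <= 1 by rewrite ger0_norm ?exprn_ge0 ?(ltW t0)// exprn_ile1 ?(ltW t0) ?(ltW t1).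
    by apply: lerD; rewrite normrM ler_piMr.
  have X2 : (chi - kap) * wint 0 (g * g) <= wint 0 (((chi - kap)%:P + (2 * kap) *: (1 - 'X)) * (g * g)).
    rewrite -linearZ; apply: le_wint => // t /andP[t0 t1].
    rewrite !HE -expr2 ler_wpM2r ?sqr_ge0// lerDl.
    by rewrite mulr_ge0 ?mulr_ge0//; lra.
  rewrite ipN_wint.
  have X4 : (chi - kap) * wint al (g * g) <= (chi - kap) * wint 0 (g * g).
    rewrite ler_wpM2l ?subr_ge0// le_wint_weight ?(ltW al0)// => t _.
    by rewrite hornerM -expr2 sqr_ge0.
  have X5 : 0 <= (2 * al + 1) * wint 0 ((1 - 'X) ^+ 2 * (g^`() * g^`())) by rewrite mulr_ge0//; lra.
  rewrite -/g; apply: (le_trans X4); apply: (le_trans X2).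
  by lra.
have h1 : (fun N => (chi - kap) * ipN al N.+1 psi psi) @ \oo --> (chi - kap) * ip al psi psi.
  apply: cvgM; first exact: cvg_cst.
  by have := ipN_cvg al0 epsi epsi; rewrite -cvg_shiftS.
have h2 : (fun N => chi * psi 0%N ^+ 2 + 2 * (C * (`|A N| + `|B N|))) @ \oo -->
    chi * psi 0%N ^+ 2 + 2 * (C * (`|0 : R| + `|0 : R|)).
  apply: cvgD; first exact: cvg_cst.
  apply: cvgM; first exact: cvg_cst.
  apply: cvgM; first exact: cvg_cst.
  apply: cvgD; apply: cvg_norm.
    by have := cvg_entire0 (entire_sub al0 epsi); rewrite -cvg_shiftS.
  exact: cvg_entire0 (entireZ kap epsi).
suff : (chi - kap) * ip al psi psi <= chi * psi 0%N ^+ 2 + 2 * (C * (`|0 : R| + `|0 : R|)).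
  by rewrite normr0 addr0 !mulr0 addr0.
by apply: ler_cvg_to h1 h2 _; exact: nearW.
Qed.

(** As (k + 1)(k + 1 + al) > 0, the equation determines psi_(k+1) from psi_k and psi_(k-1): u = 0 is
    a singular point with a single power series solution up to scaling. *)
Lemma Dop_eigen0 (psi : R^nat) : 0 < al -> Dop al kap psi = (fun m => chi * psi m) ->
  psi 0%N = 0 -> psi = (fun=> 0).
Proof.
move=> al0 Dpsi p0; suff H m : psi m = 0 /\ psi m.+1 = 0 by apply/funext => m; case: (H m).
have step k : unshift psi k = 0 -> psi k = 0 -> psi k.+1 = 0.
  move=> uk pk; have := congr1 (fun f => f k) Dpsi; rewrite /Dop uk pk !mulr0 addr0 sub0r => /eqP.
  rewrite oppr_eq0 mulf_eq0 mulf_eq0 pnatr_eq0/= gt_eqF ?orFb => [/eqP//|].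
  by have := ler0n R k.+1; lra.
elim: m => [|m [ih1 ih2]]; first by split => //; exact: step.
by split => //; exact: step.
Qed.

Lemma Dop_simple (psi phi : R^nat) : 0 < al ->
  Dop al kap psi = (fun m => chi * psi m) -> Dop al kap phi = (fun m => chi * phi m) ->
  psi 0%N != 0 -> phi = (fun m => phi 0%N / psi 0%N * psi m).
Proof.
move=> al0 Dpsi Dphi p0; set k := _ / _.
have E : Dop al kap (fun m => phi m - k * psi m) = (fun m => chi * (phi m - k * psi m)).
  apply/funext => m; have := congr1 (fun f => f m) Dpsi; have := congr1 (fun f => f m) Dphi.
  rewrite /Dop; have -> : unshift (fun m => phi m - k * psi m) m = unshift phi m - k * unshift psi m.
    by case: m => //=; rewrite mulr0 subr0.
  move=> /= h1 h2; rewrite [RHS]mulrBr (mulrCA chi k) -h1 -h2; ring.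
have := Dop_eigen0 al0 E; rewrite divfK ?subrr// => /(_ erefl) Z.
apply/funext => m; have /(congr1 (fun f => f m)) /= := Z.
by move/eqP; rewrite subr_eq0 => /eqP.
Qed.

End Pohozaev.

(** * Eigenvectors of the integral operator *)

Section Rayleigh_quotient.
Context {R : realType} (d : nat).
Implicit Types (A G S : 'I_d -> 'I_d -> R) (x : 'rV[R]_d).

Definition qform A x : R := \sum_i \sum_j x ord0 i * x ord0 j * A i j.

Lemma qformZ A k x : qform A (k *: x) = k ^+ 2 * qform A x.
Proof.
rewrite /qform mulr_sumr; apply: eq_bigr => i _; rewrite mulr_sumr.
by apply: eq_bigr => j _; rewrite !mxE; ring.
Qed.

Lemma continuous_sum_rV (I : Type) (s : seq I) (F : I -> 'rV[R]_d -> R) :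
  (forall i, continuous (F i)) -> continuous (fun x => \sum_(i <- s) F i x).
Proof.
move=> cF; elim: s => [|i s ih] x.
  rewrite (_ : (fun x => _) = fun=> 0); first exact: cst_continuous.
  by apply/funext => y; rewrite big_nil.
rewrite (_ : (fun x => _) = fun x => F i x + \sum_(i <- s) F i x).
  by apply: continuousD; [exact: cF|exact: ih].
by apply/funext => y; rewrite big_cons.
Qed.

Lemma qform_continuous A : continuous (qform A).
Proof.
apply: continuous_sum_rV => i; apply: continuous_sum_rV => j x.
have c k : (fun y : 'rV[R]_d => y ord0 k) @ x --> x ord0 k by exact: coord_continuous.
exact: (cvgM (cvgM (c i) (c j)) (cvg_cst (A i j))).
Qed.

(** The quotient is homogeneous of degree 0, so a maximum over the compact unit sphere is global. *)
Lemma qform_max G S (x1 : 'rV[R]_d) : x1 != 0 -> (forall x, x != 0 -> 0 < qform G x) ->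
  exists2 x0, x0 != 0 & forall x, qform S x * qform G x0 <= qform S x0 * qform G x.
Proof.
move=> x10 Gp; pose A := [set x : 'rV[R]_d | `|x| = 1].
have nA x : x != 0 -> A (`|x|^-1 *: x).
  move=> x0; rewrite /A/= normrZ gtr0_norm ?invr_gt0 ?normr_gt0// mulVf//.
  by rewrite normr_eq0.
have A0 : A !=set0 by exists (`|x1|^-1 *: x1); exact: nA.
have An0 x : A x -> x != 0.
  by rewrite /A/= => x1'; rewrite -normr_eq0 x1' oner_neq0.
have cA : compact A.
  apply: bounded_closed_compact.
    exists 1; split => // M M1 x /= ->; exact: ltW.
  rewrite (_ : A = (fun x : 'rV[R]_d => `|x|) @^-1` [set 1])//.
  apply: closed_comp; last exact: closed_eq.
  by move=> x _; exact: norm_continuous.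
have cf : {within A, continuous (fun x => qform S x / qform G x)}.
  apply: continuous_in_subspaceT => x; rewrite inE => /An0 x0.
  apply: continuousM; first exact: qform_continuous.
  by apply: continuousV; [rewrite gt_eqF// Gp|exact: qform_continuous].
have [x0] := EVT_max_rV A0 cA cf; rewrite inE => /An0 x00 M.
exists x0 => // x; have [->|xn0] := eqVneq x 0.
  by rewrite -(scale0r x0) !qformZ expr0n !mul0r mulr0.
have := M (`|x|^-1 *: x); rewrite inE => /(_ (nA _ xn0)).
rewrite !qformZ.
have -> : `|x|^-1 ^+ 2 * qform S x / (`|x|^-1 ^+ 2 * qform G x) = qform S x / qform G x.
  by field; rewrite gt_eqF ?Gp//= normr_eq0.
rewrite ler_pdivrMr ?Gp// mulrAC ler_pdivlMr ?Gp//.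
Qed.

End Rayleigh_quotient.

(** * The span of finitely many eigenspaces, and its top vector for D *)

Section Spectral.
Context {R : realType}.
Variables (al kap cc La : R) (kk : R^nat) (V : seq R).
Hypothesis al0 : 0 < al.
Hypothesis kap0 : 0 < kap.
Hypothesis cc0 : 0 < cc.
Hypothesis La0 : 0 < La.
Hypothesis ekk : entire kk.
Hypothesis kkS : forall m, m.+1%:R * (m.+1%:R + al) * kk m.+1 = - kap * kk m.
Hypothesis uV : uniq V.
Hypothesis VLa : forall v, v \in V -> La <= v.
Implicit Types (a b f : R^nat).

Local Notation H := (Hop al kk).
Local Notation D := (Dop al kap).
Local Notation "<< a , b >>" := (ip al a b).

Definition eigQ (v : R) a := entire a /\ forall m, cc * H (H a) m = v * a m.

Lemma eigQ_lin v k a b : eigQ v a -> eigQ v b -> eigQ v (fun m => k * a m + b m).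
Proof.
move=> [ea Ea] [eb Eb]; have h := al0; split; first by apply: entireD => //; exact: entireZ.
move=> m; have eH := entire_Hop al0 ekk.
rewrite (HopD al0 kk (entireZ k ea) eb) (HopZ al0 kk k ea).
rewrite (HopD al0 kk (entireZ k (eH _ ea)) (eH _ eb)) (HopZ al0 kk k (eH _ ea)).
by rewrite mulrDr mulrCA Ea Eb; ring.
Qed.

Lemma Hop0 : H (fun=> 0) = (fun=> 0).
Proof.
apply/funext => m; rewrite /Hop /rho [tsum _](_ : _ = 0) ?mulr0// -[RHS](@tsum0 R).
by congr tsum; apply/funext => l; rewrite mul0r.
Qed.

Lemma eigQ0 v : eigQ v (fun=> 0).
Proof. by split; [exact: entire0|move=> m; rewrite !Hop0 !mulr0]. Qed.

Lemma eigQ_Dop v a : eigQ v a -> eigQ v (D a).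
Proof.
move=> [ea Ea]; have h := al0; split; first exact: entire_Dop.
have eH := entire_Hop al0 ekk.
move=> m; rewrite (Hop_Dop al0 kkS ea) (Hop_Dop al0 kkS (eH _ ea)).
have := eH _ (eH _ ea) => eHH.
have -> : cc * D (H (H a)) m = D (fun m => cc * H (H a) m) m.
  by rewrite /Dop; case: m => [|m] /=; ring.
have -> : (fun m => cc * H (H a) m) = (fun m => v * a m) by apply/funext.
by rewrite /Dop; case: m => [|m] /=; ring.
Qed.

Lemma ip_HH a b : entire a -> entire b -> << H (H a), b >> = << H a, H b >>.
Proof. by move=> ea eb; rewrite ip_Hop//; exact: entire_Hop. Qed.

Lemma eigQ_ip v a b : eigQ v a -> entire b -> cc * << H a, H b >> = v * << a, b >>.
Proof.
move=> [ea Ea] eb; rewrite -ip_HH// -ipZl//; last first.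
  by apply: entire_Hop => //; exact: entire_Hop.
by rewrite -ipZl//; congr ip; apply/funext.
Qed.

Lemma eigQ_orth v w a b : v != w -> eigQ v a -> eigQ w b -> << a, b >> = 0.
Proof.
move=> vw Ea Eb; have ea := Ea.1; have eb := Eb.1.
have h1 := eigQ_ip Ea eb; have h2 := eigQ_ip Eb ea.
have eH := entire_Hop al0 ekk.
have : (v - w) * << a, b >> = 0.
  by rewrite mulrBl -h1 (ipC al0 ea eb) -h2 (ipC al0 (eH _ ea) (eH _ eb)) subrr.
by move/eqP; rewrite mulf_eq0 subr_eq0 (negbTE vw) => /eqP.
Qed.

Lemma ip_sum (I : Type) (s : seq I) (F : I -> R^nat) f : (forall i, entire (F i)) ->
  entire f -> << fun m => \sum_(i <- s) F i m, f >> = \sum_(i <- s) << F i, f >>.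
Proof.
move=> eF ef; elim: s => [|i s ih].
  rewrite big_nil /ip -[RHS](@tsum0 R); congr tsum; apply/funext => m.
  by rewrite big_nil mul0r.
rewrite big_cons -ih -ipDl//; last exact: entire_sum.
by congr ip; apply/funext => m; rewrite big_cons.
Qed.

Lemma Hop_sum (I : Type) (s : seq I) (F : I -> R^nat) : (forall i, entire (F i)) ->
  H (fun m => \sum_(i <- s) F i m) = (fun m => \sum_(i <- s) H (F i) m).
Proof.
move=> eF; apply/funext => m; rewrite /Hop -ip_mono ipC//; [|exact: entire_mono|exact: entire_sum].
rewrite ip_sum//; last exact: entire_mono.
rewrite mulr_sumr; apply: eq_bigr => i _.
by rewrite ipC// ?ip_mono//; exact: entire_mono.
Qed.

Lemma ip0_Hop0 a : entire a -> << a, a >> = 0 -> forall m, H a m = 0.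
Proof.
move=> ea a0 m; have := rho_le_ip al0 m ea; rewrite a0 -[X in _ <= X](expr0n _ 2).
rewrite /Hop => r0; have /eqP : rho al a m ^+ 2 == 0.
  by rewrite eq_le sqr_ge0 andbT (le_trans r0)// expr0n.
by move/eqP; rewrite expf_eq0/= => /eqP ->; rewrite mulr0.
Qed.

(* The span of the eigenspaces of cc H^2 for the eigenvalues listed in V. *)
Definition spanQ a := exists2 F : R -> R^nat, (forall v, eigQ v (F v)) &
  a = (fun m => \sum_(v <- V) F v m).

Lemma spanQ_entire a : spanQ a -> entire a.
Proof. by move=> [F EF ->]; apply: entire_sum => v; case: (EF v). Qed.

Lemma spanQ_lin k a b : spanQ a -> spanQ b -> spanQ (fun m => k * a m + b m).
Proof.
move=> [F EF ->] [G EG ->]; exists (fun v m => k * F v m + G v m).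
  by move=> v; exact: eigQ_lin.
by apply/funext => m; rewrite mulr_sumr -big_split.
Qed.

Lemma spanQ0 : spanQ (fun=> 0).
Proof. by exists (fun _ _ => 0) => [v|]; [exact: eigQ0|apply/funext => m; rewrite big1]. Qed.

Lemma spanQ_Dop a : spanQ a -> spanQ (D a).
Proof.
move=> [F EF ->]; exists (fun v => D (F v)); first by move=> v; exact: eigQ_Dop.
apply/funext => m; rewrite /Dop.
have -> : unshift (fun m => \sum_(v <- V) F v m) m = \sum_(v <- V) unshift (F v) m.
  by case: m => //=; rewrite big1.
by rewrite !mulr_sumr -sumrB -big_split/=.
Qed.

Lemma spanQ_sum n (x : 'I_n -> R) (b : 'I_n -> R^nat) : (forall i, spanQ (b i)) ->
  spanQ (fun m => \sum_i x i * b i m).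
Proof.
move=> sb; elim: (index_enum _) => [|i s ih].
  have := spanQ0; congr spanQ; apply/funext => m; by rewrite big_nil.
have := spanQ_lin (x i) (sb i) ih; congr spanQ; apply/funext => m; by rewrite big_cons.
Qed.

Lemma ip_span_diag (F : R -> R^nat) : (forall v, eigQ v (F v)) ->
  << fun m => \sum_(v <- V) F v m, fun m => \sum_(v <- V) F v m >> = \sum_(v <- V) << F v, F v >>.
Proof.
move=> EF; have eF v : entire (F v) by case: (EF v).
rewrite ip_sum//; last exact: entire_sum.
rewrite [LHS]big_seq [RHS]big_seq; apply: eq_bigr => v vV.
rewrite ipC//; last exact: entire_sum.
rewrite ip_sum// (bigD1_seq v)//= big1 ?addr0// => w wv.
exact: eigQ_orth (EF w) (EF v).
Qed.

(** Distinct eigenspaces are orthogonal, so both sides split over V, and cc |H F_v|^2 = v |F_v|^2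
    with v >= La. *)
Lemma spanQ_lower a : spanQ a -> La * << a, a >> <= cc * << H a, H a >>.
Proof.
move=> [F EF ->]; have eF v : entire (F v) by case: (EF v).
rewrite ip_span_diag// Hop_sum// ip_sum; last 2 first.
- by move=> v; exact: entire_Hop.
- by apply: entire_sum => v; exact: entire_Hop.
rewrite !mulr_sumr [leLHS]big_seq [leRHS]big_seq; apply: ler_sum => v vV.
rewrite -(Hop_sum V eF) (eigQ_ip (EF v)); last exact: entire_sum.
rewrite ipC//; last exact: entire_sum.
rewrite ip_sum// (bigD1_seq v)//= big1 ?addr0; last by move=> w wv; exact: eigQ_orth (EF w) (EF v).
by rewrite ler_wpM2r ?VLa// ip_ge0.
Qed.

(** Definiteness on the span: a null component has zero moments by Cauchy-Schwarz, so H kills it,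
    whereas cc H^2 multiplies it by some v >= La > 0. *)
Lemma spanQ_eq0 a : spanQ a -> << a, a >> = 0 -> a = (fun=> 0).
Proof.
move=> [F EF ->]; have eF v : entire (F v) by case: (EF v).
rewrite ip_span_diag// => /eqP; rewrite psumr_eq0; last by move=> v _; exact: ip_ge0.
move=> /allP Z; apply/funext => m; rewrite big_seq big1// => v vV.
have /eqP Hv := Z _ vV; have E := (EF v).2 m.
have H0 : H (F v) = (fun=> 0) by apply/funext => l; exact: ip0_Hop0.
have /eqP : v * F v m = 0.
  by rewrite -E H0 Hop0 mulr0.
rewrite mulf_eq0 gt_eqF/= => [/eqP//|].
by apply: lt_le_trans (VLa vV); have := La0.
Qed.

Lemma spanQ_gt0 a : spanQ a -> a <> (fun=> 0) -> 0 < << a, a >>.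
Proof.
move=> sa an0; rewrite lt_neqAle ip_ge0 ?andbT//; last exact: spanQ_entire.
by apply/eqP => /esym /(spanQ_eq0 sa).
Qed.

(** If the first N moments of a vanish, H a involves only the kk_m with m >= N, so |H a| is at most
    a tail of kk times |a|. For large N this contradicts [spanQ_lower] unless a = 0. *)
Lemma spanQ_finite : exists N, forall a, spanQ a ->
  (forall m, (m < N)%N -> rho al a m = 0) -> a = (fun=> 0).
Proof.
have sk := entire_abs_summable ekk.
have := tail_cvg0 sk; move=> /cvgrPdist_lt.
(* Chosen so that cc e^2 = La / 2, half of the constant in [spanQ_lower]. *)
pose e := Num.sqrt (La / cc / 2).
have Lc : 0 < La / cc / 2 by have := La0; have := cc0 => ??; rewrite !divr_gt0.
have e0 : 0 < e by rewrite sqrtr_gt0.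
move=> /(_ _ e0)[N _ /(_ N (leqnn N)) /=]; rewrite sub0r normrN => tN.
exists N => a sa r0; apply: spanQ_eq0 => //; have ea := spanQ_entire sa.
have eHa := entire_Hop al0 ekk ea.
set t := tsum _ in tN.
have t0 : 0 <= t by apply: tsum_norm_ge0; exact: (@abs_summable_drop _ kk N sk).
set A := << a, a >>; pose B := << H a, H a >>.
have A0 : 0 <= A by exact: ip_ge0.
have B0 : 0 <= B by exact: ip_ge0.
have rA f m : entire f -> `|rho al f m| <= Num.sqrt << f, f >>.
  by move=> ef; rewrite -sqrtr_sqr ler_wsqrtr// rho_le_ip.
have HB : B <= t * (Num.sqrt A * Num.sqrt B).
  apply: le_trans (ler_norm _) _.
  have sH := ip_summable al0 eHa eHa.
  have BE : B = tsum (fun m => H a (m + N)%N * rho al (H a) (m + N)%N).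
    rewrite /B /ip -(@tsum_drop _ (fun m => H a m * rho al (H a) m))// /series/= [X in _ - X]big_nat.
    by rewrite [X in _ - X]big1 ?subr0// => m /andP[_ mN]; rewrite /Hop r0// mulr0 mul0r.
  rewrite [X in `|X|]BE; apply: norm_tsum_le => [|k].
    exact: (@abs_summable_drop _ (fun m => H a m * rho al (H a) m) N sH).
  have skN := @abs_summable_drop _ kk N sk.
  apply: le_trans (ler_norm_sum _ _ _) _.
  apply: (@le_trans _ _ (series (fun m => `|kk (m + N)%N|) k * (Num.sqrt A * Num.sqrt B))).
    rewrite /series/= mulr_suml; apply: ler_sum => m _.
    by rewrite /Hop !normrM -mulrA ler_wpM2l// ler_pM// rA.
  by rewrite ler_wpM2r ?mulr_ge0 ?sqrtr_ge0//; exact: series_norm_le.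
have HBA : B <= t ^+ 2 * A.
  move: HB; rewrite -{1 3}(sqr_sqrtr B0) -{2}(sqr_sqrtr A0).
  have := sqrtr_ge0 A; have := sqrtr_ge0 B.
  move: (Num.sqrt A) (Num.sqrt B) => x y; rewrite le_eqVlt => /predU1P[<-|y0] x0 HB.
    by rewrite expr0n/= -exprMn sqr_ge0.
  rewrite -exprMn lerXn2r ?nnegrE ?mulr_ge0 ?(ltW y0)//.
  by rewrite -(ler_pM2r y0) -expr2 -mulrA.
have := spanQ_lower sa; rewrite -/A -/B => L.
have t2 : t ^+ 2 < La / cc / 2.
  have ee : e ^+ 2 = La / cc / 2 by rewrite sqr_sqrtr// ltW.
  by rewrite -ee; move: tN; rewrite (ger0_norm t0) => ?; nra.
have : La * A <= La / 2 * A.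
  apply: (le_trans L); apply: (@le_trans _ _ (cc * (La / cc / 2 * A))).
    by rewrite ler_wpM2l ?(ltW cc0)// (le_trans HBA)// ler_wpM2r// ltW.
  by rewrite le_eqVlt; apply/orP; left; apply/eqP; field; rewrite gt_eqF//; exact: cc0.
by have := La0; nra.
Qed.

Lemma left_kernel n N (A : 'M[R]_(n, N)) : (N < n)%N ->
  exists2 v : 'rV[R]_n, v != 0 & v *m A = 0.
Proof.
move=> Nn; have : kermx A != 0.
  apply/negP; rewrite kermx_eq0 /row_free => /eqP rA.
  by have := rank_leq_col A; rewrite rA leqNgt Nn.
by move=> /rowV0Pn[v /sub_kermxP vA v0]; exists v.
Qed.

Definition lin_free n (b : 'I_n -> R^nat) :=
  forall x : 'I_n -> R, (forall m, \sum_i x i * b i m = 0) -> forall i, x i = 0.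

Lemma rho_comb n (x : 'I_n -> R) (b : 'I_n -> R^nat) m : (forall i, entire (b i)) ->
  rho al (fun m => \sum_i x i * b i m) m = \sum_i x i * rho al (b i) m.
Proof.
move=> eb; rewrite -ip_mono ipC//; last 2 first.
- exact: entire_mono.
- by apply: entire_sum => i; exact: entireZ.
rewrite ip_sum; [|by move=> i; exact: entireZ|exact: entire_mono].
apply: eq_bigr => i _; rewrite ipZl//; last exact: entire_mono.
by rewrite ipC// ?ip_mono//; exact: entire_mono.
Qed.

(** The first N moments are N linear forms on a space of dimension n > N. *)
Lemma free_annihilator n N (b : 'I_n -> R^nat) : (forall i, spanQ (b i)) -> lin_free b -> (N < n)%N ->
  exists f, [/\ spanQ f, f <> (fun=> 0) & forall m, (m < N)%N -> rho al f m = 0].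
Proof.
move=> sb fb Nn; pose A : 'M[R]_(n, N) := \matrix_(i, m) rho al (b i) m.
have eb i : entire (b i) by exact: spanQ_entire.
have [v v0 vA] := left_kernel A Nn.
exists (fun m => \sum_i v ord0 i * b i m); split.
- exact: spanQ_sum.
- move=> f0; move/eqP: v0; apply; apply/rowP => i; rewrite mxE.
  by apply: (fb (fun i => v ord0 i)) => m; exact: (congr1 (fun f => f m) f0).
- move=> m mN; rewrite rho_comb//.
  have /matrixP/(_ ord0 (Ordinal mN)) := vA; rewrite !mxE => E; rewrite -[RHS]E.
  by apply: eq_bigr => i _; rewrite !mxE.
Qed.

(** A free family of maximal length is a basis; [spanQ_finite] and [free_annihilator] bound the
    lengths. *)
Lemma spanQ_basis : exists d (b : 'I_d -> R^nat),
  [/\ forall i, spanQ (b i), lin_free b &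
      forall a, spanQ a -> exists x : 'rV[R]_d, a = (fun m => \sum_i x ord0 i * b i m)].
Proof.
have [N HN] := spanQ_finite.
pose P n := `[< exists b : 'I_n -> R^nat, (forall i, spanQ (b i)) /\ lin_free b >].
have P0 : exists n, P n.
  by exists 0; apply/asboolP; exists (fun=> fun=> 0); split => [[]|x _ []].
have PN n : P n -> (n <= N)%N.
  move=> /asboolP[b [sb fb]]; rewrite leqNgt; apply/negP => Nn.
  by have [f [sf f0 rf]] := free_annihilator sb fb Nn; apply: f0; exact: HN.
have [d /asboolP[b [sb fb]] dmax] := ex_maxnP P0 PN.
exists d, b; split => // a sa.
pose b' (i : 'I_d.+1) := if insub (nat_of_ord i) is Some j then b j else a.
have b'w j : b' (widen_ord (leqnSn d) j) = b j by rewrite /b' /= valK.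
have b'm : b' ord_max = a by rewrite /b' insubF//= ltnn.
have nfb : ~ lin_free b'.
  move=> fb'; have /dmax : P d.+1.
    apply/asboolP; exists b'; split => // i.
    by rewrite /b'; case: insubP.
  by rewrite ltnn.
have [x xb [i xi]] : exists2 x : 'I_d.+1 -> R, forall m, \sum_i x i * b' i m = 0 & exists i, x i <> 0.
  apply: contrapT => nx; apply: nfb => x xb i; apply: contrapT => xi.
  by apply: nx; exists x => //; exists i.
have xb2 m : \sum_(j < d) x (widen_ord (leqnSn d) j) * b j m + x ord_max * a m = 0.
  rewrite -[RHS](xb m) big_ord_recr/= b'm; congr (_ + _).
  by apply: eq_bigr => j _; rewrite b'w.
have y0 : x ord_max != 0.
  apply/eqP => y0; apply: xi.
  have H0 : forall j, x (widen_ord (leqnSn d) j) = 0.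
    by apply: (fb (fun j => x (widen_ord (leqnSn d) j))) => m; have := xb2 m; rewrite y0 mul0r addr0.
  have [->//|im] := eqVneq i ord_max.
  have id : (i < d)%N by rewrite ltn_neqAle -ltnS ltn_ord andbT.
  by rewrite -(H0 (Ordinal id)); congr x; exact: val_inj.
exists (\row_j (- x (widen_ord (leqnSn d) j) / x ord_max)); apply/funext => m.
apply: (mulfI y0); rewrite mulr_sumr; have := xb2 m => /eqP; rewrite addrC addr_eq0 => /eqP ->.
rewrite -sumrN; apply: eq_bigr => j _; rewrite mxE; field; exact: y0.
Qed.

Lemma ip_comb n (x y : 'I_n -> R) (a b : 'I_n -> R^nat) : (forall i, entire (a i)) -> (forall i, entire (b i)) ->
  << fun m => \sum_i x i * a i m, fun m => \sum_i y i * b i m >> = \sum_i \sum_j x i * y j * << a i, b j >>.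
Proof.
move=> ea eb; have eB : entire (fun m => \sum_i y i * b i m).
  by apply: entire_sum => i; exact: entireZ.
rewrite ip_sum//; last by move=> i; exact: entireZ.
apply: eq_bigr => i _; rewrite ipZl// ipC// ip_sum//; last by move=> j; exact: entireZ.
rewrite mulr_sumr; apply: eq_bigr => j _; rewrite ipZl// ipC//; ring.
Qed.

Lemma Dop_comb n (x : 'I_n -> R) (b : 'I_n -> R^nat) :
  D (fun m => \sum_i x i * b i m) = (fun m => \sum_i x i * D (b i) m).
Proof.
apply/funext => m; rewrite /Dop.
have -> : unshift (fun m => \sum_i x i * b i m) m = \sum_i x i * unshift (b i) m.
  by case: m => //=; rewrite big1// => i _; rewrite mulr0.
by rewrite !mulr_sumr -sumrB -big_split/=; apply: eq_bigr => i _; ring.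
Qed.

Lemma ip_expand t a p b q : entire a -> entire p -> entire b -> entire q ->
  << fun m => t * a m + p m, fun m => t * b m + q m >> =
  t ^+ 2 * << a, b >> + t * << a, q >> + t * << p, b >> + << p, q >>.
Proof.
move=> ea ep eb eq; have eta := entireZ t ea; have etb := entireZ t eb.
rewrite (ipDl al0 eta ep (entireD etb eq)) !(ipDr al0 etb eq)//.
rewrite (ipZl al0 t ea (entireZ t eb)) (ipZr al0 t eb ea) (ipZl al0 t ea eq) (ipZr al0 t eb ep).
ring.
Qed.

(* psi maximises <D a, a> / <a, a> over the span; f, orthogonal to the polynomials
   of degree < n, shows that the maximum is at least e_n. *)
Lemma spectral_top n (g : 'I_n.+1 -> R^nat) : (forall i, spanQ (g i)) -> lin_free g ->
  exists psi chi mu, [/\ entire psi, 0 < << psi, psi >>, D psi = (fun m => chi * psi m),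
    ev al n <= chi & H psi = (fun m => mu * psi m) /\ La <= cc * mu ^+ 2].
Proof.
move=> sg fg; have h := al0.
have [f [sf fn0 rf]] := free_annihilator sg fg (ltnSn n).
have [d [b [sb fb bspan]]] := spanQ_basis.
have eb i : entire (b i) by exact: spanQ_entire.
pose comb (x : 'rV[R]_d) : R^nat := fun m => \sum_i x ord0 i * b i m.
have scomb x : spanQ (comb x) by exact: spanQ_sum.
pose G i j := << b i, b j >>; pose S i j := << D (b i), b j >>.
have GE x : qform G x = << comb x, comb x >> by rewrite ip_comb.
have SE x : qform S x = << D (comb x), comb x >>.
  by rewrite Dop_comb ip_comb// => i; exact: entire_Dop.
have comb0 x : x != 0 -> comb x <> (fun=> 0).
  move=> /eqP xn0 c0; apply: xn0; apply/rowP => i; rewrite mxE.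
  by apply: (fb (fun i => x ord0 i)) => m; exact: (congr1 (fun f => f m) c0).
have Gp x : x != 0 -> 0 < qform G x by move=> /comb0 x0; rewrite GE spanQ_gt0.
have [xf fE] := bspan f sf.
have xf0 : xf != 0.
  by apply/eqP => x0; apply: fn0; rewrite fE x0; apply/funext => m; rewrite big1// => i _; rewrite mxE mul0r.
have [x0 x00 M] := qform_max S xf0 Gp.
pose psi := comb x0; have spsi : spanQ psi by exact: scomb.
have epsi := spanQ_entire spsi.
have psi0 : 0 < << psi, psi >> by rewrite -GE Gp.
pose chi := << D psi, psi >> / << psi, psi >>.
have max a : spanQ a -> << D a, a >> <= chi * << a, a >>.
  move=> /bspan[x ->]; rewrite -/(comb x) -GE -SE mulrAC ler_pdivlMr//.
  by have := M x; rewrite !GE !SE.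
have crit a : spanQ a -> << fun m => chi * psi m - D psi m, a >> = 0.
  move=> sa; have ea := spanQ_entire sa; have eDpsi := entire_Dop kap al0 epsi.
  have eDa := entire_Dop kap al0 ea.
  set W := << _, _ >>.
  have WE : W = chi * << psi, a >> - << D psi, a >>.
    rewrite /W -ipZl// -[X in _ - X]mul1r -mulNr -ipZl// -ipDl//; try exact: entireZ.
    by congr ip; apply/funext => m; rewrite mulN1r.
  pose T := chi * << a, a >> - << D a, a >>.
  have T0 : 0 <= T by rewrite subr_ge0 max.
  (* First-order optimality along psi + t a: this quadratic stays nonnegative, so its slope W at t =
     0 must vanish. *)
  have Q t : 0 <= 2 * t * W + t ^+ 2 * T.
    have := max _ (spanQ_lin t sa spsi).
    have -> : D (fun m => t * a m + psi m) = (fun m => t * D a m + D psi m).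
      by apply/funext => m; rewrite /Dop; case: m => [|m] /=; ring.
    rewrite (ip_expand t eDa eDpsi ea epsi) (ip_expand t ea epsi ea epsi).
    have chiE : chi * << psi, psi >> = << D psi, psi >> by rewrite divfK// gt_eqF.
    rewrite (ipC al0 ea epsi) (ip_Dop kap al0 ea epsi) (ipC al0 ea eDpsi).
    rewrite WE /T; move: chiE => chiE L; rewrite -subr_ge0 in L.
    by apply: le_trans L _; rewrite le_eqVlt; apply/orP; left; apply/eqP; rewrite -chiE; ring.
  apply/eqP; apply: contrapT => /negP W0.
  have [T00|Tn0] := eqVneq T 0.
    by have := Q (- W); have : 0 < W ^+ 2 by [rewrite exprn_even_gt0]; rewrite T00; nra.
  have Tp : 0 < T by rewrite lt_neqAle eq_sym Tn0.
  have := Q (- W / T); have W2 : 0 < W ^+ 2 by rewrite exprn_even_gt0.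
  have -> : 2 * (- W / T) * W + (- W / T) ^+ 2 * T = - (W ^+ 2 / T) by field.
  by rewrite oppr_ge0 leNgt divr_gt0.
(* The defect chi psi - D psi lies in the span by invariance, hence is orthogonal to itself. *)
have Dpsi : D psi = (fun m => chi * psi m).
  have s : spanQ (fun m => chi * psi m - D psi m).
    have := spanQ_lin (-1) (spanQ_Dop spsi) (spanQ_lin chi spsi spanQ0).
    by congr spanQ; apply/funext => m; ring.
  have := spanQ_eq0 s (crit _ s) => Z; apply/funext => m.
  by have /(congr1 (fun f => f m))/eqP := Z; rewrite /= subr_eq0 => /eqP.
have p0 : psi 0%N != 0.
  apply/eqP => p0; have := Dop_eigen0 al0 Dpsi p0 => Z.
  by apply: (comb0 x0 x00).
have DH : D (H psi) = (fun m => chi * H psi m).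
  by rewrite -(Hop_Dop al0 kkS epsi) Dpsi (HopZ al0 kk _ epsi).
have HE := Dop_simple al0 Dpsi DH p0; set mu := _ / _ in HE.
exists psi, chi, mu; split => //.
- have /(le_trans (rayleigh_lower al0 (ltW kap0) (spanQ_entire sf) rf)) := max _ sf.
  by rewrite ler_pM2r// spanQ_gt0.
- split => //; have := spanQ_lower spsi; rewrite HE ipZl//; last exact: entireZ.
  rewrite (ipZr al0 mu epsi epsi) [X in _ <= X](_ : _ = cc * mu ^+ 2 * << psi, psi >>); last by ring.
  by rewrite ler_pM2r.
Qed.

Lemma eigQ_sum v (I : Type) (s : seq I) (P : pred I) (x : I -> R) (b : I -> R^nat) :
  (forall i, P i -> eigQ v (b i)) -> eigQ v (fun m => \sum_(i <- s | P i) x i * b i m).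
Proof.
move=> Eb; elim: s => [|i s ih].
  by under [X in eigQ v X]eq_fun do rewrite big_nil; exact: eigQ0.
case Pi : (P i); last by under [X in eigQ v X]eq_fun do rewrite big_cons Pi.
under [X in eigQ v X]eq_fun do rewrite big_cons Pi.
by apply: eigQ_lin => //; exact: Eb.
Qed.

Lemma spanQ_eig v a : v \in V -> eigQ v a -> spanQ a.
Proof.
move=> vV Ea; exists (fun w => if w == v then a else fun=> 0).
  by move=> w; case: eqP => [->//|_]; exact: eigQ0.
apply/funext => m; rewrite (bigD1_seq v)//= eqxx big1 ?addr0// => w wv.
by rewrite (negbTE wv).
Qed.

(** By orthogonality of the eigenspaces a linear relation splits into one relation for each
    eigenvalue. *)
Lemma free_glue n (lam : 'I_n -> R) (b : 'I_n -> R^nat) :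
  (forall i, eigQ (lam i) (b i)) -> (forall i, lam i \in V) ->
  (forall v (x : 'I_n -> R), (forall m, \sum_(i | lam i == v) x i * b i m = 0) ->
     forall i, lam i = v -> x i = 0) -> lin_free b.
Proof.
move=> Eb lV fb x xb0; pose A v : R^nat := fun m => \sum_(i | lam i == v) x i * b i m.
have EA v : eigQ v (A v) by apply: eigQ_sum => i /eqP <-.
have SA : (fun m => \sum_(v <- V) A v m) = fun=> 0.
  apply/funext => m; rewrite -[RHS](xb0 m) /A.
  under eq_bigr do rewrite big_mkcond/=.
  rewrite exchange_big/=; apply: eq_bigr => i _.
  rewrite (bigD1_seq (lam i))//= eqxx big1 ?addr0// => v vi.
  by rewrite eq_sym (negbTE vi).
have := ip_span_diag EA; rewrite SA.
have -> : << fun=> 0, fun=> 0 >> = 0.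
  by rewrite /ip -[RHS](@tsum0 R); congr tsum; apply/funext => m; rewrite mul0r.
move/esym/eqP; rewrite psumr_eq0; last by move=> v _; apply: ip_ge0 => //; case: (EA v).
move=> /allP Z i; have /eqP Ai := Z _ (lV i).
apply: (fb (lam i)) => // m.
by have := spanQ_eq0 (spanQ_eig (lV i) (EA (lam i))) Ai => /(congr1 (fun f => f m)).
Qed.

Lemma eigenvalue_bound n J (g : 'I_n.+1 -> R^nat) : (forall i, spanQ (g i)) -> lin_free g ->
  2 * kap <= ev al n -> (forall i, (i < J)%N -> 3 * kap <= ev al n - ev al i) ->
  La * \prod_(i < J) ((ev al n - ev al i - 2 * kap) / kap) ^+ 2 <=
    4 * cc * kk 0%N ^+ 2 * 16^-1 ^+ J.
Proof.
move=> sg fg n2 nJ; have h := al0; have kp := kap0; have cp := cc0; have Lp := La0.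
have [psi [chi [mu [epsi ip0 Dpsi nchi [Hpsi Lmu]]]]] := spectral_top sg fg.
have G i : (i < J)%N -> 3 * kap <= chi - ev al i by move=> /nJ; lra.
have kc : 0 <= kap <= chi by apply/andP; split; lra.
have poh := pohozaev al0 kc epsi Dpsi.
have jac0 := jac_coeff0_le al0 kp epsi Dpsi G.
set P := \prod_(i < J) ((chi - ev al i - 2 * kap) / kap) in jac0.
set P' := \prod_(i < J) _.
have PP : P' <= P ^+ 2.
  rewrite /P' /P -prodrXl; apply: ler_prod => i _; have := nJ i (ltn_ord i) => ?.
  rewrite sqr_ge0/= lerXn2r ?nnegrE ?divr_ge0 ?(ltW kp)//; try lra.
  by rewrite ler_pM2r ?invr_gt0//; lra.
have P'0 : 0 <= P' by apply: prodr_ge0 => i _; exact: sqr_ge0.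
have mup : mu * psi 0%N = kk 0%N * rho al psi 0 by have := congr1 (fun f => f 0%N) Hpsi.
set r := rho al psi 0 in jac0 mup; set I := << psi, psi >> in poh jac0 ip0.
(* 2 kap <= e_n <= chi gives chi - kap >= chi / 2 in the Pohozaev bound. *)
have p2 : I / 2 <= psi 0%N ^+ 2.
  have chi0 : 0 < chi by lra.
  rewrite -(ler_pM2l chi0); apply: le_trans poh.
  by rewrite mulrCA mulrC ler_wpM2r ?(ltW ip0)//; lra.
have e16 : 0 <= 16^-1 ^+ J :> R by rewrite exprn_ge0.
have jac1 : P ^+ 2 * r ^+ 2 <= 2 * 16^-1 ^+ J * I.
  apply: (le_trans jac0); rewrite ler_wpM2r ?(ltW ip0)// ler_wpM2r//.
  by rewrite ger_pMr// invf_le1; lra.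
have step1 : La * psi 0%N ^+ 2 <= cc * kk 0%N ^+ 2 * r ^+ 2.
  have -> : cc * kk 0%N ^+ 2 * r ^+ 2 = cc * mu ^+ 2 * psi 0%N ^+ 2.
    by rewrite -mulrA -exprMn -mup exprMn mulrA.
  by rewrite ler_wpM2r ?sqr_ge0.
have step2 : La * P' * (I / 2) <= cc * kk 0%N ^+ 2 * (2 * 16^-1 ^+ J * I).
  apply: (@le_trans _ _ (La * psi 0%N ^+ 2 * P')).
    rewrite mulrAC -[leLHS]mulrA -[leRHS]mulrA; apply: ler_wpM2l; first exact: ltW.
    by rewrite ler_wpM2r.
  apply: (le_trans (ler_wpM2r P'0 step1)).
  have ck : 0 <= cc * kk 0%N ^+ 2 by rewrite mulr_ge0 ?sqr_ge0 ?(ltW cp).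
  rewrite -[leLHS]mulrA; apply: ler_wpM2l => //.
  by apply: le_trans jac1; rewrite mulrC ler_wpM2r ?sqr_ge0.
have I2 : 0 < I / 2 by rewrite divr_gt0.
rewrite -(ler_pM2r I2); apply: (le_trans step2).
by rewrite le_eqVlt; apply/orP; left; apply/eqP; field.
Qed.

End Spectral.

(** * The Bessel kernel *)

Section Fractional_power_series.
Context {R : realType}.
Notation mu := (@lebesgue_measure R).
Local Notation I01 := (`]0%R, 1%R[%classic : set R).
Variable al : R.
Hypothesis al0 : 0 < al.
Implicit Types (a b f : R^nat) (h : R -> R).

Definition phi (m : nat) (x : R) : R := x `^ (2 * m%:R + al + 2^-1).

Lemma phi_ge0 m x : 0 <= phi m x. Proof. exact: powR_ge0. Qed.

Lemma phi_exp_gt0 m : 0 < 2 * m%:R + al + 2^-1.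
Proof. by have := al0; have := ler0n R m; lra. Qed.

Lemma phi_le1 m x : 0 < x < 1 -> phi m x <= 1.
Proof.
move=> /andP[x0 x1]; rewrite -(powRr0 x) /phi; apply: ger_powR; last exact: ltW (phi_exp_gt0 m).
by rewrite x0 ltW.
Qed.

Lemma norm_phi_le1 m x : 0 < x < 1 -> `|phi m x| <= 1.
Proof. by move=> x01; rewrite ger0_norm ?phi_ge0// phi_le1. Qed.

Lemma measurable_phi m : measurable_fun I01 (phi m).
Proof. by rewrite /phi; exact: measurable_funTS. Qed.

Definition fps a (x : R) : R := tsum (fun m => a m * phi m x).

Lemma fps_summable a x : abs_summable a -> 0 < x < 1 -> abs_summable (fun m => a m * phi m x).
Proof.
move=> sa x01; apply: (@abs_summable_le _ _ (fun m => `|a m|)) => // m.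
by rewrite normrM ler_piMr// norm_phi_le1.
Qed.

Lemma norm_fps_le a x : abs_summable a -> 0 < x < 1 -> `|fps a x| <= tsum (fun m => `|a m|).
Proof.
move=> sa x01; apply: norm_tsum_le => [|n]; first exact: fps_summable.
apply: le_trans (series_norm_le n sa); apply: le_trans (ler_norm_sum _ _ _) _.
by apply: ler_sum => m _; rewrite normrM ler_piMr// norm_phi_le1.
Qed.

Lemma fpsZ k a x : abs_summable a -> 0 < x < 1 -> fps (fun m => k * a m) x = k * fps a x.
Proof.
move=> sa x01; rewrite /fps -(tsumZ k (fps_summable sa x01)).
by congr tsum; apply/funext => m; rewrite mulrA.
Qed.

Lemma fps_comb (I : Type) (s : seq I) (k : I -> R) (G : I -> R^nat) x :
  (forall i, abs_summable (G i)) -> 0 < x < 1 ->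
  fps (fun m => \sum_(i <- s) k i * G i m) x = \sum_(i <- s) k i * fps (G i) x.
Proof.
move=> sG x01; suff [_ ->] : abs_summable (fun m => \sum_(i <- s) k i * G i m) /\
  fps (fun m => \sum_(i <- s) k i * G i m) x = \sum_(i <- s) k i * fps (G i) x by [].
elim: s => [|i s [ss ih]].
  have -> : (fun m => \sum_(i <- [::]) k i * G i m) = (fun=> 0).
    by apply/funext => m; rewrite big_nil.
  split; first by apply: entire_abs_summable; exact: entire0.
  rewrite big_nil /fps -[RHS]tsum0; congr tsum.
  by apply/funext => m; rewrite mul0r.
have -> : (fun m => \sum_(i <- i :: s) k i * G i m) =
    (fun m => k i * G i m + \sum_(i <- s) k i * G i m).
  by apply/funext => m; rewrite big_cons.
have sk : abs_summable (fun m => k i * G i m) by exact: abs_summableZ.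
split; first exact: abs_summableD.
rewrite big_cons -ih -fpsZ// /fps -(tsumD (fps_summable sk x01) (fps_summable ss x01)).
by congr tsum; apply/funext => m; rewrite mulrDl.
Qed.

Definition moment (m : nat) h : R := \int[mu]_(t in I01) (phi m t * h t).

Lemma integrable_bounded_mul (g h : R -> R) (C : R) : measurable_fun I01 g ->
  (forall t, I01 t -> `|g t| <= C) -> mu.-integrable I01 (EFin \o h) ->
  mu.-integrable I01 (EFin \o (fun t => g t * h t)).
Proof.
move=> mg gC ih; have C0 : 0 <= C.
  have t01 : I01 (2^-1 : R) by rewrite /= in_itv/=; apply/andP; split; lra.
  exact: le_trans (gC _ t01).
have iC : mu.-integrable I01 (fun t => (C%:E * (h t)%:E)%E) by exact: integrableZl.
apply: le_integrable iC => //.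
  apply/measurable_EFinP; apply: measurable_funM => //.
  by case/integrableP : ih => /measurable_EFinP.
by move=> t tI /=; rewrite lee_fin !normrM ler_wpM2r// (le_trans (gC _ tI))// ler_norm.
Qed.

Lemma integrable_phi_mul m h : mu.-integrable I01 (EFin \o h) ->
  mu.-integrable I01 (EFin \o (fun t => phi m t * h t)).
Proof.
apply: (@integrable_bounded_mul _ _ 1); first exact: measurable_phi.
by move=> t /=; rewrite in_itv/=; exact: norm_phi_le1.
Qed.

Lemma moment_bound m h : mu.-integrable I01 (EFin \o h) ->
  `|moment m h| <= \int[mu]_(t in I01) `|h t|.
Proof.
move=> ih; have ip := integrable_phi_mul m ih.
apply: le_trans (le_normr_Rintegral _ ip) _ => //.
apply: le_Rintegral => //.
- exact: (integrable_norm ip).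
- exact: (integrable_norm ih).
by move=> t /=; rewrite in_itv/= => t01; rewrite normrM ler_piMl// norm_phi_le1.
Qed.

Lemma measurable_fps a : abs_summable a -> measurable_fun I01 (fps a).
Proof.
move=> sa; apply: (@measurable_fun_cvg _ _ _ _ (fun n t => series (fun m => a m * phi m t) n)).
  move=> n; apply: measurable_sum => m; apply: measurable_funM => //.
  exact: measurable_phi.
by move=> t /=; rewrite in_itv/= => t01; apply: tsum_cvg; exact: fps_summable.
Qed.

(** Dominated convergence: as |phi_m| <= 1 on ]0, 1[, the partial sums are at most C |h|, with C the
    sum of the |a m|. *)
Lemma integral_fps_mul a h : abs_summable a -> mu.-integrable I01 (EFin \o h) ->
  \int[mu]_(t in I01) (fps a t * h t) = tsum (fun m => a m * moment m h).
Proof.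
move=> sa ih.
pose F n t : R := series (fun m => a m * phi m t) n * h t.
have Fsum n t : F n t = \sum_(0 <= m < n) a m * (phi m t * h t).
  by rewrite /F /series/= mulr_suml; apply: eq_bigr => m _; rewrite mulrA.
have iphi m := integrable_phi_mul m ih.
have iaphi m : mu.-integrable I01 (EFin \o (fun t => a m * (phi m t * h t))).
  rewrite (_ : EFin \o _ = fun t => ((a m)%:E * (phi m t * h t)%:E)%E)//.
  by apply: integrableZl => //; exact: iphi.
have mh : measurable_fun I01 h by case/integrableP : ih => /measurable_EFinP.
pose C := tsum (fun m => `|a m|).
have iC : mu.-integrable I01 (fun t => (C%:E * `|(h t)%:E|)%E).
  by apply: integrableZl => //; exact: integrable_abse.
have mF n : measurable_fun I01 (fun t => (F n t)%:E).
  apply/measurable_EFinP; apply: measurable_funM => //.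
  apply: measurable_sum => m; apply: measurable_funM => //; exact: measurable_phi.
have mf : measurable_fun I01 (fun t => (fps a t * h t)%:E).
  by apply/measurable_EFinP; apply: measurable_funM => //; exact: measurable_fps.
have ff : {ae mu, forall t, I01 t -> (fun n => (F n t)%:E) @ \oo --> (fps a t * h t)%:E}.
  apply: aeW => t /=; rewrite in_itv/= => t01; apply: cvg_EFin; first exact: nearW.
  by apply: cvgM; [apply: tsum_cvg; exact: fps_summable|exact: cvg_cst].
have fg : {ae mu, forall t n, I01 t -> (`|(F n t)%:E| <= C%:E * `|(h t)%:E|)%E}.
  apply: aeW => t n /=; rewrite in_itv/= => t01.
  rewrite -EFinM lee_fin /F normrM ler_wpM2r//.
  apply: le_trans (series_norm_le n sa); apply: le_trans (ler_norm_sum _ _ _) _.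
  by apply: ler_sum => m _; rewrite normrM ler_piMr// norm_phi_le1.
have [i1 _ cvgF] := @dominated_convergence _ _ _ mu I01 (measurable_itv _)
  (fun n t => (F n t)%:E) (fun t => (fps a t * h t)%:E) (fun t => (C%:E * `|(h t)%:E|)%E) mF mf ff iC fg.
have IF n : (\int[mu]_(t in I01) (F n t)%:E = (series (fun m => a m * moment m h) n)%:E)%E.
  under eq_integral do rewrite Fsum -sumEFin.
  rewrite integral_sum//.
  rewrite /series/= -sumEFin; apply: eq_bigr => m _.
  rewrite /moment -RintegralZl//.
  by rewrite /Rintegral fineK//; apply: integrable_fin_num => //; exact: iaphi.
have sm : abs_summable (fun m => a m * moment m h).
  apply: (@abs_summable_le _ _ ((\int[mu]_(t in I01) `|h t|) *: (fun m => `|a m|))).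
    by move=> m; rewrite normrM mulrC ler_wpM2r// moment_bound.
  exact: is_cvg_seriesZ.
rewrite /Rintegral; have := cvgF; rewrite (_ : [sequence _]_n = EFin \o series (fun m => a m * moment m h)).
  rewrite -[X in _ --> X]fineK; last exact: integrable_fin_num.
  by move=> /fine_cvgP[_ H1]; apply: (cvg_unique _ H1) => //; exact: tsum_cvg.
by apply/funext => n /=; rewrite IF.
Qed.

Lemma integrable_fps_mul a h : abs_summable a -> mu.-integrable I01 (EFin \o h) ->
  mu.-integrable I01 (EFin \o (fun t => fps a t * h t)).
Proof.
move=> sa; apply: (@integrable_bounded_mul _ _ (tsum (fun m => `|a m|))).
  exact: measurable_fps.
by move=> t /=; rewrite in_itv/= => t01; exact: norm_fps_le.
Qed.

Lemma integrable_fps a : abs_summable a -> mu.-integrable I01 (EFin \o fps a).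
Proof.
move=> sa; have i1 : mu.-integrable I01 (EFin \o (fun=> 1 : R)).
  have := @integrable_powR01 R 0 (lexx 0).
  by apply: eq_integrable => // t _; rewrite powRr0.
have := integrable_fps_mul sa i1; apply: eq_integrable => // t _ /=.
by rewrite mulr1.
Qed.

(** The substitution u = t^2: the integral of t^(2m + 2l + 2al + 1) is half of [wt al m l]. *)
Lemma moment_fps a m : entire a -> moment m (fps a) = rho al a m / 2.
Proof.
move=> ea; have sa := entire_abs_summable ea; have h0 := al0.
have iphi : mu.-integrable I01 (EFin \o phi m).
  by have := integrable_powR01 (ltW (phi_exp_gt0 m)).
rewrite /moment (_ : \int[mu]_(t in I01) _ = \int[mu]_(t in I01) (fps a t * phi m t)); last first.
  by apply: eq_Rintegral => t _; rewrite mulrC.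
rewrite integral_fps_mul// mulrC -tsumZ; last exact: rho_summable.
congr tsum; apply/funext => l.
have -> : moment l (phi m) = (2 * m%:R + al + 2^-1 + (2 * l%:R + al + 2^-1) + 1)^-1.
  rewrite -Rintegral_powR01; last by rewrite addr_ge0// ltW// phi_exp_gt0.
  apply: eq_Rintegral => t; rewrite inE/= in_itv/= => /andP[t0 _].
  by rewrite /phi -powRD 1?addrC// gt_eqF// addr_gt0// phi_exp_gt0.
rewrite mulrCA; congr (_ * _); rewrite /wt -invfM; congr (_^-1); lra.
Qed.

End Fractional_power_series.

Section Hankel_kernel.
Context {R : realType}.
Notation mu := (@lebesgue_measure R).
Local Notation I01 := (`]0%R, 1%R[%classic : set R).
Variables (c al : R).
Hypothesis c0 : 0 < c.
Hypothesis al0 : 0 < al.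

(** Half of the coefficient of phi_m(x) phi_m(t) in the kernel: the 1/2 of [moment_fps] is built in,
    so that the Hankel operator becomes [Hop] with these coefficients. *)
Definition kcoef (m : nat) : R :=
  (-1) ^+ m / (m`!%:R * Gamma (m%:R + al + 1)) * ((c / 2) `^ (2 * m%:R + al) * Num.sqrt c) / 2.

Lemma kcoefS m : m.+1%:R * (m.+1%:R + al) * kcoef m.+1 = - (c ^+ 2 / 4) * kcoef m.
Proof.
have a0 := al0; have cp := c0; have m0 := ler0n R m.
have s1 : 1 < m%:R + al + 1 by lra.
have G0 := Gamma_gt0 s1.
have GS : Gamma (m.+1%:R + al + 1) = (m%:R + al + 1) * Gamma (m%:R + al + 1).
  have -> : m.+1%:R + al + 1 = m%:R + al + 1 + 1 by rewrite -[m.+1%:R]natr1; lra.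
  exact: GammaS.
have P : (c / 2) `^ (2 * m.+1%:R + al) = (c / 2) ^+ 2 * (c / 2) `^ (2 * m%:R + al).
  rewrite -powR_mulrn ?divr_ge0 ?(ltW cp)// -powRD.
    by congr (_ `^ _); rewrite -natr1; ring.
  have c2 : 0 < c / 2 by rewrite divr_gt0.
  by rewrite (gt_eqF c2) implybT.
rewrite /kcoef GS P factS natrM exprS.
move: (Gamma _) G0 => G G0.
have F0 : m`!%:R != 0 :> R by rewrite pnatr_eq0 -lt0n fact_gt0.
rewrite -natr1; field; rewrite F0/=; repeat (apply/andP; split); rewrite gt_eqF//; lra.
Qed.

(** By induction |a_m| <= |a_0| K^m / m!, and (K r)^m / m! <= exp(K r) + 1. *)
Lemma entire_rec (a : R^nat) (K : R) : 0 <= K -> (forall m, m.+1%:R * `|a m.+1| <= K * `|a m|) ->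
  entire a.
Proof.
move=> K0 aK r r0.
have am m : `|a m| <= `|a 0%N| * (K ^+ m / m`!%:R).
  elim: m => [|m ih]; first by rewrite expr0 fact0 divr1 mulr1.
  have m1 : 0 < m.+1%:R :> R by rewrite ltr0n.
  rewrite -(ler_pM2l m1); apply: (le_trans (aK m)).
  apply: (le_trans (ler_wpM2l K0 ih)); rewrite factS natrM exprS.
  rewrite le_eqVlt; apply/orP; left; apply/eqP; field.
  by rewrite pnatr_eq0 -lt0n fact_gt0/= addrC natr1 pnatr_eq0.
exists (`|a 0%N| * (expR (K * r) + 1)) => [|m]; first by rewrite mulr_ge0// addr_ge0// expR_ge0.
apply: (@le_trans _ _ (`|a 0%N| * (K ^+ m / m`!%:R) * r ^+ m)).
  by rewrite ler_wpM2r// exprn_ge0// ltW.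
rewrite -mulrA ler_wpM2l// mulrAC -exprMn.
have Kr : 0 <= K * r by rewrite mulr_ge0// ltW.
case: m {am} => [|m]; first by rewrite expr0 fact0 divr1 lerDr expR_ge0.
by have := expR_ge1Dxn m Kr; lra.
Qed.

Lemma entire_kcoef : entire kcoef.
Proof.
have a0 := al0; apply: (@entire_rec _ (c ^+ 2 / 4)); first by rewrite divr_ge0 ?sqr_ge0.
move=> m; have := kcoefS m; have := ler0n R m; have c4 : 0 <= c ^+ 2 / 4 by rewrite divr_ge0 ?sqr_ge0.
move: (kcoef m.+1) (kcoef m) => p q m0 E.
have -> : c ^+ 2 / 4 * `|q| = `|m.+1%:R * (m.+1%:R + al) * p|.
  by rewrite E mulNr normrN normrM (ger0_norm c4).
have m1 : 1 <= m.+1%:R + al by rewrite -[m.+1%:R]natr1; lra.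
rewrite !normrM normr_nat mulrAC ler_peMr ?mulr_ge0//.
by rewrite (ger0_norm (le_trans ler01 m1)).
Qed.

Lemma hankel_kernel (x t : R) : 0 < x < 1 -> 0 < t < 1 ->
  Num.sqrt (c * x * t) * besselJ al (c * x * t) = fps al (fun m => 2 * kcoef m * phi al m x) t.
Proof.
move=> x01 t01; have /andP[x0 x1] := x01; have /andP[t0 t1] := t01; have cp := c0.
set y := c * x * t; have y0 : 0 < y by rewrite !mulr_gt0.
have sy : 0 < Num.sqrt y by rewrite sqrtr_gt0.
pose u m := 2 * kcoef m * phi al m x * phi al m t.
have su : abs_summable u.
  apply: (fps_summable al0) => //.
  have := fps_summable al0 (entire_abs_summable (entireZ 2 entire_kcoef)) x01.
  by [].
rewrite /besselJ -[limn _]/(tsum _).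
rewrite [tsum _](_ : _ = tsum (fun m => (Num.sqrt y)^-1 * u m)); last first.
  congr tsum; apply/funext => m; rewrite /u /kcoef /phi.
  set s := 2 * m%:R + al.
  have sx z : 0 < z -> z `^ (s + 2^-1) = z `^ s * Num.sqrt z.
    by move=> z0; rewrite powRD ?(gt_eqF z0) ?implybT// powR12_sqrt// ltW.
  have -> : (y / 2) `^ s = (c / 2) `^ s * x `^ s * t `^ s.
    have -> : y / 2 = c / 2 * x * t by rewrite /y; ring.
    by rewrite !powRM// ?mulr_ge0 ?divr_ge0// ?(ltW cp)// ?(ltW x0)// ltW.
  have -> : Num.sqrt y = Num.sqrt c * Num.sqrt x * Num.sqrt t.
    by rewrite /y !sqrtrM ?mulr_ge0// ltW.
  rewrite !sx//.
  have : Num.sqrt c != 0 by rewrite gt_eqF// sqrtr_gt0.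
  have : Num.sqrt x != 0 by rewrite gt_eqF// sqrtr_gt0.
  have : Num.sqrt t != 0 by rewrite gt_eqF// sqrtr_gt0.
  move: (Num.sqrt c) (Num.sqrt x) (Num.sqrt t) (c / 2 `^ s) (x `^ s) (t `^ s) ((-1) ^+ m / _) => A B D E F G K D0 B0 A0.
  by field; rewrite D0 B0 A0.
by rewrite tsumZ// mulrA mulfV ?mul1r// gt_eqF.
Qed.


Lemma hankel_fps f x : mu.-integrable I01 (EFin \o f) -> 0 < x < 1 ->
  hankel c al f x = fps al (fun m => 2 * kcoef m * moment al m f) x.
Proof.
move=> fi x01; rewrite /hankel.
have sk : abs_summable (fun m => 2 * kcoef m * phi al m x).
  exact: (fps_summable al0 (entire_abs_summable (entireZ 2 entire_kcoef)) x01).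
transitivity (\int[mu]_(t in I01) (fps al (fun m => 2 * kcoef m * phi al m x) t * f t)).
  by apply: eq_Rintegral => t; rewrite inE/= in_itv/= => t01; rewrite hankel_kernel.
rewrite (integral_fps_mul al0 sk fi); congr tsum; apply/funext => m.
by rewrite mulrAC.
Qed.

Lemma entire_kcoef_moment f : mu.-integrable I01 (EFin \o f) ->
  entire (fun m => 2 * kcoef m * moment al m f).
Proof.
move=> fi; pose B := \int[mu]_(t in I01) `|f t|.
have -> : (fun m => 2 * kcoef m * moment al m f) = (fun m => moment al m f * (2 * kcoef m)).
  by apply/funext => m; rewrite mulrC.
apply: (@entireM_bound _ _ _ B 1) => //; first exact: entireZ entire_kcoef.
by move=> m; rewrite expr1n mulr1; exact: moment_bound.
Qed.

Lemma hankelQ_fps f x : mu.-integrable I01 (EFin \o f) -> 0 < x < 1 ->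
  hankelQ c al f x = c * fps al (Hop al kcoef (fun m => 2 * kcoef m * moment al m f)) x.
Proof.
move=> fi x01; have eb := entire_kcoef_moment fi; rewrite /hankelQ; congr (_ * _).
set b := fun m => 2 * kcoef m * moment al m f.
transitivity (hankel c al (fps al b) x).
  apply: eq_Rintegral => t; rewrite inE/= in_itv/= => t01.
  by congr (_ * _); exact: hankel_fps.
rewrite hankel_fps//; last exact: integrable_fps (entire_abs_summable eb).
congr tsum; apply/funext => m; rewrite moment_fps// /Hop; by field.
Qed.

End Hankel_kernel.

(** * From eigenfunctions in L^2(0,1) to coefficient sequences *)

Section Eigenfunctions.
Context {R : realType}.
Notation mu := (@lebesgue_measure R).
Notation um := (@unit_measure R).
Local Notation I01 := (`]0%R, 1%R[%classic : set R).

Lemma unit_measureE A : um A = mu (A `&` I01). Proof. by []. Qed.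

Lemma ae_unit_measureW (P : R -> Prop) : {ae um, forall x, P x} -> {ae mu, forall x, I01 x -> P x}.
Proof.
move=> [N [mN N0 PN]]; exists (N `&` I01); split.
- exact: measurableI.
- exact: N0.
by move=> x /= /not_implyP[xI Px]; split => //; exact: PN.
Qed.

Lemma ae_unit_measure_filter : Filter (almost_everywhere um).
Proof. exact: ae_filter_ringOfSetsType. Qed.

Lemma ae_unit_measure01 : {ae um, forall x, I01 x}.
Proof.
exists (~` I01); split => //; first exact: measurableC.
by rewrite unit_measureE setICl measure0.
Qed.

Lemma unit_measure_fin : um [set: R] \is a fin_num.
Proof.
rewrite unit_measureE setTI lebesgue_measure_itv/= lte_fin ltr01.
by rewrite -EFinB.
Qed.

Lemma L2_integrable (f : R -> R) : f \in L2 -> mu.-integrable I01 (EFin \o f).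
Proof.
move=> /(Lfun_subset12 unit_measure_fin)/Lfun1_integrable/integrableP[mf fi].
apply/integrableP; split; first exact: measurable_funTS.
apply: le_lt_trans fi.
have -> : (\int[mu]_(x in I01) `|(EFin \o f) x| = \int[um]_(x in I01) `|(EFin \o f) x|)%E.
  by apply: eq_measure_integral => A mA AI; rewrite unit_measureE setIidl.
apply: ge0_subset_integral => //.
exact: measurableT_comp.
Qed.

Variables (c al : R).
Hypothesis c0 : 0 < c.
Hypothesis al0 : 0 < al.
Local Notation kk := (kcoef c al).

(** Q sends every integrable f to a series with entire coefficients, so f = v^-1 Q f is one almost
    everywhere. Moments ignore null sets, so those of f can be computed on the series, which turns
    the equation into one on coefficients. *)
Lemma eigenfunction_fps v f : v != 0 -> L2_eigenfunction (hankelQ c al) v f ->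
  exists2 a, eigQ al c kk v a & {ae um, forall x, f x = fps al a x}.
Proof.
move=> v0 [fL Tf]; have fi := L2_integrable fL.
pose b m := 2 * kk m * moment al m f; have eb : entire b := entire_kcoef_moment c0 al0 fi.
have ek := entire_kcoef c0 al0.
pose a m := c / v * Hop al kk b m.
have ea : entire a by apply: entireZ; exact: entire_Hop.
have fa : {ae um, forall x, f x = fps al a x}.
  move: Tf ae_unit_measure01; apply: (@filterS2 _ _ ae_unit_measure_filter) => x Tx /=; rewrite in_itv/= => x01.
  have := Tx I; rewrite hankelQ_fps// => E; apply: (mulfI v0); rewrite -E.
  have sb := entire_abs_summable (entire_Hop al0 ek eb).
  rewrite (fpsZ al0 _ sb x01) mulrA; congr (_ * _).
  by field.
exists a => //; split => // m.
have ba l : b l = Hop al kk a l.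
  rewrite /Hop /b; have <- : 2 * moment al l f = rho al a l.
    have -> : moment al l f = moment al l (fps al a).
      rewrite /moment /Rintegral; congr fine; apply: ae_eq_integral => //.
      - by case/integrableP : (integrable_phi_mul al0 l fi).
      - by case/integrableP : (integrable_phi_mul al0 l (integrable_fps al0 (entire_abs_summable ea))).
      by apply: (@filterS _ _ (ae_filter_ringOfSetsType _)) (ae_unit_measureW fa) => x fx xI; rewrite fx.
    by rewrite (moment_fps al0 _ ea) mulrC divfK.
  by rewrite mulrA [2 * _]mulrC.
have -> : Hop al kk a = b by apply/funext => l; rewrite ba.
by rewrite /a; field.
Qed.

(** By linearity of [fps], a relation among the sequences is one among the functions. *)
Lemma eigenfunction_free n (F : 'I_n -> R -> R) (G : 'I_n -> R^nat) : (forall i, entire (G i)) ->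
  (forall i, {ae um, forall x, F i x = fps al (G i) x}) -> L2_free F -> lin_free G.
Proof.
move=> eG FG fF x xG i; apply: fF => //.
have H : {ae um, forall y, forall i, F i y = fps al (G i) y} by exact: (@filter_forall _ _ _ _ ae_unit_measure_filter).
move: H ae_unit_measure01; apply: (@filterS2 _ _ ae_unit_measure_filter) => y Fy /=; rewrite in_itv/= => y01 _.
have sG j := entire_abs_summable (eG j).
under eq_bigr => j _ do rewrite Fy.
rewrite -(fps_comb al0 _ _ sG y01) (_ : (fun m => _) = fun=> 0); last first.
  by apply/funext => m; rewrite xG.
by rewrite /fps -[RHS]tsum0; congr tsum; apply/funext => m; rewrite mul0r.
Qed.

End Eigenfunctions.

(** * The eigenvalue estimate *)

Section Factorial_products.
Context {R : realType}.

Lemma fact_prod_add n m : (\prod_(i < m) (n + 1 + i) * n`! = (n + m)`!)%N.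
Proof.
elim: m => [|m ih]; first by rewrite big_ord0 mul1n addn0.
by rewrite big_ord_recr/= mulnAC ih [(n + m.+1)%N]addnS factS mulnC addn1 addSn.
Qed.

(** The factor (n - i)(n + 1 + i) is e_n - e_i at al = 0, a lower bound of the gap for al > 0. *)
Lemma fact_double n : (\prod_(i < n) ((n - i) * (n + 1 + i)) = (2 * n)`!)%N.
Proof.
by rewrite big_split/= -ffact_prod ffactnn mulnC fact_prod_add mul2n addnn.
Qed.

(** The term n^n / n! of the series of exp(n) is at most exp(n). *)
Lemma fact_ge n : (n%:R / expR 1) ^+ n <= n`!%:R :> R.
Proof.
case: n => [|n]; first by rewrite expr0 fact0.
have := expR_ge1Dxn n (ler0n R n.+1).
have F0 : 0 < n.+1`!%:R :> R by rewrite ltr0n fact_gt0.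
have -> : expR n.+1%:R = expR 1 ^+ n.+1 :> R by rewrite -expRM_natl mulr1.
move=> h; rewrite exprMn exprVn ler_pdivrMr ?exprn_gt0 ?expR_gt0// mulrC.
rewrite -ler_pdivrMr//; apply: le_trans h; lra.
Qed.

End Factorial_products.

Section Eigenvalue_inequality.
Context {R : realType}.
Variables (c al : R) (lam : R^nat).
Hypothesis c0 : 0 < c.
Hypothesis al0 : 0 < al.
Hypothesis hlam : decreasing_eigenvalues (hankelQ c al) lam.
Local Notation kk := (kcoef c al).

(** The listing of multiplicities, applied to the indices i <= n with lam i = v, supplies as many
    free eigenfunctions, hence sequences. [G] is indexed by nat, with 0 past the end, so that the
    blocks of all v have one type. *)
Lemma eigenvalue_block n v : 0 < v -> exists G : nat -> R^nat,
  let s := [seq i <- iota 0 n.+1 | lam i == v] in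
  (forall j, eigQ al c kk v (G j)) /\
  forall x : nat -> R, (forall m, \sum_(j < size s) x j * G j m = 0) ->
    forall j, (j < size s)%N -> x j = 0.
Proof.
move=> v0; set s := [seq i <- iota 0 n.+1 | lam i == v].
have [|F [FE Ff]] := (hlam.2 v (size s)).1.
  exists s; split => //; first by rewrite filter_uniq// iota_uniq.
  by move=> i; rewrite mem_filter => /andP[/eqP].
have v1 : v != 0 by rewrite gt_eqF.
have /choice[A FA] : forall i, exists a, eigQ al c kk v a /\
    {ae @unit_measure R, forall x, F i x = fps al a x}.
  by move=> i; have [a] := eigenfunction_fps c0 al0 v1 (FE i); exists a.
have fA : lin_free A.
  by apply: (eigenfunction_free al0) Ff => i; [exact: (FA i).1.1|exact: (FA i).2].
exists (fun j => if insub j is Some i then A i else fun=> 0); split=> [j|x xA j js].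
  case: insubP => [i _ _|_]; first exact: (FA i).1.
  exact: eigQ0.
apply: (fA (fun i => x i) _ (Ordinal js)) => m; rewrite -[RHS](xA m).
by apply: eq_bigr => i _; rewrite valK.
Qed.

Lemma eigenvalue_product n J : 0 < lam n ->
  2 * (c ^+ 2 / 4) <= ev al n ->
  (forall i : nat, (i < J)%N -> 3 * (c ^+ 2 / 4) <= ev al n - ev al i) ->
  lam n * \prod_(i < J) ((ev al n - ev al i - 2 * (c ^+ 2 / 4)) / (c ^+ 2 / 4)) ^+ 2 <=
    4 * c * kk 0%N ^+ 2 * 16^-1 ^+ J.
Proof.
move=> l0 hn hJ; have kap0 : 0 < c ^+ 2 / 4 by rewrite divr_gt0 ?exprn_gt0.
have lge i : (i < n.+1)%N -> lam n <= lam i by move=> ?; exact: hlam.1.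
pose V := undup [seq lam i | i <- iota 0 n.+1].
have VLa v : v \in V -> lam n <= v.
  by rewrite mem_undup => /mapP[i]; rewrite mem_iota => /= /lge + ->.
have lV (i : 'I_n.+1) : lam i \in V.
  by rewrite mem_undup; apply: map_f; rewrite mem_iota ltn_ord.
pose s v := [seq i <- iota 0 n.+1 | lam i == v].
have /choice[G HG] : forall v, exists G : nat -> R^nat, 0 < v ->
    (forall j, eigQ al c kk v (G j)) /\
    forall x : nat -> R, (forall m, \sum_(j < size (s v)) x j * G j m = 0) ->
      forall j, (j < size (s v))%N -> x j = 0.
  move=> v; have [v0|_] := ltP 0 v; last by exists (fun _ _ => 0).
  by have [G HG] := eigenvalue_block n v0; exists G.
(* Index i receives the vector of its block whose rank is that of i among the indices with the same
   eigenvalue. *)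
pose g (i : 'I_n.+1) := G (lam i) (index (val i) (s (lam i))).
have lp (i : 'I_n.+1) : 0 < lam i by apply: lt_le_trans l0 _; exact: lge.
have gE (i : 'I_n.+1) : eigQ al c kk (lam i) (g i) by exact: (HG _ (lp i)).1.
have ek := entire_kcoef c0 al0.
have uV : uniq V by exact: undup_uniq.
apply: (@eigenvalue_bound _ al (c ^+ 2 / 4) c (lam n) kk V _ _ _ _ _ _ uV VLa n J g) => //.
- exact: kcoefS.
- by move=> i; exact: (spanQ_eig uV (lV i) (gE i)).
apply: (@free_glue _ al c (lam n) kk V al0 l0 ek uV VLa n.+1 (fun i => lam i) g gE lV).
move=> v x xg i iv; have v0 : 0 < v by rewrite -iv.
have us : uniq (s v) by rewrite filter_uniq// iota_uniq.
have isv : val i \in s v by rewrite mem_filter iv eqxx mem_iota/=.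
have := (HG v v0).2 (fun j => x (inord (nth 0%N (s v) j))) _ (index (val i) (s v)).
rewrite index_mem nth_index// inord_val; apply => // m.
rewrite -[RHS](xg m).
pose f (k : nat) := x (inord k) * G (lam k) (index k (s (lam k))) m.
transitivity (\sum_(0 <= k < n.+1 | lam k == v) f k); last first.
  by rewrite big_mkord; apply: eq_bigr => k _; rewrite /f inord_val.
rewrite -[RHS]big_filter /index_iota subn0 -/(s v) [RHS](big_nth 0%N) big_mkord.
apply: eq_bigr => j _; rewrite /f.
have : nth 0%N (s v) j \in s v by exact: mem_nth.
by rewrite {1}/s mem_filter => /andP[/eqP -> _]; rewrite index_uniq.
Qed.

(** The left side is the square of c (c/2)^al / Gamma(al + 1); here c <= exp(c), and [Gamma_ge] at y
    = c / 2 bounds the quotient by exp(c / 2). *)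
Lemma kcoef0_le : 4 * c * kk 0%N ^+ 2 <= expR (3 * c).
Proof.
have c2 : 0 < c / 2 by rewrite divr_gt0.
have a1 : 1 < al + 1 by have := al0; lra.
have G0 := Gamma_gt0 a1; have GE := Gamma_ge a1 c2.
have p0 : 0 < (c / 2) `^ al by exact: powR_gt0.
have -> : 4 * c * kk 0%N ^+ 2 = (c * ((c / 2) `^ al / Gamma (al + 1))) ^+ 2.
  rewrite /kcoef expr0 fact0 mulr0 !add0r mul1r mul1r.
  rewrite [in LHS]exprMn [in LHS]exprMn [in LHS]exprMn sqr_sqrtr ?(ltW c0)//.
  by field; rewrite gt_eqF.
have -> : expR (3 * c) = (expR c * expR (c / 2)) ^+ 2.
  by rewrite -expRD -expRM_natl; congr expR; field.
have q0 : 0 <= (c / 2) `^ al / Gamma (al + 1) by rewrite divr_ge0 ?(ltW p0) ?(ltW G0).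
rewrite ler_sqr ?nnegrE ?(mulr_ge0 (ltW c0) q0) ?mulr_ge0 ?expR_ge0//.
apply: ler_pM; rewrite ?(ltW c0)//.
- by have := expR_gt1Dx (lt0r_neq0 c0); lra.
- rewrite ler_pdivrMr// [leRHS]mulrC -ler_pdivrMr ?expR_gt0//.
  by move: GE; rewrite addrK expRN.
Qed.

(** J = n - r gives up the last r indices. For i < J, (n - i)(n + 1 + i) >= (r + 1) n > c^2 / (2 e),
    so the loss 2 kap = c^2 / 2 is at most a fraction e of the gap and costs a factor 1 - e. The
    factors with i >= J, at most 16 / e each, are added on both sides to complete the product. *)
Lemma eigenvalue_factorial (e : R) n : 0 < e <= 2^-1 -> 0 < lam n -> c ^+ 2 <= 2 * e * n%:R ^+ 2 ->
  lam n * ((1 - e) ^+ n * (\prod_(i < n) (16 * ((n - i) * (n + 1 + i))%:R / c ^+ 2))) ^+ 2 <=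
    expR (3 * c) * (16 / e) ^+ (2 * Num.truncn (c ^+ 2 / (2 * e * n%:R))).
Proof.
move=> /andP[e0 e1] l0 cn; have a0 := al0; have cp := c0.
have c20 : 0 < c ^+ 2 by rewrite exprn_gt0.
have n0 : (0 < n%:R :> R).
  by rewrite lt0r ler0n andbT; apply: contraTneq cn => ->; rewrite expr0n/= mulr0 -ltNge.
set r := Num.truncn _; pose J := (n - r)%N.
have en0 : 0 < 2 * e * n%:R by rewrite !mulr_gt0.
have y0 : 0 <= c ^+ 2 / (2 * e * n%:R) by rewrite divr_ge0// ltW.
have r1 : r%:R * (2 * e * n%:R) <= c ^+ 2 by rewrite -ler_pdivlMr// truncn_le.
have r2 : c ^+ 2 < r.+1%:R * (2 * e * n%:R) by rewrite -ltr_pdivrMr// truncnS_gt.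
have rn : (r <= n)%N.
  by rewrite -(ler_nat R) -(ler_pM2r en0); apply: (le_trans r1); move: cn; rewrite expr2; lra.
pose d i : R := ((n - i) * (n + 1 + i))%:R.
pose z i : R := 16 * d i / c ^+ 2.
have d0 i : 0 <= d i by exact: ler0n.
have z0 i : 0 <= z i by rewrite /z divr_ge0 ?mulr_ge0// ltW.
have dJ i : (i < J)%N -> c ^+ 2 / 2 <= e * d i.
  move=> iJ; have h : (r.+1 * n <= (n - i) * (n + 1 + i))%N.
    apply: leq_mul; first by rewrite ltn_subRL addnC -ltn_subRL.
    by rewrite -addnA leq_addr.
  have h2 : r.+1%:R * n%:R <= d i by rewrite -natrM ler_nat.
  have := ler_wpM2l (ltW e0) h2; move: r2; lra.
have evd i : (i < J)%N -> d i <= ev al n - ev al i.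
  move=> iJ; have iltn : (i < n)%N by rewrite (leq_trans iJ)// leq_subr.
  rewrite /d natrM natrB 1?ltnW// natrD natrD /ev.
  have h : 0 <= (n%:R - i%:R) * al :> R by rewrite mulr_ge0 ?ltW// subr_gt0 ltr_nat.
  lra.
have H1 : 2 * (c ^+ 2 / 4) <= ev al n.
  rewrite /ev; have h : 0 <= n%:R * (al + 1) by rewrite mulr_ge0// ltW// addr_gt0.
  have : e * n%:R ^+ 2 <= 2^-1 * n%:R ^+ 2 by rewrite ler_wpM2r// sqr_ge0.
  by move: cn h; rewrite expr2; lra.
have H2 i : (i < J)%N -> 3 * (c ^+ 2 / 4) <= ev al n - ev al i.
  move=> iJ; apply: le_trans (evd i iJ); have := dJ i iJ.
  have : e * d i <= 2^-1 * d i by rewrite ler_wpM2r.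
  lra.
have main := eigenvalue_product l0 H1 H2.
have zJ i : (i < J)%N -> ((1 - e) * z i) ^+ 2 <=
    16 * ((ev al n - ev al i - 2 * (c ^+ 2 / 4)) / (c ^+ 2 / 4)) ^+ 2.
  move=> iJ; set w := (X in 16 * X ^+ 2).
  have -> : 16 * w ^+ 2 = (4 * w) ^+ 2 by ring.
  have w1 : (1 - e) * z i <= 4 * w.
    rewrite /w /z.
    have -> : 4 * ((ev al n - ev al i - 2 * (c ^+ 2 / 4)) / (c ^+ 2 / 4)) =
      16 * (ev al n - ev al i - c ^+ 2 / 2) / c ^+ 2 by field; rewrite gt_eqF.
    rewrite mulrA ler_pM2r ?invr_gt0//; have := dJ i iJ; have := evd i iJ; lra.
  have w0 : 0 <= (1 - e) * z i by rewrite mulr_ge0//; lra.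
  by rewrite ler_sqr ?nnegrE// (le_trans w0).
have zr i : (J <= i < n)%N -> z i <= 16 / e.
  move=> /andP[Ji iltn]; rewrite /z ler_pdivrMr// mulrAC ler_pdivlMr//.
  have h : ((n - i) * (n + 1 + i) <= r * (2 * n))%N.
    apply: leq_mul; first by rewrite leq_subLR addnC -leq_subLR.
    by rewrite addn1 addSn mul2n -addnn ltn_add2l.
  have h2 : d i <= r%:R * (2 * n%:R) by rewrite -natrM -natrM ler_nat.
  have := ler_wpM2l (ltW e0) h2; lra.
have E16 : 16^-1 ^+ J * 16 ^+ J = 1 :> R by rewrite -exprMn mulVf ?expr1n.
have step : lam n * \prod_(0 <= i < J) ((1 - e) * z i) ^+ 2 <= expR (3 * c).
  have h : \prod_(0 <= i < J) ((1 - e) * z i) ^+ 2 <=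
      16 ^+ J * \prod_(i < J) ((ev al n - ev al i - 2 * (c ^+ 2 / 4)) / (c ^+ 2 / 4)) ^+ 2.
    have -> : 16 ^+ J = \prod_(i < J) (16 : R) by rewrite prodr_const card_ord.
    rewrite -big_split/= big_mkord; apply: ler_prod => i _.
    by rewrite sqr_ge0 zJ.
  apply: le_trans (ler_wpM2l (ltW l0) h) _; rewrite mulrCA.
  apply: le_trans (ler_wpM2l _ main) _; first by rewrite exprn_ge0.
  by rewrite mulrCA mulrC [16 ^+ J * _]mulrC E16 mul1r kcoef0_le.
have -> : ((1 - e) ^+ n * (\prod_(i < n) (16 * ((n - i) * (n + 1 + i))%:R / c ^+ 2))) ^+ 2 =
    \prod_(0 <= i < n) ((1 - e) * z i) ^+ 2.
  have -> : (1 - e) ^+ n = \prod_(i < n) (1 - e) by rewrite prodr_const card_ord.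
  by rewrite -big_split/= -prodrXl big_mkord.
rewrite (@big_cat_nat _ _ _ J)//=; last exact: leq_subr.
have t1 : \prod_(J <= i < n) ((1 - e) * z i) ^+ 2 <= (16 / e) ^+ (2 * r).
  have -> : (2 * r = 2 * (n - J))%N by rewrite /J subKn.
  rewrite exprM -prodr_const_nat big_nat [leRHS]big_nat; apply: ler_prod => i /zr zi.
  rewrite sqr_ge0/= ler_sqr ?nnegrE; last 2 first.
  - by rewrite mulr_ge0//; lra.
  - by rewrite divr_ge0// ltW.
  apply: le_trans zi; rewrite ler_piMl//; lra.
rewrite mulrA; apply: ler_pM => //.
- by rewrite mulr_ge0 ?(ltW l0)// prodr_ge0// => i _; rewrite sqr_ge0.
- by rewrite prodr_ge0// => i _; rewrite sqr_ge0.
Qed.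

End Eigenvalue_inequality.

Theorem corollary1 (R : realType) (a : R) (ha0 : 0 < a) (ha : a < 8 / expR 1) :
  exists M : R,
  forall (c alpha : R) (hc : 0 < c) (halpha : 1 / 2 <= alpha)
         (lam : nat -> R) (hlam : decreasing_eigenvalues (hankelQ c alpha) lam)
         (n : nat),
    c * M <= n%:R ->
    lam n <= expR (- 4 * n%:R * ln (a * n%:R / c)).
Proof.
have E0 : 0 < expR 1 :> R := expR_gt0 1.
(* [q < 1] restates a < 8 / exp 1; the factorial gives the rate Y / q = 8 n / (c exp 1), better than
   the required Y = a n / c. *)
pose q := a * expR 1 / 8.
have q0 : 0 < q by rewrite divr_gt0 ?mulr_gt0.
have q1 : q < 1 by rewrite /q ltr_pdivrMr// mul1r -ltr_pdivlMr.
have lq : ln q < 0 by rewrite ln_lt0// q0 q1.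
(* Ensures 1 - e >= q, so that the loss (1 - e)^n is no worse than q^n. *)
pose e := Num.min 2^-1 (1 - q).
have e0 : 0 < e by rewrite lt_min subr_gt0 q1 andbT; lra.
have e1 : e <= 2^-1 by rewrite ge_min lexx.
have eq1 : q <= 1 - e by have : e <= 1 - q by [rewrite ge_min lexx orbT]; lra.
pose A := ln (16 / e).
have e16 : 1 < 16 / e by rewrite ltr_pdivlMr// mul1r; lra.
have A0 : 0 <= A by rewrite ltW// ln_gt0.
(* The summands give c <= n, c <= e n, and the absorption of exp(3 c + c A / e) by q^(2n). *)
pose M := 1 + e^-1 + (3 + A / e) / (- 2 * ln q).
have lq2 : 0 < - 2 * ln q by rewrite mulNr oppr_gt0 pmulr_rlt0.
have M3 : 0 <= (3 + A / e) / (- 2 * ln q) by rewrite divr_ge0 ?addr_ge0 ?divr_ge0// ltW.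
have M2 : 0 <= e^-1 by rewrite invr_ge0 ltW.
exists M => c al c0 al1 lam hlam n hn.
have al0 : 0 < al by lra.
have M1 : 1 <= M by rewrite /M; lra.
have cn : c <= n%:R by apply: le_trans hn; rewrite ler_peMr// ltW.
have n0 : 0 < n%:R :> R by exact: lt_le_trans cn.
have Me : 1 <= e * M.
  have : e * e^-1 <= e * M by rewrite ler_pM2l// /M; lra.
  by rewrite divff// gt_eqF.
have cen : c <= e * n%:R.
  apply: le_trans (_ : c * (e * M) <= _); first by rewrite ler_peMr// ltW.
  by rewrite mulrCA ler_pM2l.
have [l0|l0] := leP (lam n) 0; first by apply: le_trans l0 _; exact: expR_ge0.
have cn2 : c ^+ 2 <= 2 * e * n%:R ^+ 2.
  have : c * c <= e * n%:R * n%:R by rewrite ler_pM// ltW.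
  have : 0 <= e * n%:R * n%:R by rewrite !mulr_ge0// ltW.
  by rewrite !expr2; lra.
have := eigenvalue_factorial c0 al0 hlam _ l0 cn2; rewrite e0 e1 => /(_ isT).
set r := Num.truncn _ => main.
pose Y := a * n%:R / c; have Y0 : 0 < Y by rewrite divr_gt0 ?mulr_gt0.
have P1 : (Y / q) ^+ (2 * n) <= \prod_(i < n) (16 * ((n - i) * (n + 1 + i))%:R / c ^+ 2).
  have -> : \prod_(i < n) (16 * ((n - i) * (n + 1 + i))%:R / c ^+ 2) =
      (4 / c) ^+ (2 * n) * (2 * n)`!%:R :> R.
    rewrite -fact_double natr_prod exprM -[n in X in X * _]card_ord -prodr_const -big_split/=.
    apply: eq_bigr => i _; field; by rewrite gt_eqF.
  have -> : Y / q = 4 / c * ((2 * n)%:R / expR 1).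
    by rewrite /Y /q natrM; field; rewrite !gt_eqF.
  rewrite exprMn ler_pM2l ?exprn_gt0 ?divr_gt0//; exact: fact_ge.
have P2 : (q ^+ n * (Y / q) ^+ (2 * n)) ^+ 2 <=
    ((1 - e) ^+ n * (\prod_(i < n) (16 * ((n - i) * (n + 1 + i))%:R / c ^+ 2))) ^+ 2.
  have p1 : 0 <= q ^+ n by rewrite exprn_ge0// ltW.
  have p2 : 0 <= (Y / q) ^+ (2 * n) by rewrite exprn_ge0// divr_ge0// ltW.
  have p3 : q ^+ n * (Y / q) ^+ (2 * n) <=
    (1 - e) ^+ n * (\prod_(i < n) (16 * ((n - i) * (n + 1 + i))%:R / c ^+ 2)).
    by rewrite ler_pM// lerXn2r// nnegrE; [exact: ltW|lra].
  have p4 := mulr_ge0 p1 p2.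
  by rewrite ler_sqr// nnegrE// (le_trans p4 p3).
have main2 := le_trans (ler_wpM2l (ltW l0) P2) main.
(* Half of the gain q^(-4n) pays for (1 - e)^(2n); the remaining q^(-2n) pays for the factors
   exponential in c. *)
have E1 : (q ^+ n * (Y / q) ^+ (2 * n)) ^+ 2 = Y ^+ (4 * n) / q ^+ (2 * n).
  have -> : (4 * n = 2 * n * 2)%N by rewrite mulnAC.
  rewrite [Y ^+ _]exprM exprMn; have -> : (Y / q) ^+ (2 * n) = Y ^+ (2 * n) / q ^+ (2 * n).
    by rewrite exprMn exprVn.
  have -> : q ^+ (2 * n) = q ^+ n * q ^+ n by rewrite mul2n -addnn exprD.
  by field; rewrite expf_neq0// gt_eqF.
have Yln : Y ^+ (4 * n) = expR (4 * n%:R * ln Y).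
  by rewrite -[in LHS](lnK Y0) -expRM_natl natrM.
have qln : q ^+ (2 * n) = expR (2 * n%:R * ln q).
  by rewrite -[in LHS](lnK q0) -expRM_natl natrM.
have eln : (16 / e) ^+ (2 * r) = expR (2 * r%:R * A).
  by rewrite /A -[in LHS](lnK (lt_trans ltr01 e16)) -expRM_natl natrM.
move: main2; rewrite E1 mulrA ler_pdivrMr ?exprn_gt0//.
have -> : expR (- 4 * n%:R * ln (a * n%:R / c)) = (Y ^+ (4 * n))^-1.
  by rewrite Yln -expRN; congr expR; rewrite -/Y; ring.
move=> main2; rewrite -[leRHS]mul1r ler_pdivlMr ?exprn_gt0//.
apply: le_trans main2 _; rewrite eln qln -!expRD -[leRHS]expR0 ler_expR.
(* From r <= c^2 / (2 e n) and c <= n: the indices given up cost only an exponential in c. *)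
have r1 : 2 * r%:R * e <= c.
  have : r%:R * (2 * e * n%:R) <= c ^+ 2.
    by rewrite -ler_pdivlMr ?mulr_gt0// truncn_le divr_ge0 ?sqr_ge0 ?mulr_ge0// ltW.
  have : c * c <= c * n%:R by rewrite ler_pM2l.
  move=> h h'; rewrite -(ler_pM2r n0); move: h h'; rewrite expr2; lra.
have r2 : 2 * r%:R * A <= c * (A / e).
  have -> : 2 * r%:R * A = 2 * r%:R * e * (A / e) by field; rewrite gt_eqF.
  by rewrite ler_wpM2r// divr_ge0// ltW.
have h1 : c * (3 + A / e) <= n%:R * (- 2 * ln q).
  apply: le_trans (_ : c * M * (- 2 * ln q) <= _); last by rewrite ler_pM2r.
  rewrite -mulrA ler_pM2l// -ler_pdivrMr// /M; lra.
lra.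
Qed.
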